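(* Let $(R,P)$ be a commutative Noetherian local ring, $I$ a proper ideal of $R$, $M$ and $N$ finitely generated $R$-modules, and $i \geq 0$ an integer. Assume that the ideal $I + \operatorname{ann}_R M + \operatorname{ann}_R N$ is $P$-primary. Then there are a polynomial $p$ in one variable with rational coefficients and an integer $n_0$ such that $$\lambda\big(\operatorname{Tor}_i^R(M/I^nM,\, N/I^nN)\big) = p(n) \quad \text{for all } n \geq n_0.$$
   Context: $\lambda$ denotes length of an $R$-module and $\operatorname{ann}_R$ denotes annihilator. *)

(* Defs.v *)
From HB Require Import structures.
From mathcomp Require Import all_boot all_algebra.
From mathcomp Require Import finmap.
From mathcomp Require Import boolp classical_sets monalg.

Set Implicit Arguments.
Unset Strict Implicit.
Unset Printing Implicit Defensive.

Import GRing.Theory.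

Local Open Scope ring_scope.
Local Open Scope quotient_scope.

(* An ideal of a commutative ring [R] is a submodule of the regular module
   [R^o]; the unit ideal is allowed, unlike in the library's [idealr_closed]. *)
Definition is_ideal (R : comNzRingType) (J : {pred R}) : Prop :=
  submod_closed (J : {pred R^o}).

Section Span.
Context (R : pzRingType) (V : lmodType R) (A : set V).

Definition span : {pred V} := fun v =>
  `[< forall S : {pred V},
        submod_closed S -> (forall a, A a -> a \in S) -> v \in S >].

Lemma span_submod_closed : submod_closed span.
Proof.
split=> [|c u v]; rewrite ?unfold_in.
  by apply/asboolP => S [].
move=> /asboolP hu /asboolP hv; apply/asboolP => S SS AS.
by apply: (SS.2); [exact: hu | exact: hv].
Qed.

HB.instance Definition _ :=
  GRing.isSubmodClosed.Build R V span span_submod_closed.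

Lemma sub_span a : A a -> a \in span.
Proof. by move=> Aa; apply/asboolP => S _; apply. Qed.

Lemma span_min (S : {pred V}) :
  submod_closed S -> (forall a, A a -> a \in S) -> {subset span <= S}.
Proof. by move=> SS AS v /asboolP; apply. Qed.

End Span.

Section QuotientModule.
Context (R : pzRingType) (V : lmodType R) (S : submodClosed V).

(* [Quotient.quot] needs closure under opposite, which [submodClosed] (phrased
   for semimodules) does not record. *)
Definition submod_zmod : {pred V} := S.
HB.instance Definition _ :=
  GRing.isZmodClosed.Build V submod_zmod (submodClosedP S : zmod_closed S).

Definition quotmod : Type := Quotient.quot submod_zmod.
HB.instance Definition _ := GRing.Zmodule.on quotmod.

Definition quotmod_pi : V -> quotmod := \pi_(Quotient.quot submod_zmod).

Lemma quotmod_piP u v : (quotmod_pi u == quotmod_pi v) = (u - v \in S).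
Proof. by rewrite -[_ \in S]/(_ \in submod_zmod) Quotient.idealrBE. Qed.

Definition quotmod_repr (x : quotmod) : V := repr (x : Quotient.quot submod_zmod).

Lemma quotmod_reprK : cancel quotmod_repr quotmod_pi.
Proof. exact: reprK. Qed.

Lemma quotmod_piD : {morph quotmod_pi : u v / u + v}.
Proof. by move=> u v; rewrite /quotmod_pi raddfD. Qed.

Definition quotmod_scale (a : R) (x : quotmod) : quotmod :=
  quotmod_pi (a *: quotmod_repr x).

Lemma quotmod_scale_pi a v :
  quotmod_scale a (quotmod_pi v) = quotmod_pi (a *: v).
Proof.
apply/eqP; rewrite quotmod_piP -scalerBr rpredZ //.
by rewrite -quotmod_piP quotmod_reprK.
Qed.

Fact quotmod_scaleA a b x :
  quotmod_scale a (quotmod_scale b x) = quotmod_scale (a * b) x.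
Proof. by rewrite -[x]quotmod_reprK !quotmod_scale_pi scalerA. Qed.

Fact quotmod_scale1 : left_id 1 quotmod_scale.
Proof. by move=> x; rewrite -[x]quotmod_reprK quotmod_scale_pi scale1r. Qed.

Fact quotmod_scaleDr : right_distributive quotmod_scale +%R.
Proof.
move=> a x y; rewrite -[x]quotmod_reprK -[y]quotmod_reprK.
by rewrite -quotmod_piD !quotmod_scale_pi scalerDr quotmod_piD.
Qed.

Fact quotmod_scaleDl x : {morph quotmod_scale^~ x : a b / a + b}.
Proof.
move=> a b; rewrite -[x]quotmod_reprK !quotmod_scale_pi.
by rewrite scalerDl quotmod_piD.
Qed.

HB.instance Definition _ := GRing.Zmodule_isLmodule.Build R quotmod
  quotmod_scaleA quotmod_scale1 quotmod_scaleDr quotmod_scaleDl.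

Fact quotmod_pi_linear : linear quotmod_pi.
Proof. by move=> a u v; rewrite quotmod_piD -quotmod_scale_pi. Qed.

HB.instance Definition _ :=
  GRing.isLinear.Build R V quotmod *:%R quotmod_pi quotmod_pi_linear.

(* The map induced by a linear map that vanishes on [S]. *)
Definition quotmod_lift (W : lmodType R) (f : V -> W) (x : quotmod) : W :=
  f (quotmod_repr x).

Lemma quotmod_lift_pi (W : lmodType R) (f : {linear V -> W}) :
  (forall v, v \in S -> f v = 0) ->
  forall v, quotmod_lift f (quotmod_pi v) = f v.
Proof.
move=> fS v; apply/eqP; rewrite -subr_eq0 -linearB; apply/eqP/fS.
by rewrite -quotmod_piP quotmod_reprK.
Qed.

Lemma quotmod_lift_linear (W : lmodType R) (f : {linear V -> W}) :
  (forall v, v \in S -> f v = 0) -> linear (quotmod_lift f).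
Proof.
move=> fS a x y; rewrite -[x]quotmod_reprK -[y]quotmod_reprK -linearP.
by rewrite !quotmod_lift_pi // linearP.
Qed.

End QuotientModule.

Section Submodule.
Context (R : pzRingType) (V : lmodType R) (S : submodClosed V).

Record submodule : Type := Submodule { subm_val :> V; _ : subm_val \in S }.
HB.instance Definition _ := [isSub for subm_val].
HB.instance Definition _ := [Choice of submodule by <:].
HB.instance Definition _ := [SubChoice_isSubLmodule of submodule by <:].

End Submodule.

Section KernelImage.
Context (R : pzRingType) (U V : lmodType R) (f : {linear U -> V}).

Definition lker_pred : {pred U} := fun u => f u == 0.

Lemma lker_submod_closed : submod_closed lker_pred.
Proof.
split=> [|a u v]; rewrite !unfold_in ?linear0 // => /eqP fu /eqP fv.
by rewrite linearP fu fv scaler0 addr0.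
Qed.

HB.instance Definition _ :=
  GRing.isSubmodClosed.Build R U lker_pred lker_submod_closed.

Definition limage_pred : {pred V} := fun v => `[< exists u, f u = v >].

Lemma limage_submod_closed : submod_closed limage_pred.
Proof.
split=> [|a _ _ /asboolP[u <-] /asboolP[v <-]].
  by apply/asboolP; exists 0; rewrite linear0.
by apply/asboolP; exists (a *: u + v); rewrite linearP.
Qed.

HB.instance Definition _ :=
  GRing.isSubmodClosed.Build R V limage_pred limage_submod_closed.

End KernelImage.

Section Homology.
Context (R : pzRingType) (U V W : lmodType R).
Context (f : {linear U -> V}) (g : {linear V -> W}).

Definition boundaries : {pred submodule (lker_pred g)} :=
  fun z => val z \in limage_pred f.

Lemma boundaries_submod_closed : submod_closed boundaries.
Proof.
have memE z : (z \in boundaries) = (val z \in limage_pred f) by [].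
split=> [|a u v]; rewrite !memE ?raddf0 ?rpred0 // => fu fv.
have -> : val (a *: u + v) = a *: val u + val v by rewrite linearP.
by apply: rpredD => //; apply: rpredZ.
Qed.

HB.instance Definition _ :=
  GRing.isSubmodClosed.Build R (submodule (lker_pred g)) boundaries
    boundaries_submod_closed.

(* [ker g / (im f :&: ker g)], i.e. the homology at [V] of the complex
   [U -f-> V -g-> W] when [g \o f = 0]. *)
Definition homology : lmodType R := quotmod boundaries.

End Homology.

(* [{malg R[K]}] is the free [R]-module with basis [<< k >>], [k : K]. *)
Section FreeModule.
Context (R : comNzRingType) (K : choiceType) (V : lmodType R) (h : K -> V).

Definition free_lift (g : {malg R[K]}) : V :=
  \sum_(k <- msupp g) g@_k *: h k.

Lemma free_liftEw (g : {malg R[K]}) (D : {fset K}) :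
  (msupp g `<=` D)%fset -> free_lift g = \sum_(k <- D) g@_k *: h k.
Proof.
move=> gD; rewrite /free_lift (big_fset_incl _ gD) // => k _ kg.
by rewrite mcoeff_outdom // scale0r.
Qed.

Lemma free_lift_linear : linear free_lift.
Proof.
move=> a u v; pose D := (msupp u `|` msupp v)%fset.
have Du : (msupp u `<=` D)%fset by apply: fsubsetUl.
have Dv : (msupp v `<=` D)%fset by apply: fsubsetUr.
have Dw : (msupp (a *: u + v) `<=` D)%fset.
  apply: fsubset_trans (msuppD_le _ _) _.
  by rewrite fsubUset Dv (fsubset_trans (msuppZ_le _ _)).
rewrite (free_liftEw Du) (free_liftEw Dv) (free_liftEw Dw) scaler_sumr.
rewrite -big_split; apply: eq_bigr => k _ /=.
by rewrite mcoeffD mcoeffZ scalerDl scalerA.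
Qed.

HB.instance Definition _ :=
  GRing.isLinear.Build R {malg R[K]} V *:%R free_lift free_lift_linear.

Lemma free_liftU k : free_lift << k >> = h k.
Proof.
rewrite (@free_liftEw _ [fset k]%fset) ?msuppU_le //.
by rewrite big_seq_fset1 mcoeffU eqxx scale1r.
Qed.

End FreeModule.

Section Tensor.
Context (R : comNzRingType).

Definition tensor_rel (M N : lmodType R) : set {malg R[(M * N)%type]} :=
  fun r =>
    [\/ exists x x' y, r = << (x + x', y) >> - << (x, y) >> - << (x', y) >>,
        exists x y y', r = << (x, y + y') >> - << (x, y) >> - << (x, y') >>,
        exists a x y, r = << (a *: x, y) >> - a *: << (x, y) >>
      | exists a x y, r = << (x, a *: y) >> - a *: << (x, y) >>].

Definition tensor (M N : lmodType R) : lmodType R :=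
  quotmod (span (@tensor_rel M N)).

Definition tens (M N : lmodType R) (x : M) (y : N) : tensor M N :=
  quotmod_pi (span (@tensor_rel M N)) << (x, y) >>.

Lemma tens_is_bilinear (M N : lmodType R) :
  (forall y : N, linear (fun x : M => tens x y)) /\
  (forall x : M, linear (fun y : N => tens x y)).
Proof.
have eq0 r : @tensor_rel M N r -> quotmod_pi (span (@tensor_rel M N)) r = 0.
  move=> rr; apply/eqP; rewrite -(linear0 (quotmod_pi (span (@tensor_rel M N)))).
  by rewrite quotmod_piP subr0 sub_span.
have Dl x x' y : tens (x + x') y = tens x y + tens x' y :> tensor M N.
  apply/eqP; rewrite -subr_eq0 opprD addrA -!linearB; apply/eqP/eq0.
  by constructor 1; exists x, x', y.
have Dr x y y' : tens x (y + y') = tens x y + tens x y' :> tensor M N.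
  apply/eqP; rewrite -subr_eq0 opprD addrA -!linearB; apply/eqP/eq0.
  by constructor 2; exists x, y, y'.
have Zl a x y : tens (a *: x) y = a *: tens x y :> tensor M N.
  apply/eqP; rewrite -subr_eq0 -linearZ -linearB; apply/eqP/eq0.
  by constructor 3; exists a, x, y.
have Zr a x y : tens x (a *: y) = a *: tens x y :> tensor M N.
  apply/eqP; rewrite -subr_eq0 -linearZ -linearB; apply/eqP/eq0.
  by constructor 4; exists a, x, y.
by split=> [y a x x' | x a y y']; rewrite (Dl, Dr) (Zl, Zr).
Qed.

Section UniversalProperty.
Context (M N V : lmodType R) (h : M -> N -> V).

Definition tensor_lift : tensor M N -> V :=
  quotmod_lift (free_lift (fun p : M * N => h p.1 p.2)).

Hypothesis h_linl : forall y, linear (h^~ y).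
Hypothesis h_linr : forall x, linear (h x).

Lemma free_lift_tensor_rel v :
  v \in span (@tensor_rel M N) -> free_lift (fun p : M * N => h p.1 p.2) v = 0.
Proof.
set fl := free_lift _; move=> vS.
suff : v \in lker_pred fl by rewrite unfold_in => /eqP.
apply: span_min vS; first exact: lker_submod_closed.
have hDl x x' y : h (x + x') y = h x y + h x' y.
  by have := h_linl y 1 x x'; rewrite !scale1r.
have hDr x y y' : h x (y + y') = h x y + h x y'.
  by have := h_linr x 1 y y'; rewrite !scale1r.
have h0l y : h 0 y = 0 by apply: (addrI (h 0 y)); rewrite -hDl !addr0.
have h0r x : h x 0 = 0 by apply: (addrI (h x 0)); rewrite -hDr !addr0.
have hZl a x y : h (a *: x) y = a *: h x y.
  by have := h_linl y a x 0; rewrite !addr0 h0l addr0.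
have hZr a x y : h x (a *: y) = a *: h x y.
  by have := h_linr x a y 0; rewrite !addr0 h0r addr0.
move=> r; rewrite unfold_in /fl.
case=> [[x [x' [y ->]]]|[x [y [y' ->]]]|[a [x [y ->]]]|[a [x [y ->]]]];
  rewrite !linearB /= ?linearZ /= !free_liftU /=.
- by rewrite hDl addrAC addrK subrr.
- by rewrite hDr addrAC addrK subrr.
- by rewrite hZl scalerN subrr.
- by rewrite hZr scalerN subrr.
Qed.

Lemma tensor_lift_linear : linear tensor_lift.
Proof. exact: quotmod_lift_linear free_lift_tensor_rel. Qed.

Lemma tensor_liftE x y : tensor_lift (tens x y) = h x y.
Proof.
rewrite /tensor_lift /tens.
by rewrite (quotmod_lift_pi free_lift_tensor_rel) /= free_liftU.
Qed.

End UniversalProperty.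

Section Functoriality.
Context (M M' N : lmodType R) (f : {linear M -> M'}).

Definition tensor_map : tensor M N -> tensor M' N :=
  tensor_lift (fun x y => tens (f x) y).

Let linl y : linear (fun x => tens (f x) y : tensor M' N).
Proof. by move=> a u v; rewrite linearP (tens_is_bilinear _ _).1. Qed.

Let linr x : linear (fun y => tens (f x) y : tensor M' N).
Proof. exact: (tens_is_bilinear _ _).2. Qed.

HB.instance Definition _ := GRing.isLinear.Build R (tensor M N) (tensor M' N)
  *:%R tensor_map (tensor_lift_linear linl linr).

Lemma tensor_mapE x y : tensor_map (tens x y) = tens (f x) y.
Proof. exact: tensor_liftE linl linr x y. Qed.

End Functoriality.
End Tensor.

Arguments tensor_map {R M M'} N f.

Section Resolution.
Context (R : comNzRingType).

Definition augmentation (N : lmodType R) : {linear {malg R[N]} -> N} :=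
  free_lift (@idfun N).

(* The standard free resolution [... -> F_1 -> F_0 -> M -> 0]: [F_n] is the
   free module on the underlying set of the [n]-th syzygy module [K_n], where
   [K_0 = M] and [K_(n+1) = ker (F_n -> K_n)]. *)
Fixpoint syzygy (M : lmodType R) (n : nat) : lmodType R :=
  if n is n'.+1 then submodule (lker_pred (augmentation (syzygy M n'))) else M.

Definition resolution (M : lmodType R) (n : nat) : lmodType R :=
  {malg R[syzygy M n]}.

Definition syzygy_incl (M : lmodType R) (n : nat) :
  {linear syzygy M n.+1 -> resolution M n} := val.

Definition resolution_diff (M : lmodType R) (n : nat) :
    {linear resolution M n.+1 -> resolution M n} :=
  syzygy_incl M n \o augmentation (syzygy M n.+1).

Lemma augmentation_surj (N : lmodType R) y : exists g, augmentation N g = y.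
Proof. by exists << y >>; rewrite /augmentation /= free_liftU. Qed.

Lemma resolution_exact0 (M : lmodType R) (x : resolution M 0) :
  augmentation M x = 0 <-> exists y, resolution_diff M 0 y = x.
Proof.
split=> [x0|[y <-]].
  have xK : x \in lker_pred (augmentation (syzygy M 0)) by rewrite unfold_in; apply/eqP.
  have [g gE] := augmentation_surj (Submodule xK : syzygy M 1).
  by exists g; rewrite /resolution_diff /= gE.
exact/eqP/(valP (augmentation (syzygy M 1) y)).
Qed.

Lemma resolution_exact (M : lmodType R) n (x : resolution M n.+1) :
  resolution_diff M n x = 0 <-> exists y, resolution_diff M n.+1 y = x.
Proof.
split=> [x0|[y <-]].
  have xK : x \in lker_pred (augmentation (syzygy M n.+1)).
    by rewrite unfold_in; apply/eqP/val_inj; rewrite raddf0.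
  have [g gE] := augmentation_surj (Submodule xK : syzygy M n.+2).
  by exists g; rewrite /resolution_diff /= gE.
rewrite /resolution_diff /=.
by have /eqP -> := valP (augmentation (syzygy M n.+2) y).
Qed.

(* The differential of [F (x) N] leaving degree [i]. In degree 0 the codomain is
   immaterial, since the map is zero. *)
Definition tor_diff (M N : lmodType R) (i : nat) :
    {linear tensor (resolution M i) N -> tensor (resolution M i.-1) N} :=
  match i with
  | 0 => \0
  | i'.+1 => tensor_map N (resolution_diff M i')
  end.

Definition Tor (i : nat) (M N : lmodType R) : lmodType R :=
  homology (tensor_map N (resolution_diff M i)) (tor_diff M N i).

End Resolution.

Section Length.
Context (R : pzRingType) (V : lmodType R).

Definition submodule_chain (k : nat) (S : nat -> {pred V}) : Prop :=
  (forall j, (j <= k)%N -> submod_closed (S j)) /\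
  (forall j, (j < k)%N -> {subset S j <= S j.+1} /\ ~ {subset S j.+1 <= S j}).

(* [V] has finite length [k]: [k] is the largest length of a strictly increasing
   chain of submodules of [V]. *)
Definition has_length (k : nat) : Prop :=
  (exists S, submodule_chain k S) /\
  (forall m S, submodule_chain m S -> (m <= k)%N).

Lemma has_length_inj k k' : has_length k -> has_length k' -> k = k'.
Proof.
move=> [[S Sk] k_max] [[S' Sk'] k'_max].
by apply/eqP; rewrite eqn_leq (k'_max k S Sk) (k_max k' S' Sk').
Qed.

End Length.

Section FinitelyGenerated.
Context (R : pzRingType) (V : lmodType R).

Definition fin_gen_sub (S : {pred V}) : Prop :=
  exists s : seq V, S =i span (fun v => v \in s).

Definition fin_gen : Prop := fin_gen_sub predT.

Definition scale_sub (J : {pred R}) (S : {pred V}) : {pred V} :=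
  span (fun w => exists a v, [/\ a \in J, v \in S & w = a *: v]).

HB.instance Definition _ J S := GRing.SubmodClosed.on (scale_sub J S).

Definition annihilator : {pred R} := fun a => `[< forall v : V, a *: v = 0 >].

End FinitelyGenerated.

Section Ideals.
Context (R : comNzRingType).
Implicit Types I J P Q : {pred R}.

Fixpoint ideal_pow I (n : nat) : {pred R} :=
  if n is n'.+1 then @scale_sub R R^o I (ideal_pow I n') else predT.

Definition ideal_add I J : {pred R} :=
  fun a => `[< exists x y, [/\ x \in I, y \in J & a = x + y] >].

Definition radical I : {pred R} := fun a => `[< exists n, a ^+ n \in I >].

(* [idealr_closed] includes properness, so the exponent below is positive. *)
Definition primary_ideal Q : Prop :=
  idealr_closed Q /\
  forall a b, a * b \in Q -> a \in Q \/ exists n, b ^+ n \in Q.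

Definition is_primary_to P Q : Prop := primary_ideal Q /\ radical Q =i P.

Definition maximal_ideal P : Prop :=
  idealr_closed P /\
  forall J, idealr_closed J -> {subset P <= J} -> J =i P.

Definition noetherian : Prop :=
  forall J, is_ideal J -> @fin_gen_sub R R^o J.

Definition local_ring P : Prop :=
  maximal_ideal P /\ forall P', maximal_ideal P' -> P' =i P.

End Ideals.

Arguments noetherian : clear implicits.

Definition quot_pow (R : comNzRingType) (I : {pred R}) (n : nat)
    (M : lmodType R) : lmodType R :=
  quotmod (@scale_sub R M (ideal_pow I n) predT).

(* Main.v *)
Require Import Defs.
From Stdlib Require List.
From HB Require Import structures.
From mathcomp Require Import all_boot all_algebra.
From mathcomp Require Import finmap.
From mathcomp Require Import boolp classical_sets monalg.

(* A graded resolution, over R[T_1, ..., T_r] with T_a acting as the a-th generator of I, of the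
   family (I^n M)_n has pieces that resolve I^n M over R.  The inclusions I^n M -> M lift to maps
   phi from the degree n strand to the degree 0 strand with phi T_a = f_a phi, and the mapping
   cone of phi resolves M / I^n M.  After tensoring with N / I^n N, the length of the homology of
   the cone splits as an alternating sum of lengths of the homology of the two strands modulo I^n
   and of the images of phi on them.  Each of these is a length of a subquotient of one fixed
   module V, assembled from families of submodules indexed by degrees (n, m) and stable under the
   commuting operators T_a (which raise n) and f_a (which raise m).  Such families are noetherian
   by the argument of Hilbert's basis theorem, so the lengths on the diagonal, and their sums over
   m < n, are eventually polynomial.  The strands have homology of finite length because it is
   killed by powers of I, by ann M (through homotopies on the resolution) and by ann N. *)

Set Implicit Arguments.
Unset Strict Implicit.
Unset Printing Implicit Defensive.

Import GRing.Theory Num.Theory.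
Local Open Scope classical_set_scope.
Local Open Scope ring_scope.

(** * Submodules and lengths of subquotients *)

(** Both arguments of Tor change with n, so the modules in question form no evident graded module
    over a Rees algebra. Only [M] is resolved: the pieces of the graded resolution are free over
    [R], hence tensoring them with N/I^nN amounts to reducing their tensor product with [N] modulo
    I^n, and the second argument enters only through powers of I. The degree n of a strand and the
    exponent m of I stay independent because Tor sees only n = m, whereas the Hilbert function
    argument has to move in each direction separately. Finite length is available for homology, not
    for the strands modulo I^m, so each Hilbert function is that of a subquotient of homology. It is
    presented inside a finitely generated family: through true cycles where possible, and otherwise
    through the image under the differential, which lies in I^m times the next strand. The sums over
    m < n come from filtering true cycles by powers of I. All levels share one free module with
    generators indexed by [nat], which lets sums, images and intersections be handled as plain
    sets. *)

Lemma In_mem (T : eqType) (s : seq T) (x : T) : List.In x s <-> x \in s.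
Proof.
elim: s => //= y s IH; rewrite inE; split=> [[->|/IH ->]|/predU1P[->|/IH]]; rewrite ?eqxx ?orbT //.
  by left.
by right.
Qed.

Section Submodules.
Context (R : pzRingType).
Implicit Types U V W : lmodType R.

Definition is_sub V (S : set V) : Prop :=
  S 0 /\ forall a u v, S u -> S v -> S (a *: u + v).

Section Closure.
Context V (S : set V) (SS : is_sub S).

Lemma is_sub0 : S 0. Proof. exact: SS.1. Qed.

Lemma eq0_sub x : x = 0 -> S x. Proof. by move=> ->; apply: is_sub0. Qed.

Lemma is_subD u v : S u -> S v -> S (u + v).
Proof. by move=> Su Sv; rewrite -[u]scale1r; apply: SS.2. Qed.

Lemma is_subZ a u : S u -> S (a *: u).
Proof. by move=> Su; rewrite -[_ *: _]addr0; apply: SS.2 => //; apply: SS.1. Qed.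

Lemma is_subN u : S u -> S (- u).
Proof. by move=> Su; rewrite -scaleN1r; apply: is_subZ. Qed.

Lemma is_subB u v : S u -> S v -> S (u - v).
Proof. by move=> Su Sv; apply: is_subD => //; apply: is_subN. Qed.

Lemma is_sub_sum (I : Type) (r : seq I) (P : pred I) (F : I -> V) :
  (forall i, P i -> S (F i)) -> S (\sum_(i <- r | P i) F i).
Proof.
by move=> SF; elim/big_rec: _ => [|i x Pi Sx]; [exact: is_sub0 | apply: is_subD => //; apply: SF].
Qed.

End Closure.

Definition sub_add V (A B : set V) : set V :=
  [set x | exists a b, [/\ A a, B b & x = a + b]].

Lemma sub_add_is_sub V (A B : set V) : is_sub A -> is_sub B -> is_sub (sub_add A B).
Proof.
move=> SA SB; split=> [|c _ _ [a [b [Aa Bb ->]]] [a' [b' [Aa' Bb' ->]]]].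
  by exists 0, 0; rewrite addr0; split; [exact: is_sub0 SA | exact: is_sub0 SB |].
exists (c *: a + a'), (c *: b + b'); split; [exact: SA.2 | exact: SB.2 |].
by rewrite scalerDr addrACA.
Qed.

Lemma sub_addl V (A B : set V) : is_sub B -> A `<=` sub_add A B.
Proof. by move=> SB x Ax; exists x, 0; rewrite addr0; split=> //; apply: is_sub0 SB. Qed.

Lemma sub_addr V (A B : set V) : is_sub A -> B `<=` sub_add A B.
Proof. by move=> SA x Bx; exists 0, x; rewrite add0r; split=> //; apply: is_sub0 SA. Qed.

Lemma sub_add_min V (A B S : set V) :
  is_sub S -> A `<=` S -> B `<=` S -> sub_add A B `<=` S.
Proof. by move=> SS AS BS x [a [b [/AS Sa /BS Sb ->]]]; apply: is_subD. Qed.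

Lemma setI_is_sub V (A B : set V) : is_sub A -> is_sub B -> is_sub (A `&` B).
Proof.
move=> SA SB; split=> [|c u v [Au Bu] [Av Bv]].
  by split; [exact: is_sub0 SA | exact: is_sub0 SB].
by split; [exact: SA.2 | exact: SB.2].
Qed.

Lemma preimage_is_sub V W (f : {linear V -> W}) (B : set W) :
  is_sub B -> is_sub (f @^-1` B).
Proof.
move=> SB; split=> [|c u v]; rewrite /preimage /=; first by rewrite linear0; apply: is_sub0 SB.
by move=> Bu Bv; rewrite linearP; apply: SB.2.
Qed.

Lemma image_is_sub V W (f : {linear V -> W}) (A : set V) :
  is_sub A -> is_sub (f @` A).
Proof.
move=> SA; split=> [|c _ _ [u Au <-] [v Av <-]].
  by exists 0; [exact: is_sub0 SA | rewrite linear0].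
by exists (c *: u + v); [exact: SA.2 | rewrite linearP].
Qed.

Lemma set0_is_sub V : is_sub [set (0 : V)].
Proof. by split=> [|a u v -> ->] //=; rewrite scaler0 addr0. Qed.

Lemma setT_is_sub V : is_sub [set: V].
Proof. by []. Qed.

Lemma fixed_is_sub V (g : {linear V -> V}) : is_sub [set v | g v = v].
Proof. by split=> [|a u v /= gu gv]; rewrite /= ?linear0 // linearP gu gv. Qed.

End Submodules.

(** * Length of a subquotient, measured by chains between two submodules *)

Section Length.
Context (R : pzRingType).
Implicit Types V W : lmodType R.

Definition chain V (Z Y : set V) (k : nat) (S : nat -> set V) : Prop :=
  (forall j, (j <= k)%N -> [/\ is_sub (S j), Z `<=` S j & S j `<=` Y]) /\
  (forall j, (j < k)%N -> S j `<=` S j.+1 /\ ~ S j.+1 `<=` S j).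

Definition len_is V (Z Y : set V) (k : nat) : Prop :=
  (exists S, chain Z Y k S) /\ forall m S, chain Z Y m S -> (m <= k)%N.

Definition fin_len V (Z Y : set V) : Prop := exists k, len_is Z Y k.

(** The value is 0 when [Y / Z] has no finite length, so additivity has to carry [fin_len] along. *)
Definition len V (Z Y : set V) : nat := xget 0 [set k | len_is Z Y k].

Lemma len_is_inj V (Z Y : set V) k k' : len_is Z Y k -> len_is Z Y k' -> k = k'.
Proof.
move=> [[S Sk] k_max] [[S' Sk'] k'_max].
by apply/eqP; rewrite eqn_leq (k'_max k S Sk) (k_max k' S' Sk').
Qed.

Lemma lenP V (Z Y : set V) : fin_len Z Y -> len_is Z Y (len Z Y).
Proof. by case=> k Zk; rewrite /len; apply: (xgetPex 0%N); exists k. Qed.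

Lemma len_eq V (Z Y : set V) k : len_is Z Y k -> len Z Y = k.
Proof. by move=> Yk; apply: len_is_inj (Yk); apply: lenP; exists k. Qed.

Lemma fin_len_bound V (Z Y : set V) k : is_sub Z -> Z `<=` Y ->
  (forall m S, chain Z Y m S -> (m <= k)%N) -> fin_len Z Y.
Proof.
move=> SZ ZY bnd; have ex0 : exists m, `[< exists S, chain Z Y m S >].
  by exists 0%N; apply/asboolP; exists (fun=> Z); split=> [j _|j]; [split | rewrite ltn0].
have bnd' m : `[< exists S, chain Z Y m S >] -> (m <= k)%N.
  by move=> /asboolP[S]; apply: bnd.
case: (ex_maxnP ex0 bnd') => m /asboolP mS m_max; exists m; split=> // m' S' S'm'.
by apply: m_max; apply/asboolP; exists S'.
Qed.

Lemma len_is_transfer V W (Z Y : set V) (Z' Y' : set W) :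
  (forall k, (exists S, chain Z Y k S) <-> (exists S, chain Z' Y' k S)) ->
  forall k, len_is Z Y k <-> len_is Z' Y' k.
Proof.
move=> E k; split=> -[/E ex bnd]; split=> // m S mS.
  by have [S' /bnd] : exists S, chain Z Y m S by apply/E; exists S.
by have [S' /bnd] : exists S, chain Z' Y' m S by apply/E; exists S.
Qed.

(* [f] induces an isomorphism [Y / K = Y' / Z'] of subquotients. *)
Lemma len_is_map V W (f : {linear V -> W}) (K Y : set V) (Z' Y' : set W) :
  is_sub Y -> is_sub Z' ->
  (forall v, K v <-> Y v /\ Z' (f v)) ->
  (forall w, Y' w <-> exists v z, [/\ Y v, Z' z & w = f v + z]) ->
  forall k, len_is K Y k <-> len_is Z' Y' k.
Proof.
move=> SY SZ' KE Y'E; apply: len_is_transfer => k; split=> -[S [Sin Slt]].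
  exists (fun j => sub_add (f @` S j) Z'); split=> j jk.
    have [Sj KS SjY] := Sin j jk; have SfS := image_is_sub f Sj; split.
    - exact: sub_add_is_sub.
    - exact: sub_addr.
    - move=> _ [_ [z [[v Sv <-] Zz ->]]]; apply/Y'E; exists v, z; split=> //; exact: SjY.
  have [SS nS] := Slt j jk; have [Sj KS _] := Sin j (ltnW jk).
  have [Sj1 _ SY1] := Sin j.+1 jk.
  split=> [_ [_ [z [[v Sv <-] Zz ->]]]|le].
    by exists (f v), z; split=> //; exists v => //; apply: SS.
  apply: nS => s Ss; have [|_ [z [[t St <-] Zz fsE]]] := le (f s).
    by apply: (sub_addl SZ'); exists s.
  rewrite -[s](subrK t); apply: (is_subD Sj) => //; apply: KS; apply/KE; split.
    by apply: (is_subB SY); [exact: SY1 | apply: SY1; apply: SS].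
  by rewrite linearB fsE addrAC subrr add0r.
exists (fun j => Y `&` f @^-1` S j); split=> j jk.
  have [Sj ZS SjY] := Sin j jk; split=> [||v []//].
    by apply: setI_is_sub => //; apply: preimage_is_sub.
  by move=> v /KE[Yv Zv]; split=> //; apply: ZS.
have [SS nS] := Slt j jk; have [Sj ZS _] := Sin j (ltnW jk).
have [Sj1 ZS1 SY1] := Sin j.+1 jk.
split=> [v [Yv Sv]|le]; first by split=> //; apply: SS.
apply: nS => x Sx; have /SY1/Y'E[y [z [Yy Zz xE]]] := Sx.
have fyE : f y = x - z by rewrite xE addrK.
rewrite -[x](subrK z) -fyE; apply: (is_subD Sj); last exact: ZS.
by case: (le y) => //; split=> //; rewrite /preimage /= fyE; apply: (is_subB Sj1) => //; apply: ZS1.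
Qed.

Lemma len_map V W (f : {linear V -> W}) (K Y : set V) (Z' Y' : set W) :
  is_sub Y -> is_sub Z' ->
  (forall v, K v <-> Y v /\ Z' (f v)) ->
  (forall w, Y' w <-> exists v z, [/\ Y v, Z' z & w = f v + z]) ->
  (fin_len K Y <-> fin_len Z' Y') /\ len K Y = len Z' Y'.
Proof.
move=> SY SZ' KE Y'E; have E := len_is_map SY SZ' KE Y'E; split.
  by split=> -[k /E]; exists k.
by rewrite /len; congr xget; apply/seteqP; split=> k /E.
Qed.

Section Additivity.
Context V (Z Y X : set V).
Hypotheses (SZ : is_sub Z) (SY : is_sub Y) (SX : is_sub X).
Hypotheses (ZY : Z `<=` Y) (YX : Y `<=` X).

Lemma chain_cat k l S T : chain Z Y k S -> chain Y X l T ->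
  exists U, chain Z X (k + l) U.
Proof.
move=> [Sin Slt] [Tin Tlt].
(* Index [k] carries [Y] itself, since neither the top of [S] nor the bottom of [T] has to equal
   [Y]. *)
exists (fun j => if (j < k)%N then S j else if j == k then Y else T (j - k)%N).
have TE j : (k <= j)%N -> (j <= k + l)%N -> (j - k <= l)%N by rewrite leq_subLR.
split=> j jkl.
  case: ltnP => jk; first by have [? ? SjY] := Sin j (ltnW jk); split=> // x /SjY/YX.
  case: eqP => [_|_]; first by split.
  by have [? YT ?] := Tin _ (TE _ jk jkl); split=> // x /ZY/YT.
case: (ltngtP j k) => [jk|kj|jE].
- have [SS nS] := Slt j jk; have [_ _ SjY] := Sin j (ltnW jk).
  case: (ltngtP j.+1 k) => [//|/(leq_trans jk)|jE]; first by rewrite ltnn.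
  by split=> // YS; apply: nS => x; rewrite jE => Sx; apply: YS; have [_ _] := Sin k (leqnn k); apply.
- rewrite ltnNge ltnW //= ?(leq_trans kj) // (gtn_eqF (leq_trans kj _)) // subSn 1?ltnW //.
  by apply: Tlt; rewrite ltn_subLR // ltnW.
- rewrite jE in jkl *; rewrite ltnNge leqnSn /= gtn_eqF // subSnn.
  have l0 : (0 < l)%N by move: jkl; rewrite -{1}[k]addn0 ltn_add2l.
  have [TT nT] := Tlt 0%N l0; have [S0 Y0 _] := Tin 0%N (leq0n _).
  by split=> [x /Y0/TT//|le]; apply: nT => x /le/Y0.
Qed.

Definition strict_steps (S : nat -> set V) k :=
  count (fun j => ~~ `[< S j.+1 `<=` S j >]) (iota 0 k).

(** Repetitions are dropped one at a time; the equality of the top terms lets the induction append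
    the next strict step. *)
Lemma weak_chain (A B : set V) k S :
  (forall j, (j <= k)%N -> [/\ is_sub (S j), A `<=` S j & S j `<=` B]) ->
  (forall j, (j < k)%N -> S j `<=` S j.+1) ->
  exists T, chain A B (strict_steps S k) T /\ T (strict_steps S k) = S k.
Proof.
elim: k => [|k IH] Sin Sle; first by exists S; split=> //; split=> [j|//]; rewrite leqn0 => /eqP->; apply: Sin.
have [||T [[Tin Tlt] Tk]] := IH; [by move=> j /leqW/Sin | by move=> j /leqW/Sle |].
rewrite /strict_steps -addn1 iotaD count_cat /= -/(strict_steps S k) add0n addn0.
case: asboolP => le /=; rewrite ?addn0 ?addn1.
  exists T; split=> //; rewrite Tk; apply/seteqP; split=> //; exact: Sle.
set c := strict_steps S k in T Tin Tlt Tk *.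
exists (fun j => if (j <= c)%N then T j else S k.+1); rewrite ltnn; split=> //.
split=> j jc; first by case: leqP => jc'; [exact: Tin | exact: Sin].
rewrite ltnS in jc; rewrite jc; case: ltnP => jc'; first exact: Tlt.
have -> : j = c by apply/eqP; rewrite eqn_leq jc.
by rewrite Tk; split=> //; apply: Sle.
Qed.

Lemma strict_steps_full A B k S : chain A B k S -> strict_steps S k = k.
Proof.
move=> [_ Slt]; rewrite /strict_steps -[RHS](size_iota 0 k); apply/eqP; rewrite -all_count.
by apply/allP => j; rewrite mem_iota add0n => /andP[_ /Slt[_ nS]]; apply/asboolPn.
Qed.

(** By the modular law a strict step of [S] stays strict after intersection with [Y] or after
    addition of [Y], and each of these two weak chains is bounded. *)
Lemma chain_bound k l : (forall m S, chain Z Y m S -> (m <= k)%N) ->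
  (forall m S, chain Y X m S -> (m <= l)%N) ->
  forall m S, chain Z X m S -> (m <= k + l)%N.
Proof.
move=> bk bl m S cS; have [Sin Slt] := cS.
pose S1 j := S j `&` Y; pose S2 j := sub_add (S j) Y.
have [||T1 [/bk c1 _]] := @weak_chain Z Y m S1.
- move=> j /Sin[SS ZS _]; split=> [||x []//]; first exact: setI_is_sub.
  by move=> x Zx; split; [exact: ZS | exact: ZY].
- by move=> j /Slt[SS _] x [Sx Yx]; split=> //; apply: SS.
have [||T2 [/bl c2 _]] := @weak_chain Y X m S2.
- move=> j /Sin[SS _ SX']; split; [exact: sub_add_is_sub | exact: sub_addr |].
  exact: sub_add_min.
- by move=> j /Slt[SS _] _ [x [y [Sx Yy ->]]]; exists x, y; split=> //; apply: SS.
apply: leq_trans (leq_add c1 c2); rewrite -{1}(strict_steps_full cS) /strict_steps.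
have := Slt; move: (Sin); elim: (m) => [//|n IH] Sin' Slt'.
rewrite -addn1 iotaD !count_cat /= !add0n !addn0 addnACA leq_add //.
  by apply: IH => j /leqW; [exact: Sin' | exact: Slt'].
case: asboolP => // nS; case: asboolP => // le1; case: asboolP => // le2; case: nS => x Sx.
have [Sn1 _ _] := Sin' n.+1 (leqnn _); have [Sn _ _] := Sin' n (leqnSn _).
have [SS _] := Slt' n (ltnSn _).
have [|y [z [Sy Yz xE]]] := le2 x; first exact: (sub_addl SY).
rewrite xE; apply: is_subD => //.
have zE : z = x - y by rewrite xE addrAC subrr add0r.
have Sz : S n.+1 z by rewrite zE; apply: (is_subB Sn1) => //; apply: SS.
by have [] : S1 n z by apply: le1.
Qed.

Lemma len_is_add k l : len_is Z Y k -> len_is Y X l -> len_is Z X (k + l).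
Proof.
move=> [[S cS] bk] [[T cT] bl]; split; first exact: chain_cat cS cT.
exact: chain_bound.
Qed.

Lemma fin_lenE : fin_len Z X <-> fin_len Z Y /\ fin_len Y X.
Proof.
split=> [[k [_ bk]]|[[k Yk] [l Xl]]]; last by exists (k + l)%N; apply: len_is_add.
split; apply: (@fin_len_bound _ _ _ k) => // m S [Sin Slt]; apply: (bk m S); split=> // j /Sin[? ? ?].
  by split=> // x; move/(_ x): YX; auto.
by split=> // x; move/(_ x): ZY; auto.
Qed.

Lemma len_add : fin_len Z X -> len Z X = (len Z Y + len Y X)%N.
Proof. by move=> /fin_lenE[/lenP Yk /lenP Xl]; apply/len_eq/len_is_add. Qed.

End Additivity.

End Length.

(** * Noetherian families of submodules indexed by pairs of degrees *)

Section Graded.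
Context (R : comNzRingType) (V : lmodType R).

Definition degree : Type := (nat * nat)%type.

Definition shift (b : bool) (d : degree) : degree :=
  if b then (d.1.+1, d.2) else (d.1, d.2.+1).

Lemma shift_inj b : injective (shift b).
Proof. by case: b => -[n m] [n' m'] [-> ->]. Qed.

Lemma shiftC b c d : shift b (shift c d) = shift c (shift b d).
Proof. by case: b; case: c. Qed.

Lemma iter_shiftC k b c d : iter k (shift b) (shift c d) = shift c (iter k (shift b) d).
Proof. by elim: k => //= k ->; rewrite shiftC. Qed.

Lemma iter_shift_inj k b : injective (iter k (shift b)).
Proof. by elim: k => [|k IH] d d' //= /shift_inj/IH. Qed.

(* A homogeneous operator: [true] raises the first degree, [false] the second. *)
Definition hop : Type := ({linear V -> V} * bool)%type.

Implicit Types (ops : seq hop) (W X Y Z : degree -> set V) (s : seq (degree * V)).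

Definition fam ops X : Prop :=
  (forall d, is_sub (X d)) /\
  forall o, List.In o ops -> forall d v, X d v -> X (shift o.2 d) (o.1 v).

Definition lef X Y : Prop := forall d, X d `<=` Y d.

Definition commuting ops : Prop :=
  forall o p, List.In o ops -> List.In p ops -> forall v, o.1 (p.1 v) = p.1 (o.1 v).

Definition zero_fam : degree -> set V := fun=> [set 0].

Definition gspan ops s : degree -> set V := fun d v =>
  forall X, fam ops X -> (forall p, List.In p s -> X p.1 p.2) -> X d v.

(** The ascending chain condition for [Y / Z]. Keeping both bounds lets subquotients inherit it by
    mere inclusion. *)
Definition noeth ops Z Y : Prop :=
  forall W : nat -> degree -> set V,
    (forall j, [/\ fam ops (W j), lef Z (W j) & lef (W j) Y]) ->
    (forall j, lef (W j) (W j.+1)) ->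
    exists j0, forall j, (j0 <= j)%N -> lef (W j) (W j0).

Lemma lef_trans X Y Z : lef X Y -> lef Y Z -> lef X Z.
Proof. by move=> XY YZ d x /XY/YZ. Qed.

Lemma lef_mono (W : nat -> degree -> set V) :
  (forall j, lef (W j) (W j.+1)) -> forall i j, (i <= j)%N -> lef (W i) (W j).
Proof.
move=> Wle i j /subnK <-; elim: (j - i)%N => [|k IH]; first by move=> d x.
by rewrite addSn; apply: lef_trans IH (Wle _).
Qed.

Lemma noeth_sub ops Z Y Z' Y' : noeth ops Z Y -> lef Z Z' -> lef Y' Y -> noeth ops Z' Y'.
Proof.
move=> NY ZZ YY W Win; apply: NY => j; have [FW ZW WY] := Win j; split=> //.
  exact: lef_trans ZW.
exact: lef_trans YY.
Qed.

Lemma zero_lef ops X : fam ops X -> lef zero_fam X.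
Proof. by case=> SX _ d _ ->; apply: is_sub0. Qed.

Lemma gspan_fam ops s : fam ops (gspan ops s).
Proof.
split=> [d|o oin d v sv X FX sX]; last by apply: FX.2 => //; apply: sv.
split=> [X FX _|a u v su sv X FX sX]; first exact: is_sub0 (FX.1 d).
by apply: (FX.1 d).2; [exact: su | exact: sv].
Qed.

Lemma mem_gspan ops s p : List.In p s -> gspan ops s p.1 p.2.
Proof. by move=> sp X _; apply. Qed.

Lemma gspan_min ops s X :
  fam ops X -> (forall p, List.In p s -> X p.1 p.2) -> lef (gspan ops s) X.
Proof. by move=> FX sX d v; apply. Qed.

(** Otherwise elements of [W] outside the span of those already chosen could be added forever, and
    the growing spans would violate the chain condition. *)
Lemma noeth_fingen ops Y W : noeth ops zero_fam Y -> fam ops W -> lef W Y ->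
  exists s, (forall p, List.In p s -> W p.1 p.2) /\ lef W (gspan ops s).
Proof.
move=> NY FW WY; apply: contrapT => nex.
have nexts s : exists p : degree * V, (forall p, List.In p s -> W p.1 p.2) ->
    W p.1 p.2 /\ ~ gspan ops s p.1 p.2.
  have [sW|nsW] := pselect (forall p, List.In p s -> W p.1 p.2); last by exists ((0, 0)%N, 0).
  apply: contrapT => np; apply: nex; exists s; split=> // d v Wv.
  by apply: contrapT => nsv; apply: np; exists (d, v).
pose next s := sval (cid (nexts s)).
have nextP s : (forall p, List.In p s -> W p.1 p.2) ->
    W (next s).1 (next s).2 /\ ~ gspan ops s (next s).1 (next s).2.
  by rewrite /next; case: cid.
pose sq := fix sq j := if j is j'.+1 then next (sq j') :: sq j' else [::].
have sqW j p : List.In p (sq j) -> W p.1 p.2.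
  elim: j p => [|j IH] p; first by case.
  by case=> [<-|/IH//]; have [Wn _] := nextP _ IH.
have [] := NY (fun j => gspan ops (sq j)).
- move=> j; split; [exact: gspan_fam | exact: zero_lef (gspan_fam _ _) |].
  apply: lef_trans WY; apply: gspan_min => // p; exact: sqW.
- move=> j; apply: gspan_min => [|p sp]; [exact: gspan_fam | by apply: mem_gspan; right].
move=> j0 /(_ j0.+1 (leqnSn _)) le.
have [_ []] := nextP _ (@sqW j0); apply: le.
by apply: (@mem_gspan _ (sq j0.+1)); left.
Qed.

End Graded.

(** * Hilbert's basis theorem for families indexed by degrees *)

Section HilbertBasis.
Context (R : comNzRingType) (hR : noetherian R).

Lemma ideal_acc (L : nat -> set R^o) : (forall j, is_sub (L j)) ->
  (forall j, L j `<=` L j.+1) -> exists j0, forall j, (j0 <= j)%N -> L j `<=` L j0.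
Proof.
move=> SL Lle.
have mono i j : (i <= j)%N -> L i `<=` L j.
  by move=> /subnK <-; elim: (j - i)%N => [|k IH] // x /IH; rewrite addSn; apply: Lle.
pose J : {pred R^o} := fun a => `[< exists j, L j a >].
have JI : @is_ideal R J.
  split=> [|a u v /asboolP[i Li] /asboolP[j Lj]]; apply/asboolP.
    by exists 0%N; apply: is_sub0 (SL 0%N).
  exists (maxn i j); apply: (SL _).2; first exact: mono (leq_maxl _ _) _ Li.
  exact: mono (leq_maxr _ _) _ Lj.
have [s sJ] := hR JI.
have sub0 : forall a, a \in s -> a \in J.
  by move=> a sa; rewrite sJ; apply/asboolP => S _; apply.
have [j0 sj0] : exists j0, forall a, a \in s -> L j0 a.
  elim: s sub0 {sJ} => [|a s IH] sub0; first by exists 0%N.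
  have [|i Li] := IH; first by move=> b sb; apply: sub0; rewrite inE sb orbT.
  have /asboolP[j Lj] := sub0 a (mem_head _ _).
  exists (maxn i j) => b; rewrite inE => /predU1P[->|sb].
    exact: mono (leq_maxr _ _) _ Lj.
  exact: mono (leq_maxl _ _) _ (Li _ sb).
exists j0 => j _ x Lx; have : x \in J by apply/asboolP; exists j.
rewrite sJ => /asboolP/(_ (fun x => `[< L j0 x >])) xs.
apply/asboolP/xs => [|a sa]; last by apply/asboolP/sj0.
split=> [|a u v /asboolP Lu /asboolP Lv]; apply/asboolP; first exact: is_sub0.
exact: (SL j0).2.
Qed.

Context (V : lmodType R).
Implicit Types (ops : seq (hop V)) (s : seq (degree * V)).

(** Induction on [s]: the chain is determined by its intersection with the span of the old
    generators and by the coefficients that occur at the new one, and both stabilise. *)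
Lemma noeth_gspan_nil s : noeth [::] (@zero_fam _ V) (gspan [::] s).
Proof.
elim: s => [|[d0 v0] s IH] W Win Wle.
  exists 0%N => j _ d x Wx; have [_ _ /(_ d x Wx) x0] := Win j.
  have -> : x = 0 by apply: (x0 (@zero_fam _ V)) => //; split=> // d'; apply: set0_is_sub.
  by have [FW _ _] := Win 0%N; apply: is_sub0 (FW.1 d).
set Y' := gspan [::] s in IH *; set Y := gspan _ _ in Win *.
have SW j d : is_sub (W j d) by have [[]] := Win j.
have SY' d : is_sub (Y' d) := (gspan_fam [::] s).1 d.
have Yin d x : Y d x -> exists a y, [/\ Y' d y, x = y + a *: v0 & d = d0 \/ a = 0].
  pose X : degree -> set V := fun d =>
    [set x | exists a y, [/\ Y' d y, x = y + a *: v0 & d = d0 \/ a = 0]].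
  move=> /(_ X); apply=> [|[d1 v1] /= [[<- <-]|sv]]; first split=> [{}d|//]; last 2 first.
  - by exists 1, 0; rewrite add0r scale1r; split; [exact: is_sub0 | | left].
  - by exists 0, v1; rewrite scale0r addr0; split=> //; [apply: (@mem_gspan _ _ _ s (d1, v1)) | right].
  split=> [|c _ _ [a [y [Yy -> da]]] [b [z [Yz -> db]]]].
    by exists 0, 0; rewrite scale0r addr0; split=> //; [exact: is_sub0 | right].
  exists (c * a + b), (c *: y + z); split; first exact: (SY' d).2.
    by rewrite scalerDr scalerA scalerDl addrACA.
  by case: da => [->|->]; [left | case: db => [->|->]; [left | right; rewrite mulr0 addr0]].
(* Coefficients of the new generator [v0] occurring in [W j]: an ascending chain of ideals. *)
pose L j : set R^o := [set a | exists y, Y' d0 y /\ W j d0 (y + a *: v0)].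
have [||j1 Lj1] := @ideal_acc L.
- move=> j; split=> [|c a b [y [Yy Wy]] [z [Yz Wz]]].
    by exists 0; rewrite scale0r addr0; split; apply: is_sub0.
  exists (c *: y + z); split; first exact: (SY' d0).2.
  by rewrite scalerDl -scalerA addrACA -scalerDr; apply: (SW j d0).2.
- by move=> j a [y [Yy Wy]]; exists y; split=> //; apply: Wle.
have [||j2 Wj2] := IH (fun j d => W j d `&` Y' d).
- move=> j; split=> [||d x []//]; last by move=> d _ ->; split; apply: is_sub0.
  by split=> // d; apply: setI_is_sub.
- by move=> j d x [Wx Yx]; split=> //; apply: Wle.
have mono := lef_mono Wle.
exists (maxn j1 j2) => j; rewrite geq_max => /andP[j1j j2j] d x Wx.
have [_ _ /(_ d x Wx) /Yin[a [y [Yy xE dd]]]] := Win j.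
have Wmax t : Y' d t -> W j d t -> W (maxn j1 j2) d t.
  by move=> Yt Wt; apply: (mono j2); [exact: leq_maxr | have [] := Wj2 j j2j d t (conj Wt Yt)].
case: dd => [dE|a0]; last first.
  have xy : x = y by rewrite xE a0 scale0r addr0.
  by apply: Wmax; rewrite // xy.
rewrite dE in Yy Wx Wmax *.
have [|z [Yz Wz]] := Lj1 j j1j a; first by exists y; rewrite -xE.
have -> : x = (y - z) + (z + a *: v0) by rewrite addrA subrK.
apply: (is_subD (SW _ _)); last by apply: mono Wz; apply: leq_maxl.
apply: Wmax; first exact: (is_subB (SY' d0)).
rewrite (_ : y - z = x - (z + a *: v0)); last by rewrite xE opprD addrACA subrr addr0.
by apply: (is_subB (SW _ _)) => //; apply: mono Wz.
Qed.

End HilbertBasis.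

Section HilbertStep.
Context (R : comNzRingType) (V : lmodType R) (o : hop V) (os : seq (hop V)).
Hypothesis comm_o : commuting (o :: os).
Context (s : seq (degree * V)).

Let Y' := gspan os s.
Let T k (v : V) := iter k o.1 v.
Let sh k d := iter k (shift o.2) d.

Let T_linear k a u v : T k (a *: u + v) = a *: T k u + T k v.
Proof. by rewrite /T; elim: k => //= k ->; rewrite linearP. Qed.

Let T0 k : T k 0 = 0.
Proof. by rewrite /T; elim: k => //= k ->; rewrite linear0. Qed.

Let T_comm k p v : List.In p os -> T k (p.1 v) = p.1 (T k v).
Proof.
move=> pos; rewrite /T; elim: k => //= k ->.
by apply: comm_o; [left | right].
Qed.

Let SY' d : is_sub (Y' d). Proof. exact: (gspan_fam os s).1. Qed.

(** Terms of exact order [k] in [o]; the case [x = 0] covers the degrees that are not a [k]-fold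
    shift. *)
Let top k d : set V := [set x | x = 0 \/ exists d0 z, [/\ sh k d0 = d, Y' d0 z & x = T k z]].

Let top_sub k d : is_sub (top k d).
Proof.
split=> [|a _ _ [->|[d1 [z1 [<- Y1 ->]]]] [->|[d2 [z2 [dE Y2 ->]]]]]; first by left.
- by left; rewrite scaler0 addr0.
- by right; exists d2, z2; rewrite scaler0 add0r.
- by right; exists d1, (a *: z1); split=> //; [exact: (is_subZ (SY' d1)) | rewrite -[a *: z1]addr0 T_linear T0].
- right; exists d1, (a *: z1 + z2); rewrite T_linear; split=> //.
  have dd := iter_shift_inj dE; rewrite dd in Y2.
  by apply: (SY' d1).2.
Qed.

(* The elements of the form [\sum_(j < k) T j z_j] with [z_j] in [Y']. *)
Fixpoint low_terms (k : nat) (d : degree) {struct k} : set V :=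
  if k is k'.+1 then sub_add (low_terms k' d) (top k' d) else [set 0].

Let low_terms_sub k d : is_sub (low_terms k d).
Proof. by elim: k => [|k IH] /=; [exact: set0_is_sub | exact: sub_add_is_sub]. Qed.

Let low_termsS k d : low_terms k d `<=` low_terms k.+1 d.
Proof. exact: sub_addl. Qed.

Let low_terms_comm k d p v : List.In p os -> low_terms k d v -> low_terms k (shift p.2 d) (p.1 v).
Proof.
move=> pos; elim: k v => [|k IH] v; first by move=> ->; apply: linear0.
move=> [y [_ [yk [->|[d0 [z [dE Yz ->]]]] ->]]]; exists (p.1 y).
  by exists 0; rewrite addr0 addr0; split; [exact: IH | left |].
exists (p.1 (T k z)); rewrite linearD; split=> //; first exact: IH.
right; exists (shift p.2 d0), (p.1 z); rewrite T_comm // -dE /sh iter_shiftC; split=> //.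
exact: (gspan_fam os s).2.
Qed.

Let low_terms_step k d v : low_terms k d v -> low_terms k.+1 (shift o.2 d) (o.1 v).
Proof.
elim: k v => [|k IH] v; first by move=> ->; rewrite linear0; apply: is_sub0.
move=> [y [_ [yk [->|[d0 [z [dE Yz ->]]]] ->]]]; exists (o.1 y).
  by exists 0; rewrite addr0 addr0; split; [exact: IH | left |].
exists (T k.+1 z); rewrite linearD; split=> //; first exact: IH.
by right; exists d0, z; rewrite -dE.
Qed.

Let low_terms_exhaust d x : gspan (o :: os) s d x -> exists k, low_terms k d x.
Proof.
have mono k l d' : (k <= l)%N -> low_terms k d' `<=` low_terms l d'.
  by move=> /subnK <-; elim: (l - k)%N => [|m IH] // y /IH; rewrite addSn; apply: low_termsS.
move=> /(_ (fun d => [set x | exists k, low_terms k d x])); apply=> [|p sp]; last first.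
  exists 1%N, 0, p.2; rewrite add0r; split=> //; right; exists p.1, p.2; split=> //.
  exact: mem_gspan.
split=> [{}d|p /= [<-|pos] {}d v [k yk]]; last 2 first.
- by exists k.+1; apply: low_terms_step.
- by exists k; apply: low_terms_comm.
split=> [|a u v [k uk] [l vl]]; first by exists 0%N.
exists (maxn k l); apply: (low_terms_sub _ _).2; first exact: mono (leq_maxl _ _) _ uk.
exact: mono (leq_maxr _ _) _ vl.
Qed.

(* The leading coefficients argument of Hilbert's basis theorem. *)
Lemma noeth_gspan_step :
  noeth os (@zero_fam _ V) Y' -> noeth (o :: os) (@zero_fam _ V) (gspan (o :: os) s).
Proof.
move=> NY W Win Wle; have FW j : fam (o :: os) (W j) by have [] := Win j.
have SW j d : is_sub (W j d) := (FW j).1 d.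
have mono := lef_mono Wle.
(* Leading coefficients: [z] belongs when [W j] contains [T k z] plus terms of lower order in
   [o]. *)
pose L j k : degree -> set V := fun d =>
  [set z | Y' d z /\ exists y, low_terms k (sh k d) y /\ W j (sh k d) (y + T k z)].
have FL j k : fam os (L j k).
  split=> [d|p pos d z [Yz [y [yk Wy]]]].
    split=> [|a u v [Yu [y [yk Wy]]] [Yv [z [zk Wz]]]].
      by split; [exact: is_sub0 | exists 0; rewrite T0 addr0; split; apply: is_sub0].
    split; first exact: (SY' d).2.
    exists (a *: y + z); split; first exact: (low_terms_sub _ _).2.
    by rewrite T_linear addrACA -scalerDr; apply: (SW _ _).2.
  split; first exact: (gspan_fam os s).2.
  exists (p.1 y); rewrite /sh iter_shiftC T_comm // -linearD; split; first exact: low_terms_comm.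
  by apply: (FW j).2 => //; right.
have Lk j k : lef (L j k) (L j k.+1).
  move=> d z [Yz [y [yk Wy]]]; split=> //; exists (o.1 y); split; first exact: low_terms_step.
  by rewrite -linearD; apply: (FW j).2 => //; left.
have Lj j k : lef (L j k) (L j.+1 k).
  by move=> d z [Yz [y [yk Wy]]]; split=> //; exists y; split=> //; apply: Wle.
have Lmono i j k l : (i <= j)%N -> (k <= l)%N -> lef (L i k) (L j l).
  move=> ij kl; apply: (@lef_trans _ _ _ (L i l)); first exact: (lef_mono (Lk i)).
  exact: (@lef_mono _ _ (fun j => L j l)).
have Lin j k : [/\ fam os (L j k), lef (@zero_fam _ V) (L j k) & lef (L j k) Y'].
  by split; [exact: FL | exact: zero_lef (FL _ _) | move=> d z []].
(* The array [L] increases in both indices. Stationarity along the diagonal settles the columns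
   [k >= j1], and the finitely many others are settled one by one. *)
have [j1 Lj1] : exists j0, forall j, (j0 <= j)%N -> lef (L j j) (L j0 j0).
  by apply: NY => // j; apply: Lmono.
have [N LN] : exists N, forall k, (k < j1)%N -> forall j, lef (L j k) (L N k).
  elim: {Lj1} j1 => [|j1 [N1 IH]]; first by exists 0%N.
  have [N2 LN2] := NY (fun j => L j j1) (Lin^~ j1) (Lj^~ j1).
  exists (maxn N1 N2) => k; rewrite ltnS leq_eqVlt => /predU1P[->|kj] j.
    apply: (@lef_trans _ _ _ (L N2 j1)); last exact: Lmono (leq_maxr _ _) _.
    by apply: lef_trans (LN2 _ (leq_maxr j N2)); apply: Lmono (leq_maxl _ _) _.
  by apply: lef_trans (IH _ kj j) _; apply: Lmono (leq_maxl _ _) _.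
have LM j k : lef (L j k) (L (maxn N j1) k).
  case: (ltnP k j1) => kj; first by apply: lef_trans (LN _ kj j) _; apply: Lmono (leq_maxl _ _) _.
  apply: (@lef_trans _ _ _ (L j1 j1)); last by apply: Lmono => //; apply: leq_maxr.
  apply: lef_trans (Lj1 (maxn j k) _); last by rewrite (leq_trans kj) ?leq_maxr.
  by apply: Lmono; [exact: leq_maxl | exact: leq_maxr].
exists (maxn N j1) => j jN d x Wx.
have [k yk] : exists k, low_terms k d x by apply: low_terms_exhaust; have [_ _] := Win j; apply.
(* Induction on the number of terms: [LM] supplies an element of the stationary family with the same
   leading term, and the difference has fewer terms. *)
elim: k x Wx yk => [|k IH] x Wx; first by move=> ->; apply: is_sub0.
move=> [y [t [yk tk xE]]].
case: tk => [t0|[d0 [z [dE Yz tE]]]]; first by apply: IH; rewrite // xE t0 addr0.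
have [|_ [y' [y'k Wy']]] := LM j k d0 z; first by split=> //; exists y; rewrite dE -tE -xE.
rewrite dE -tE in y'k Wy'.
have -> : x = (y - y') + (y' + t) by rewrite addrA subrK.
apply: (is_subD (SW _ _)) => //; apply: IH; last exact: (is_subB (low_terms_sub _ _)).
rewrite (_ : y - y' = x - (y' + t)); last by rewrite xE opprD addrACA subrr addr0.
by apply: (is_subB (SW _ _)) => //; apply: (mono _ _ jN).
Qed.

End HilbertStep.

Lemma noeth_gspan (R : comNzRingType) (V : lmodType R) (ops : seq (hop V))
    (s : seq (degree * V)) :
  noetherian R -> commuting ops -> noeth ops (@zero_fam _ V) (gspan ops s).
Proof.
move=> hR; elim: ops => [|o os IH] C; first exact: noeth_gspan_nil.
by apply: noeth_gspan_step => //; apply: IH => p q pos qos; apply: C; right.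
Qed.

(** * Eventually polynomial functions and Hilbert functions *)

Section EventuallyPolynomial.
Implicit Types (f g : nat -> rat).

Definition ev_poly f : Prop :=
  exists (p : {poly rat}) n0, forall n, (n0 <= n)%N -> f n = p.[n%:R].

Lemma ev_poly_ext n0 f g : (forall n, (n0 <= n)%N -> f n = g n) -> ev_poly f -> ev_poly g.
Proof.
move=> fg [p [n1 fp]]; exists p, (maxn n0 n1) => n.
by rewrite geq_max => /andP[n0n n1n]; rewrite -fg ?fp.
Qed.

Lemma ev_poly_cst c : ev_poly (fun=> c).
Proof. by exists c%:P, 0%N => n _; rewrite hornerC. Qed.

Lemma ev_polyD f g : ev_poly f -> ev_poly g -> ev_poly (fun n => f n + g n).
Proof.
move=> [p [n0 fp]] [q [n1 gq]]; exists (p + q), (maxn n0 n1) => n.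
by rewrite geq_max => /andP[n0n n1n]; rewrite hornerD fp ?gq.
Qed.

Lemma ev_polyN f : ev_poly f -> ev_poly (fun n => - f n).
Proof. by move=> [p [n0 fp]]; exists (- p), n0 => n /fp ->; rewrite hornerN. Qed.

Lemma ev_polyB f g : ev_poly f -> ev_poly g -> ev_poly (fun n => f n - g n).
Proof. by move=> fp gp; apply: ev_polyD => //; apply: ev_polyN. Qed.

Lemma coef_XD1n n j : ((('X + 1 : {poly rat}) ^+ n)`_j = ('C(n, j))%:R).
Proof.
have -> : ('X + 1 : {poly rat}) ^+ n = \poly_(i < n.+1) ('C(n, i))%:R.
  rewrite poly_def addrC exprDn; apply: eq_bigr => i _.
  by rewrite expr1n mul1r scaler_nat.
by rewrite coef_poly; case: ltnP => // nj; rewrite bin_small.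
Qed.

(** Induction on the size: [D] has leading term [(k + 1) X^k], so subtracting [c *: D] removes the
    top coefficient of [p], and [D] itself is the difference of [X^(k+1)]. *)
Lemma antidifference (p : {poly rat}) :
  exists q : {poly rat}, forall n : nat, q.[n.+1%:R] - q.[n%:R] = p.[n%:R].
Proof.
have [k] := ubnP (size p); elim: k p => [//|k IH] p; rewrite ltnS => pk.
case: k => [|k] in IH pk *.
  by exists 0 => n; move: pk; rewrite leqn0 size_poly_eq0 => /eqP->; rewrite !hornerE.
pose c := p`_k / k.+1%:R; pose D := ('X + 1 : {poly rat}) ^+ k.+1 - 'X ^+ k.+1.
have [|q qE] := IH (p - c *: D).
  rewrite ltnS; apply/leq_sizeP => j kj; rewrite coefB coefZ coefB coef_XD1n coefXn.
  move: kj; rewrite leq_eqVlt => /predU1P[<-|kj].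
    rewrite (ltn_eqF (ltnSn k)) subr0 binSn /c divfK ?subrr //.
    by rewrite pnatr_eq0.
  rewrite nth_default ?(leq_trans pk) // sub0r.
  case: (ltngtP j k.+1) => [|kj'|->]; first by rewrite ltnS leqNgt kj.
    by rewrite bin_small // subrr mulr0 oppr0.
  by rewrite binn subrr mulr0 oppr0.
exists (q + c *: 'X ^+ k.+1) => n; rewrite !hornerD !hornerZ opprD addrACA qE.
rewrite hornerD hornerN hornerZ -mulrBr hornerD hornerN !hornerXn horner_exp !hornerE.
by rewrite -[n.+1%:R]natr1 subrK.
Qed.

Lemma ev_poly_diff f : ev_poly (fun n => f n.+1 - f n) -> ev_poly f.
Proof.
move=> [p [n0 fp]]; have [q qE] := antidifference p.
exists (q + (f n0 - q.[n0%:R])%:P), n0 => n /subnK <-.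
elim: (n - n0)%N => [|k IH]; first by rewrite add0n hornerD hornerC addrC subrK.
rewrite addSn -[LHS](subrK (f (k + n0)%N)) fp ?leq_addl // IH -qE !hornerD !hornerC.
by rewrite addrA subrK.
Qed.

End EventuallyPolynomial.

(** * Hilbert functions of noetherian families, on the diagonal and summed below it *)

Section HilbertFunction.
Context (R : comNzRingType) (V : lmodType R).
Implicit Types (ops : seq (hop V)) (Y Z W : degree -> set V) (tl ul : seq {linear V -> V}).

Lemma len0 (Z : set V) : is_sub Z -> len Z Z = 0%N.
Proof.
move=> SZ; apply: len_eq; split.
  by exists (fun=> Z); split=> [j _|j]; [split | rewrite ltn0].
move=> m S [Sin Slt]; rewrite leqNgt; apply/negP => m0.
have [_ nS] := Slt 0%N m0; apply: nS => x Sx.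
have [_ ZS _] := Sin 0%N (leq0n _); have [_ _ SZ1] := Sin 1%N m0.
exact/ZS/SZ1.
Qed.

Section KernelCokernel.
Context (o : hop V) (os : seq (hop V)) (Z Y : degree -> set V).
Hypotheses (C : commuting (o :: os)) (FZ : fam (o :: os) Z) (FY : fam (o :: os) Y).
Hypotheses (ZY : lef Z Y) (NY : noeth (o :: os) Z Y).
Hypothesis finY : forall d, fin_len (Z d) (Y d).

(** [hop_ker / Z] and [Y / hop_im] are the kernel and the cokernel of [o] on [Y / Z]. In [hop_im]
    the case [x = 0] covers degrees outside the image of the shift. *)
Definition hop_ker d : set V := Y d `&` o.1 @^-1` Z (shift o.2 d).

Definition hop_im d : set V :=
  sub_add (Z d) [set x | x = 0 \/ exists d' y, [/\ shift o.2 d' = d, Y d' y & x = o.1 y]].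

Let im_sub d :
  is_sub [set x | x = 0 \/ exists d' y, [/\ shift o.2 d' = d, Y d' y & x = o.1 y]].
Proof.
split=> [|a _ _ [->|[d1 [y1 [<- Y1 ->]]]] [->|[d2 [y2 [dE Y2 ->]]]]]; first by left.
- by left; rewrite scaler0 addr0.
- by right; exists d2, y2; rewrite scaler0 add0r.
- right; exists d1, (a *: y1); rewrite linearZ addr0; split=> //.
  exact: (is_subZ (FY.1 d1)).
- right; exists d1, (a *: y1 + y2); rewrite linearP; split=> //.
  by have dd := shift_inj dE; rewrite dd in Y2; apply: (FY.1 d1).2.
Qed.

Lemma hop_ker_fam : fam os hop_ker.
Proof.
split=> [d|p pos d v [Yv Zv]].
  by apply: setI_is_sub; [exact: FY.1 | apply: preimage_is_sub; exact: FZ.1].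
split; first by apply: FY.2 => //; right.
rewrite /preimage /= (C (or_introl erefl) (or_intror pos)) -shiftC.
by rewrite shiftC shiftC; apply: FZ.2 => //; right.
Qed.

Lemma hop_im_fam : fam os hop_im.
Proof.
split=> [d|p pos d _ [z [x [Zz xE ->]]]].
  by apply: sub_add_is_sub; [exact: FZ.1 | exact: im_sub].
rewrite linearD; exists (p.1 z), (p.1 x); split=> //; first by apply: FZ.2 => //; right.
case: xE => [->|[d' [y [<- Yy ->]]]]; first by left; rewrite linear0.
right; exists (shift p.2 d'), (p.1 y); rewrite shiftC; split=> //.
  by apply: FY.2 => //; right.
by rewrite -(C (or_introl erefl) (or_intror pos)).
Qed.

Lemma lef_ker : lef Z hop_ker.
Proof. by move=> d z Zz; split; [exact: ZY | apply: FZ.2 => //; left]. Qed.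

Lemma ker_lef : lef hop_ker Y. Proof. by move=> d z []. Qed.

Lemma lef_im : lef Z hop_im. Proof. by move=> d; apply: sub_addl. Qed.

Lemma im_lef : lef hop_im Y.
Proof.
move=> d _ [z [x [Zz xE ->]]]; apply: (is_subD (FY.1 d)); first exact: ZY.
case: xE => [->|[d' [y [<- Yy ->]]]]; first exact: is_sub0 (FY.1 d).
by apply: FY.2 => //; left.
Qed.

(** [o] sends the kernel into [Z], so every family between [Z] and the kernel is stable under [o]
    automatically, and the chain condition for all operators applies. *)
Lemma hop_ker_noeth : noeth os Z hop_ker.
Proof.
move=> W Win; apply: NY => j; have [[SW FW] ZW WK] := Win j; split=> //; last first.
  exact: lef_trans WK ker_lef.
split=> // p /= [<-|pos] d v Wv; last exact: FW.
by apply: ZW; have [] := WK _ _ Wv.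
Qed.

(** Dually, [o] sends all of [Y] into [hop_im], so families above [hop_im] are stable under [o]. *)
Lemma hop_im_noeth : noeth os hop_im Y.
Proof.
move=> W Win; apply: NY => j; have [[SW FW] CW WY] := Win j; split=> //; last first.
  exact: lef_trans lef_im CW.
split=> // p /= [<-|pos] d v Wv; last exact: FW.
apply: CW; apply: (sub_addr (FZ.1 _)); right; exists d, v; split=> //; exact: WY.
Qed.

Lemma fin_hop_ker d : fin_len (Z d) (hop_ker d).
Proof.
have /(fin_lenE (FZ.1 d) (hop_ker_fam.1 d) (FY.1 d) (@lef_ker d) (@ker_lef d))[] := finY d.
by [].
Qed.

Lemma fin_hop_im d : fin_len (hop_im d) (Y d).
Proof.
have /(fin_lenE (FZ.1 d) (hop_im_fam.1 d) (FY.1 d) (@lef_im d) (@im_lef d))[] := finY d.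
by [].
Qed.

(** [o] induces an isomorphism from [Y / hop_ker] in degree [d] onto [hop_im / Z] in the shifted
    degree; these two lengths cancel in the difference. *)
Lemma len_hop d : (len (Z (shift o.2 d)) (Y (shift o.2 d)))%:R - (len (Z d) (Y d))%:R =
  (len (hop_im (shift o.2 d)) (Y (shift o.2 d)))%:R - (len (Z d) (hop_ker d))%:R :> rat.
Proof.
have := len_add (FZ.1 d) (hop_ker_fam.1 d) (FY.1 d) (@lef_ker d) (@ker_lef d) (finY d).
set d1 := shift o.2 d.
have := len_add (FZ.1 d1) (hop_im_fam.1 d1) (FY.1 d1) (@lef_im d1) (@im_lef d1) (finY d1).
have [|w|_ <- -> ->] :=
    @len_map _ _ _ o.1 (hop_ker d) (Y d) (Z d1) (hop_im d1) (FY.1 d) (FZ.1 d1).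
- by move=> v.
- split=> [[z [x [Zz xE ->]]]|[v [z [Yv Zz ->]]]].
    case: xE => [->|[d' [y [/shift_inj <- Yy ->]]]].
      by exists 0, z; rewrite linear0 addrC; split=> //; apply: is_sub0 (FY.1 d).
    by exists y, z; rewrite addrC.
  by exists z, (o.1 v); rewrite addrC; split=> //; right; exists d, v.
by rewrite !natrD [X in _ - X]addrC opprD addrACA subrr add0r.
Qed.

End KernelCokernel.

Lemma fam_ext ops ops' X : (forall p, List.In p ops <-> List.In p ops') ->
  fam ops X -> fam ops' X.
Proof. by move=> E [SX FX]; split=> // p /E; apply: FX. Qed.

Lemma noeth_ext ops ops' Z Y : (forall p, List.In p ops <-> List.In p ops') ->
  noeth ops Z Y -> noeth ops' Z Y.
Proof.
move=> E NY W Win; apply: NY => j; have [FW ? ?] := Win j; split=> //.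
by apply: fam_ext FW => p; rewrite E.
Qed.

Lemma commuting_ext ops ops' : (forall p, List.In p ops <-> List.In p ops') ->
  commuting ops -> commuting ops'.
Proof. by move=> E C p q /E pin /E qin; apply: C. Qed.

Lemma commuting_cons o ops : commuting (o :: ops) -> commuting ops.
Proof. by move=> C p q pin qin; apply: C; right. Qed.

Definition hops tl ul : seq (hop V) :=
  [seq (t, true) | t <- tl] ++ [seq (u, false) | u <- ul].

Lemma hops_consr tl u ul p :
  List.In p (hops tl (u :: ul)) <-> List.In p ((u, false) :: hops tl ul).
Proof. by rewrite /hops /= !List.in_app_iff /=; tauto. Qed.

Lemma in_hopsP tl ul p : List.In p (hops tl ul) <->
  (exists2 t, List.In t tl & p = (t, true)) \/ (exists2 u, List.In u ul & p = (u, false)).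
Proof.
rewrite /hops List.in_app_iff !List.in_map_iff; split.
  by case=> -[v [<- vin]]; [left | right]; exists v.
by case=> -[v vin ->]; [left | right]; exists v.
Qed.

(** When all operators raise the same coordinate, the other one is invariant. The families equal to
    [Y] where that coordinate is below [j] and to [Z] elsewhere form an ascending chain, and its
    stationarity forces [Y] into [Z] beyond some bound. *)
Lemma noeth_vanish b ops Z Y : fam ops Z -> fam ops Y -> lef Z Y ->
  (forall p, List.In p ops -> p.2 = b) -> noeth ops Z Y ->
  exists n0, forall d, (n0 <= if b then d.2 else d.1)%N -> Y d `<=` Z d.
Proof.
move=> FZ FY ZY opsb NY; pose c (d : degree) := if b then d.2 else d.1.
have shE b' d : (if b' then (shift b' d).2 else (shift b' d).1) = if b' then d.2 else d.1.
  by case: b'.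
have cE p d : List.In p ops -> c (shift p.2 d) = c d by move=> /opsb ->; exact: shE.
have [||n0 Wn0] := NY (fun j d => if (c d < j)%N then Y d else Z d).
- move=> j; split=> [|d x|d x]; [|by case: ifP => // _; apply: ZY|by case: ifP => // _; apply: ZY].
  split=> [d|p pin d v]; first by case: ifP => _; [exact: FY.1 | exact: FZ.1].
  by rewrite cE //; case: ifP => _; [exact: FY.2 | exact: FZ.2].
- move=> j d x; rewrite ltnS [(c d <= j)%N]leq_eqVlt; case: eqP => [->|_]; last by [].
  by rewrite ltnn; apply: ZY.
exists n0 => d n0d y Yy; have := Wn0 (c d).+1 (leqW n0d) d y.
by rewrite ltnSn ltnNge n0d /=; apply.
Qed.

Definition finite_graded ops Z Y : Prop :=
  [/\ commuting ops, fam ops Z, fam ops Y, lef Z Y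
    & noeth ops Z Y /\ forall d, fin_len (Z d) (Y d)].

Lemma finite_graded_ext ops ops' Z Y : (forall p, List.In p ops <-> List.In p ops') ->
  finite_graded ops Z Y -> finite_graded ops' Z Y.
Proof.
move=> E [C FZ FY ZY [NY finY]]; split=> //; last split=> //.
- exact: commuting_ext E C.
- exact: fam_ext E FZ.
- exact: fam_ext E FY.
- exact: noeth_ext E NY.
Qed.

Lemma finite_graded_ker o os Z Y :
  finite_graded (o :: os) Z Y -> finite_graded os Z (hop_ker o Z Y).
Proof.
move=> [C FZ FY ZY [NY finY]]; split; last split.
- exact: commuting_cons C.
- by case: FZ => SZ FZ; split=> // p pos; apply: FZ; right.
- exact: hop_ker_fam C FZ FY.
- exact: lef_ker FZ ZY.
- exact: hop_ker_noeth NY.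
- exact: fin_hop_ker C FZ FY ZY finY.
Qed.

Lemma finite_graded_im o os Z Y :
  finite_graded (o :: os) Z Y -> finite_graded os (hop_im o Z Y) Y.
Proof.
move=> [C FZ FY ZY [NY finY]]; split; last split.
- exact: commuting_cons C.
- exact: hop_im_fam C FZ FY.
- by case: FY => SY FY; split=> // p pos; apply: FY; right.
- exact: im_lef FY ZY.
- exact: hop_im_noeth FZ FY NY.
- exact: fin_hop_im C FZ FY ZY finY.
Qed.

Lemma finite_graded_len o os Z Y d : finite_graded (o :: os) Z Y ->
  (len (Z (shift o.2 d)) (Y (shift o.2 d)))%:R - (len (Z d) (Y d))%:R =
  (len (hop_im o Z Y (shift o.2 d)) (Y (shift o.2 d)))%:R
    - (len (Z d) (hop_ker o Z Y d))%:R :> rat.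
Proof. by move=> [C FZ FY ZY [NY finY]]; apply: len_hop C FZ FY ZY finY d. Qed.

Lemma finite_graded_vanish b ops Z Y : finite_graded ops Z Y ->
  (forall p, List.In p ops -> p.2 = b) ->
  exists n0, forall d, (n0 <= if b then d.2 else d.1)%N -> len (Z d) (Y d) = 0%N.
Proof.
move=> [C FZ FY ZY [NY finY]] opsb.
have [n0 Yn0] := noeth_vanish FZ FY ZY opsb NY; exists n0 => d n0d.
rewrite (_ : Y d = Z d) ?len0 //; first exact: FZ.1.
by apply/seteqP; split; [exact: Yn0 | exact: ZY].
Qed.

(* Induction on the number of operators: an operator vanishes on its own kernel and cokernel, so
   these are noetherian for the remaining ones, and they compute the difference of the lengths. *)
Lemma hilbert_diagonal k tl ul Z Y a b : (size tl + size ul <= k)%N ->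
  finite_graded (hops tl ul) Z Y ->
  ev_poly (fun n => (len (Z (n + a, n + b)%N) (Y (n + a, n + b)%N))%:R).
Proof.
elim: k tl ul Z Y a b => [|k IH] tl ul Z Y a b szk GY.
  have [|n0 Yn0] := @finite_graded_vanish true _ _ _ GY.
    by move: szk; case: (tl) => //; case: (ul) => // _ p.
  apply: (@ev_poly_ext n0 (fun=> 0)) (ev_poly_cst 0) => n n0n.
  by rewrite Yn0 // (leq_trans n0n) ?leq_addr.
(* With operators of one kind only, the length is zero once the other coordinate is large, and the
   diagonal eventually gets there. *)
have vanish (bb : bool) : (forall p, List.In p (hops tl ul) -> p.2 = bb) ->
    ev_poly (fun n => (len (Z (n + a, n + b)%N) (Y (n + a, n + b)%N))%:R).
  move=> /(finite_graded_vanish GY)[n0 Yn0].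
  apply: (@ev_poly_ext n0 (fun=> 0)) (ev_poly_cst 0) => n n0n.
  by rewrite Yn0 //; case: (bb); rewrite /= (leq_trans n0n) ?leq_addr.
case: tl => [|t tl] in szk GY vanish *.
  by apply: (vanish false) => p /in_hopsP[] [v] // _ ->.
case: ul => [|u ul] in szk GY vanish *.
  by apply: (vanish true) => p /in_hopsP[] [v] // _ ->.
have GT : finite_graded ((t, true) :: hops tl (u :: ul)) Z Y by [].
have GU := finite_graded_ext (@hops_consr (t :: tl) u ul) GY.
have szT : (size tl + size (u :: ul) <= k)%N by rewrite -ltnS.
have szU : (size (t :: tl) + size ul <= k)%N by rewrite -ltnS -addnS.
(* A step along the diagonal is a shift by [t] followed by a shift by [u], so the difference is a
   sum of two differences given by [finite_graded_len]. The offsets [a] and [b] absorb the points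
   off the diagonal. *)
apply: ev_poly_diff.
apply: (@ev_poly_ext 0%N (fun n =>
   ((len (hop_im (u, false) Z Y (n + a.+1, n + b.+1)%N) (Y (n + a.+1, n + b.+1)%N))%:R
    - (len (Z (n + a.+1, n + b)%N) (hop_ker (u, false) Z Y (n + a.+1, n + b)%N))%:R)
 + ((len (hop_im (t, true) Z Y (n + a.+1, n + b)%N) (Y (n + a.+1, n + b)%N))%:R
    - (len (Z (n + a, n + b)%N) (hop_ker (t, true) Z Y (n + a, n + b)%N))%:R))).
  move=> n _; have := finite_graded_len (n + a.+1, n + b)%N GU.
  have := finite_graded_len (n + a, n + b)%N GT; rewrite /= !addnS => <- <-.
  by rewrite !addSn addrA subrK.
have KU := finite_graded_ker GU; have IU := finite_graded_im GU.
have KT := finite_graded_ker GT; have IT := finite_graded_im GT.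
apply: ev_polyD; apply: ev_polyB.
- exact: (IH _ _ _ _ a.+1 b.+1 szU IU).
- exact: (IH _ _ _ _ a.+1 b szU KU).
- exact: (IH _ _ _ _ a.+1 b szT IT).
- exact: (IH _ _ _ _ a b szT KT).
Qed.

(** Induction on the operators raising the first degree: passing from [n] to [n.+1] adds one
    diagonal term, and the others change by the cokernel and kernel of [t], which have one operator
    fewer. With none left, the family vanishes in large first degree. *)
Lemma hilbert_sum tl ul Z Y a : finite_graded (hops tl ul) Z Y ->
  ev_poly (fun n => \sum_(k < n) (len (Z (n + a, k : nat)%N) (Y (n + a, k : nat)%N))%:R).
Proof.
elim: tl ul Z Y a => [|t tl IH] ul Z Y a GY.
  have [|n0 Yn0] := @finite_graded_vanish false _ _ _ GY.
    by move=> p /in_hopsP[] [v] // _ ->.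
  apply: (@ev_poly_ext n0 (fun=> 0)) (ev_poly_cst 0) => n n0n.
  by rewrite big1 // => k _; rewrite Yn0 // (leq_trans n0n) ?leq_addr.
have GT : finite_graded ((t, true) :: hops tl ul) Z Y by [].
apply: ev_poly_diff.
apply: (@ev_poly_ext 0%N (fun n =>
   (len (Z (n + a.+1, n + 0)%N) (Y (n + a.+1, n + 0)%N))%:R
 + (\sum_(k < n) (len (hop_im (t, true) Z Y (n + a.+1, k : nat)%N) (Y (n + a.+1, k : nat)%N))%:R
    - \sum_(k < n) (len (Z (n + a, k : nat)%N) (hop_ker (t, true) Z Y (n + a, k : nat)%N))%:R))).
  move=> n _; rewrite big_ord_recr /= addn0 -sumrB.
  rewrite (eq_bigr (fun k : 'I_n =>
     (len (Z (n.+1 + a, k : nat)%N) (Y (n.+1 + a, k : nat)%N))%:R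
     - (len (Z (n + a, k : nat)%N) (Y (n + a, k : nat)%N))%:R)); last first.
    move=> k _; have /= := finite_graded_len (n + a, k : nat)%N GT.
    by rewrite addnS addSn => ->.
  by rewrite sumrB addnS addSn addrA [X in X - _]addrC.
apply: ev_polyD; first exact: (hilbert_diagonal a.+1 0 (leqnn _) GY).
by apply: ev_polyB; apply: IH; [exact: finite_graded_im GT | exact: finite_graded_ker GT].
Qed.

End HilbertFunction.

(** * Powers of an ideal and homology of graded complexes modulo them *)

Section IdealPowers.
Context (R : comNzRingType) (r : nat) (f : 'I_r -> R).
Implicit Types V W : lmodType R.

(* [imul S] is [I S], where [I] is the ideal generated by the [f a]. *)
Definition imul V (S : set V) : set V :=
  [set x | exists g : 'I_r -> V, (forall a, S (g a)) /\ x = \sum_a f a *: g a].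

Definition ipow V m (S : set V) : set V := iter m (@imul V) S.

Lemma imul_is_sub V (S : set V) : is_sub S -> is_sub (imul S).
Proof.
move=> SS; split=> [|c _ _ [g [Sg ->]] [h [Sh ->]]].
  by exists (fun=> 0); split=> [a|]; [exact: is_sub0 | rewrite big1 // => a _; rewrite scaler0].
exists (fun a => c *: g a + h a); split=> [a|]; first exact: SS.2.
rewrite scaler_sumr -big_split; apply: eq_bigr => a _.
by rewrite scalerDr !scalerA [c * _]mulrC.
Qed.

Lemma ipow_is_sub V m (S : set V) : is_sub S -> is_sub (ipow m S).
Proof. by move=> SS; elim: m => // m IH; apply: imul_is_sub. Qed.

Lemma imul_min V (S X : set V) : is_sub X -> (forall a x, S x -> X (f a *: x)) -> imul S `<=` X.
Proof. by move=> SX SfX _ [g [Sg ->]]; apply: is_sub_sum => // a _; apply: SfX. Qed.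

Lemma imul_gen V (S : set V) a x : is_sub S -> S x -> imul S (f a *: x).
Proof.
move=> SS Sx; exists (fun b => if b == a then x else 0); split=> [b|].
  by case: eqP => // _; apply: is_sub0.
rewrite (bigD1 a) //= eqxx big1 ?addr0 // => b /negPf ->; exact: scaler0.
Qed.

Lemma imul_map V W (S : set V) (S' : set W) (g : {linear V -> W}) :
  (forall x, S x -> S' (g x)) -> forall x, imul S x -> imul S' (g x).
Proof.
move=> SS' _ [h [Sh ->]]; exists (fun a => g (h a)); split=> [a|]; first exact: SS'.
by rewrite linear_sum; apply: eq_bigr => a _; rewrite linearZ.
Qed.

Lemma ipow_map V W m (S : set V) (S' : set W) (g : {linear V -> W}) :
  (forall x, S x -> S' (g x)) -> forall x, ipow m S x -> ipow m S' (g x).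
Proof. by move=> SS'; elim: m => // m IH; apply: imul_map. Qed.

Lemma ipow_le V m (S : set V) : is_sub S -> ipow m S `<=` S.
Proof.
move=> SS; elim: m => // m IH; apply: imul_min => // a x /IH; exact: is_subZ.
Qed.

Lemma ipowS_le V m (S : set V) : is_sub S -> ipow m.+1 S `<=` ipow m S.
Proof.
by move=> SS; apply: imul_min => [|a x Sx]; [exact: ipow_is_sub | apply: is_subZ => //; apply: ipow_is_sub].
Qed.

Definition scl V (a : R) (v : V) : V := a *: v.

Fact scl_linear V a : linear (@scl V a).
Proof. by move=> c u v; rewrite /scl scalerDr !scalerA mulrC. Qed.

HB.instance Definition _ V a := GRing.isLinear.Build R V V *:%R (@scl V a) (@scl_linear V a).

Definition scls V : seq {linear V -> V} := [seq (@scl V (f a) : {linear V -> V}) | a <- enum 'I_r].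

Lemma in_sclsP V (u : {linear V -> V}) :
  List.In u (scls V) -> exists a, u = (@scl V (f a) : {linear V -> V}).
Proof. by move=> /List.in_map_iff[a [<- _]]; exists a. Qed.

End IdealPowers.

(** * Noetherian families built from a finitely generated graded family *)

Section GradedModules.
Context (R : comNzRingType) (hR : noetherian R) (r : nat) (f : 'I_r -> R).
Context (V : lmodType R).
Implicit Types (tl ul : seq {linear V -> V}) (G : nat -> set V).
Notation imul := (imul f).
Notation ipow := (ipow f).
Notation scls := (@scls R r f V).

Definition comm_list tl : Prop :=
  forall t u, List.In t tl -> List.In u tl -> forall v, t (u v) = u (t v).

Definition graded tl G : Prop :=
  (forall n, is_sub (G n)) /\ forall t, List.In t tl -> forall n v, G n v -> G n.+1 (t v).

Definition graded_fg tl G : Prop :=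
  exists2 s : seq (nat * V), forall p, List.In p s -> G p.1 p.2 &
    forall X, graded tl X -> (forall p, List.In p s -> X p.1 p.2) ->
      forall n, G n `<=` X n.

Lemma comm_hops tl ul : comm_list tl ->
  (forall u, List.In u ul -> exists a, forall v, u v = a *: v) -> commuting (hops tl ul).
Proof.
move=> C ulE _ _ /in_hopsP[[t tin ->]|[t /ulE[a tE] ->]] /in_hopsP[[u uin ->]|[u /ulE[b uE] ->]] v /=.
- exact: C.
- by rewrite !uE linearZ.
- by rewrite !tE linearZ.
- by rewrite !tE !uE !scalerA mulrC.
Qed.

Lemma scls_scale u : List.In u scls -> exists a, forall v, u v = a *: v.
Proof. by move=> /in_sclsP[a ->]; exists (f a). Qed.

Lemma id_scale (u : {linear V -> V}) :
  List.In u [:: (idfun : {linear V -> V})] -> exists a, forall v, u v = a *: v.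
Proof. by case=> // <-; exists 1 => v; rewrite scale1r. Qed.

(** Generators of [G] placed in second degree 0 generate the whole family, because the scalars [f a]
    raise the second degree and produce the powers of I: a Rees module of [G]. *)
Lemma noeth_ipow tl G : comm_list tl -> graded tl G -> graded_fg tl G ->
  noeth (hops tl scls) (@zero_fam _ V) (fun d => ipow d.2 (G d.1)).
Proof.
move=> C GG [s sG Gmin].
pose s' : seq (degree * V) := [seq ((p.1, 0%N), p.2) | p <- s].
have NY := noeth_gspan (s := s') hR (comm_hops C scls_scale).
apply: noeth_sub NY _ _ => [d x //|-[n m] /=].
have [SX FX] := gspan_fam (hops tl scls) s'.
elim: m => [|m IH] /=.
  have X1 : graded tl (fun n => gspan (hops tl scls) s' (n, 0%N)).
    split=> // t tin k v; apply: (FX (t, true)); apply/in_hopsP; left; by exists t.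
  refine (Gmin _ X1 _ n) => p ps; apply: (@mem_gspan _ _ _ s' ((p.1, 0%N), p.2)).
  by apply/List.in_map_iff; exists p.
apply: imul_min => // a x /IH; apply: (FX ((scl (f a) : {linear V -> V}), false)).
apply/in_hopsP; right; exists (scl (f a)) => //; apply/List.in_map_iff; exists a; split=> //.
by apply/In_mem; rewrite mem_enum.
Qed.

(** The identity serves as the operator raising the second degree, so a family depending on the
    first degree alone fits the theory with two degrees. *)
Lemma noeth_const tl G : comm_list tl -> graded tl G -> graded_fg tl G ->
  noeth (hops tl [:: (idfun : {linear V -> V})]) (@zero_fam _ V) (fun d => G d.1).
Proof.
move=> C GG [s sG Gmin].
pose s' : seq (degree * V) := [seq ((p.1, 0%N), p.2) | p <- s].
have NY := noeth_gspan (s := s') hR (comm_hops C id_scale).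
apply: noeth_sub NY _ _ => [d x //|-[n m] /=].
have [SX FX] := gspan_fam (hops tl [:: (idfun : {linear V -> V})]) s'.
elim: m => [|m IH] /=.
  have X1 : graded tl (fun n => gspan (hops tl [:: (idfun : {linear V -> V})]) s' (n, 0%N)).
    split=> // t tin k v; apply: (FX (t, true)); apply/in_hopsP; left; by exists t.
  refine (Gmin _ X1 _ n) => p ps; apply: (@mem_gspan _ _ _ s' ((p.1, 0%N), p.2)).
  by apply/List.in_map_iff; exists p.
move=> x /IH; apply: (FX ((idfun : {linear V -> V}), false)).
by apply/in_hopsP; right; exists idfun => //; left.
Qed.

Lemma graded_ipow tl G : graded tl G -> fam (hops tl scls) (fun d => ipow d.2 (G d.1)).
Proof.
move=> [SG TG]; split=> [d|p]; first exact: ipow_is_sub.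
move=> /in_hopsP[[t tin ->]|[u /in_sclsP[a ->] ->]] [n m] v /=.
  by apply: ipow_map => x; apply: TG.
by apply: imul_gen; apply: ipow_is_sub.
Qed.

Lemma graded_const tl G :
  graded tl G -> fam (hops tl [:: (idfun : {linear V -> V})]) (fun d => G d.1).
Proof.
move=> [SG TG]; split=> [d|p]; first exact: SG.
by move=> /in_hopsP[[t tin ->]|[u [<-|//] ->]] [n m] v //=; apply: TG.
Qed.

End GradedModules.

(** * Homology of a graded complex modulo powers of the ideal *)

Section HomologyLength.
Context (R : comNzRingType) (hR : noetherian R) (r : nat) (f : 'I_r -> R).
Context (V : lmodType R) (tl : seq {linear V -> V}) (C : comm_list tl).
Context (d : {linear V -> V}) (G G' B : nat -> set V).
Hypotheses (GG : graded tl G) (GG' : graded tl G') (GB : graded tl B).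
Hypotheses (fgG : graded_fg tl G) (fgG' : graded_fg tl G').
Hypothesis d_tl : forall t, List.In t tl -> forall v, d (t v) = t (d v).
Hypothesis dG : forall n v, G n v -> G' n (d v).
Hypothesis BG : forall n v, B n v -> G n v /\ d v = 0.
Notation ipow := (ipow f).
Notation scls := (@scls R r f V).
Notation id1 := [:: (idfun : {linear V -> V})].

(* [cycm n m / bdrm n m] is the homology of [G n / I^m G n]. *)
Definition cycm n m : set V := [set x | G n x /\ ipow m (G' n) (d x)].
Definition bdrm n m : set V := sub_add (B n) (ipow m (G n)).
Let cyc n : set V := [set x | G n x /\ d x = 0].

Let d_scl a v : d (scl a v) = a *: d v.
Proof. by rewrite /scl linearZ. Qed.

Let cyc_sub n : is_sub (cyc n).
Proof.
split=> [|a u v [Gu du] [Gv dv]]; first by split; [exact: is_sub0 (GG.1 n) | rewrite linear0].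
by split; [exact: (GG.1 n).2 | rewrite linearP du dv scaler0 addr0].
Qed.

Let iG_sub n m : is_sub (ipow m (G n)) := ipow_is_sub f m (GG.1 n).
Let iG'_sub n m : is_sub (ipow m (G' n)) := ipow_is_sub f m (GG'.1 n).

Lemma cycm_sub n m : is_sub (cycm n m).
Proof. exact: (setI_is_sub (GG.1 n) (preimage_is_sub d (iG'_sub n m))). Qed.

Lemma bdrm_sub n m : is_sub (bdrm n m).
Proof. by apply: sub_add_is_sub; [exact: GB.1 | exact: iG_sub]. Qed.

Let cycm_fam : fam (hops tl scls) (fun e => cycm e.1 e.2).
Proof.
split=> [e|p]; first exact: cycm_sub.
move=> /in_hopsP[[t tin ->]|[u /in_sclsP[a ->] ->]] [n m] v /= [Gv dv]; split.
- exact: GG.2.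
- by rewrite d_tl //; apply: ipow_map dv => x; apply: GG'.2.
- exact: (is_subZ (GG.1 n) (f a) Gv).
- by rewrite d_scl; apply: imul_gen dv.
Qed.

Let cyc_fam : fam (hops tl scls) (fun e => cyc e.1).
Proof.
split=> [e|p]; first exact: cyc_sub.
move=> /in_hopsP[[t tin ->]|[u /in_sclsP[a ->] ->]] [n m] v /= [Gv dv]; split.
- exact: GG.2.
- by rewrite d_tl // dv linear0.
- exact: (is_subZ (GG.1 n) (f a) Gv).
- by rewrite d_scl dv scaler0.
Qed.

Let iG_fam := graded_ipow f GG.

Let bdrm_fam : fam (hops tl scls) (fun e => bdrm e.1 e.2).
Proof.
split=> [e|p]; first exact: bdrm_sub.
move=> pin [n m] _ /= [b [u [Bb Iu ->]]]; rewrite linearD; exists (p.1 b), (p.1 u); split=> //.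
  move: pin => /in_hopsP[[t tin ->]|[v /in_sclsP[a ->] ->]] /=; first exact: GB.2.
  exact: (is_subZ (GB.1 n) (f a) Bb).
by have := iG_fam.2 _ pin (n, m) u Iu; case: (p.2).
Qed.

Let iG_cycm n m : ipow m (G n) `<=` cycm n m.
Proof. by move=> x Ix; split; [exact: (ipow_le (GG.1 n) Ix) | apply: ipow_map Ix; apply: dG]. Qed.

Let cyc_cycm n m : cyc n `<=` cycm n m.
Proof. by move=> x [Gx dx]; split=> //; rewrite dx; apply: is_sub0. Qed.

(** The homology [cycm / bdrm] is cut at [zi]: below it classes are represented by true cycles,
    above it only the image under [d] matters. *)
Let zi n m : set V := sub_add (cyc n) (ipow m (G n)).

Let zi_sub n m : is_sub (zi n m). Proof. exact: sub_add_is_sub. Qed.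

Let bdrm_zi n m : bdrm n m `<=` zi n m.
Proof. by move=> _ [b [u [/BG Zb Iu ->]]]; exists b, u. Qed.

Let zi_cycm n m : zi n m `<=` cycm n m.
Proof. by apply: sub_add_min; [exact: cycm_sub | exact: cyc_cycm | exact: iG_cycm]. Qed.

Hypothesis fin : forall n m, fin_len (bdrm n m) (cycm n m).

Let fin_zi n m : fin_len (bdrm n m) (zi n m) /\ fin_len (zi n m) (cycm n m).
Proof. by apply/(fin_lenE _ _ _ (@bdrm_zi n m) (@zi_cycm n m)) => //; [exact: bdrm_sub | exact: cycm_sub]. Qed.

(** [zi] is exactly the part of [cycm] whose image under [d] already comes from [ipow m (G n)]. *)
Let top_map n m :
  (fin_len (zi n m) (cycm n m) <-> fin_len (d @` ipow m (G n)) (d @` cycm n m)) /\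
  len (zi n m) (cycm n m) = len (d @` ipow m (G n)) (d @` cycm n m).
Proof.
apply: (len_map (f := d)) => [||v|w]; [exact: cycm_sub | exact: image_is_sub | |].
  split=> [zv|[Cv [u Iu du]]].
    split; first exact: zi_cycm.
    by case: zv => z [u [[_ dz] Iu ->]]; exists u => //; rewrite linearD dz add0r.
  exists (v - u), u; rewrite subrK; split=> //; split; last by rewrite linearB du subrr.
  by apply: (is_subB (GG.1 n)); [case: Cv | exact: (ipow_le (GG.1 n) Iu)].
split=> [[v Cv <-]|[v [z [Cv [u Iu <-] ->]]]].
  by exists v, 0; rewrite addr0; split=> //; exists 0; [exact: is_sub0 | exact: linear0].
by exists (v + u); rewrite ?linearD //; apply: (is_subD (cycm_sub n m)) => //; apply: iG_cycm.
Qed.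

Let im_fam (X : degree -> set V) : fam (hops tl scls) X -> fam (hops tl scls) (fun e => d @` X e).
Proof.
move=> [SX FX]; split=> [e|p pin e _ [v Xv <-]]; first exact: image_is_sub.
exists (p.1 v); first exact: FX.
by move: pin => /in_hopsP[[t tin ->]|[u /in_sclsP[a ->] ->]] /=; rewrite (d_tl, d_scl).
Qed.

Let comm_scls : commuting (hops tl scls).
Proof. exact: comm_hops C (@scls_scale _ _ _ _). Qed.

(* [d] carries [cycm / zi] onto a subquotient of [I^n (G' n)], which avoids Artin-Rees. *)
Let top_poly : ev_poly (fun n => (len (zi n n) (cycm n n))%:R).
Proof.
apply: (@ev_poly_ext 0%N (fun n => (len (d @` ipow (n + 0) (G (n + 0)%N)) (d @` cycm (n + 0) (n + 0)))%:R)).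
  by move=> n _; rewrite addn0 (top_map n n).2.
apply: (@hilbert_diagonal _ _ _ tl scls (fun e => d @` ipow e.2 (G e.1)) (fun e => d @` cycm e.1 e.2)) => //.
split=> //; [exact: im_fam | exact: im_fam | | split].
- by move=> [n m] _ [v Iv <-]; exists v => //; apply: iG_cycm.
- apply: noeth_sub (noeth_ipow hR C GG' fgG') _ _.
    by move=> e _ ->; exists 0; [exact: is_sub0 | exact: linear0].
  by move=> [n m] _ [v [_ dv] <-].
- by move=> [n m]; apply/(top_map n m).1; have [] := fin_zi n m.
Qed.

Let low n m : set V := cyc n `&` bdrm n m.

Let low_sub n m : is_sub (low n m).
Proof. by apply: setI_is_sub => //; apply: bdrm_sub. Qed.

Let bot_map n m :
  (fin_len (low n m) (cyc n) <-> fin_len (bdrm n m) (zi n m)) /\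
  len (low n m) (cyc n) = len (bdrm n m) (zi n m).
Proof.
apply: (len_map (f := idfun)) => [||v|w] //; first exact: bdrm_sub.
split=> [[z [u [Zz Iu ->]]]|[v [b [Zv [c [u [/BG Zc Iu ->]]] ->]]]].
  by exists z, u; split=> //; apply: sub_addr Iu; exact: GB.1.
by exists (v + c), u; rewrite addrA; split=> //; apply: (is_subD (cyc_sub n)).
Qed.

Let lowS n m : low n m.+1 `<=` low n m.
Proof.
move=> x [Zx [b [u [Bb Iu xE]]]]; split=> //; exists b, u; split=> //.
exact: (ipowS_le (GG.1 n) Iu).
Qed.

Let low0 n : low n 0 = cyc n.
Proof.
apply/seteqP; split=> [x []//|x Zx]; split=> //.
by apply: (sub_addr (GB.1 n)); case: Zx.
Qed.

Let low_cyc n m : low n m `<=` cyc n. Proof. by move=> x []. Qed.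

(** [low n m] contains [B n], so a class in [low n m / low n m.+1] can be moved into [ipow m (G n)]
    by a boundary. This quotient is therefore [Y / X], a subquotient of a family already known to be
    noetherian. *)
Let Y (e : degree) : set V := cyc e.1 `&` ipow e.2 (G e.1).
Let X (e : degree) : set V := Y e `&` bdrm e.1 e.2.+1.

Let step_map n m :
  (fin_len (X (n, m)) (Y (n, m)) <-> fin_len (low n m.+1) (low n m)) /\
  len (X (n, m)) (Y (n, m)) = len (low n m.+1) (low n m).
Proof.
apply: (len_map (f := idfun)) => [||v|w] //; first exact: setI_is_sub.
- by split=> [[[Zv Iv] Bv]|[[Zv Iv] [_ Bv]]].
- split=> [[Zw [b [u [Bb Iu wE]]]]|[v [z [[Zv Iv] /lowS lz ->]]]].
    exists u, b; rewrite wE addrC; split=> //; split=> //.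
    + rewrite (_ : u = w - b); last by rewrite wE addrAC subrr add0r.
      by apply: (is_subB (cyc_sub n)) => //; apply: BG.
    + exact: BG.
    + exact: (sub_addl (iG_sub n m.+1)).
  apply: (is_subD (low_sub n m)) => //; split=> //.
  exact: (sub_addr (GB.1 n)).
Qed.

Let len_low n m : len (low n m) (cyc n) = (\sum_(k < m) len (X (n, k : nat)) (Y (n, k : nat)))%N.
Proof.
elim: m => [|m IH]; first by rewrite low0 big_ord0 len0.
rewrite big_ord_recr /= -IH addnC (step_map n m).2; apply: len_add => //.
by apply/(bot_map n m.+1).1; have [] := fin_zi n m.+1.
Qed.

(* [zi / bdrm] is filtered by the intersections of [cyc] with [bdrm n m], [m < n]. *)
Let bot_poly : ev_poly (fun n => (len (bdrm n n) (zi n n))%:R).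
Proof.
apply: (@ev_poly_ext 0%N (fun n => \sum_(k < n) (len (X (n + 0, k : nat)%N) (Y (n + 0, k : nat)%N))%:R)).
  by move=> n _; rewrite addn0 -(bot_map n n).2 len_low natr_sum.
apply: (@hilbert_sum _ _ tl scls X Y).
have YF : fam (hops tl scls) Y.
  split=> [e|p pin e v [Zv Iv]]; first exact: setI_is_sub.
  by split; [exact: (cyc_fam.2 _ pin) | exact: (iG_fam.2 _ pin)].
split=> //; [ | | split].
- split=> [e|p pin [n m] v [Yv Bv]]; first by apply: setI_is_sub; [exact: YF.1 | exact: bdrm_sub].
  by split; [exact: (YF.2 _ pin) | have := bdrm_fam.2 _ pin (n, m.+1) v Bv; case: (p.2)].
- by move=> e x [].
- apply: noeth_sub (noeth_ipow hR C GG fgG) _ _; last by move=> e x [].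
  by move=> e _ ->; apply: is_sub0; apply: setI_is_sub; [exact: YF.1 | exact: bdrm_sub].
- move=> [n m]; apply/(step_map n m).1.
  have : fin_len (low n m.+1) (cyc n).
    by apply/(bot_map n m.+1).1; have [] := fin_zi n m.+1.
  by case/(fin_lenE (low_sub n m.+1) (low_sub n m) (cyc_sub n) (@lowS n m) (@low_cyc n m)).
Qed.

Lemma homology_poly : ev_poly (fun n => (len (bdrm n n) (cycm n n))%:R).
Proof.
apply: (@ev_poly_ext 0%N (fun n => (len (bdrm n n) (zi n n))%:R + (len (zi n n) (cycm n n))%:R)).
  by move=> n _; rewrite -natrD -len_add //; [exact: bdrm_sub | exact: cycm_sub].
exact: ev_polyD.
Qed.

End HomologyLength.

(** * Images in homology of a map that turns the operators into scalars *)

Section ImageLength.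
Context (R : comNzRingType) (hR : noetherian R) (r : nat) (f : 'I_r -> R).
Context (V : lmodType R) (T : 'I_r -> {linear V -> V}).
Let tl := [seq T a | a <- enum 'I_r].
Hypothesis T_comm : forall a b v, T a (T b v) = T b (T a v).
Context (d phi : {linear V -> V}) (G G' : nat -> set V) (Q B : set V).
Hypotheses (GG : graded tl G) (GG' : graded tl G').
Hypotheses (fgG : graded_fg tl G) (fgG' : graded_fg tl G').
Hypotheses (SQ : is_sub Q) (SB : is_sub B).
Hypothesis d_T : forall a v, d (T a v) = T a (d v).
Hypothesis phi_T : forall a v, phi (T a v) = f a *: phi v.
Notation ipow := (ipow f).
Notation scls := (@scls R r f V).
Notation id1 := [:: (idfun : {linear V -> V})].

Let A n m : set V := cycm f d G G' n m.
Let S0 m : set V := sub_add B (ipow m Q).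
Let cyc n : set V := [set x | G n x /\ d x = 0].
(** [S0] collects the boundaries modulo I^m. The image of [phi] above it is cut at [S1], the part
    reached from true cycles. *)
Let S1 n m : set V := sub_add (phi @` cyc n) (S0 m).
Let S2 n m : set V := sub_add (phi @` A n m) (S0 m).

Hypothesis fin : forall n m, fin_len (S0 m) (S2 n m).

Let in_tlP t : List.In t tl <-> exists a, t = T a.
Proof.
rewrite /tl List.in_map_iff; split=> [[a [<- _]]|[a ->]]; first by exists a.
exists a; split=> //.
by apply/In_mem; rewrite mem_enum.
Qed.

Let C : comm_list tl.
Proof. by move=> t u /in_tlP[a ->] /in_tlP[b ->] v. Qed.

Let A_sub n m : is_sub (A n m). Proof. exact: (cycm_sub f d GG GG'). Qed.

Let S0_sub m : is_sub (S0 m).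
Proof. by apply: sub_add_is_sub => //; apply: ipow_is_sub. Qed.

Let cyc_sub n : is_sub (cyc n).
Proof. exact: (setI_is_sub (GG.1 n) (preimage_is_sub d (set0_is_sub _))). Qed.

Let S1_sub n m : is_sub (S1 n m).
Proof. by apply: sub_add_is_sub => //; apply: image_is_sub. Qed.

Let S2_sub n m : is_sub (S2 n m).
Proof. by apply: sub_add_is_sub => //; apply: image_is_sub. Qed.

Let cyc_A n m : cyc n `<=` A n m.
Proof. by move=> x [Gx dx]; split=> //; rewrite dx; exact: (is_sub0 (ipow_is_sub f m (GG'.1 n))). Qed.

Let S01 n m : S0 m `<=` S1 n m.
Proof. exact: (sub_addr (image_is_sub phi (cyc_sub n))). Qed.

Let S12 n m : S1 n m `<=` S2 n m.
Proof. by move=> _ [_ [u [[x /(@cyc_A n m) Ax <-] Su ->]]]; exists (phi x), u; split=> //; exists x. Qed.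

Let fin1 n m : fin_len (S0 m) (S1 n m) /\ fin_len (S1 n m) (S2 n m).
Proof. by apply/(fin_lenE (S0_sub m) (S1_sub n m) (S2_sub n m) (@S01 n m) (@S12 n m)). Qed.

Let S0_scl a m v : S0 m v -> S0 m.+1 (f a *: v).
Proof.
move=> [b [u [Bb Iu ->]]]; exists (f a *: b), (f a *: u); rewrite scalerDr; split=> //.
  exact: is_subZ.
by apply: imul_gen Iu; apply: ipow_is_sub.
Qed.

Let S0_scl' a m v : S0 m v -> S0 m (f a *: v).
Proof. exact: is_subZ. Qed.

Let cyc_T a n v : cyc n v -> cyc n.+1 (T a v).
Proof.
move=> [Gv dv]; split; last by rewrite d_T dv linear0.
by apply: GG.2 => //; apply/in_tlP; exists a.
Qed.

(** Degree and exponent are tied here: [phi] turns [T a] into multiplication by [f a], which carries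
    [S0 n] into [S0 n.+1], so the condition at exponent [n] is stable under the operators. *)
Let X (e : degree) : set V := cyc e.1 `&` phi @^-1` S0 e.1.

Let low_map n :
  (fin_len (X (n, 0%N)) (cyc n) <-> fin_len (S0 n) (S1 n n)) /\
  len (X (n, 0%N)) (cyc n) = len (S0 n) (S1 n n).
Proof.
apply: (len_map (f := phi)) => // w; split=> [[_ [u [[v Zv <-] Su ->]]]|[v [u [Zv Su ->]]]].
  by exists v, u.
by exists (phi v), u; split=> //; exists v.
Qed.

Let low_poly : ev_poly (fun n => (len (S0 n) (S1 n n))%:R).
Proof.
pose Y (e : degree) : set V := cyc e.1.
apply: (@ev_poly_ext 0%N (fun n => (len (X (n + 0, n + 0)%N) (Y (n + 0, n + 0)%N))%:R)).
  by move=> n _; rewrite addn0 -(low_map n).2.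
apply: (@hilbert_diagonal _ _ _ tl id1 X Y) => //.
have gcyc : graded tl cyc by split=> // t /in_tlP[a ->] n v; apply: cyc_T.
split=> //; [exact: comm_hops C (@id_scale _ _) | | | | split].
- split=> [e|p]; first by apply: setI_is_sub => //; apply: preimage_is_sub.
  move=> /in_hopsP[[t /in_tlP[a ->] ->]|[u [<-|//] ->]] [n m] v //= [Zv Sv].
  by split; [exact: cyc_T | rewrite /preimage /= phi_T; apply: S0_scl].
- exact: graded_const gcyc.
- by move=> e x [].
- apply: noeth_sub (noeth_const hR C GG fgG) _ _; last by move=> e x [].
  by move=> e _ ->; apply: is_sub0; apply: setI_is_sub => //; apply: preimage_is_sub.
- by move=> [n m]; apply/(low_map n).1; have [] := fin1 n n.
Qed.

(** [A / K] is [S2 / S1] through [phi]. As [phi] sends true cycles into [S1], [K] contains the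
    kernel of [d] on [A], and [d] identifies [A / K] with a subquotient of [ipow m (G' n)]. *)
Let K n m : set V := A n m `&` phi @^-1` S1 n m.

Let K_sub n m : is_sub (K n m).
Proof. by apply: setI_is_sub => //; apply: preimage_is_sub. Qed.

Let up_map n m :
  (fin_len (K n m) (A n m) <-> fin_len (S1 n m) (S2 n m)) /\
  len (K n m) (A n m) = len (S1 n m) (S2 n m).
Proof.
apply: (len_map (f := phi)) => // w; split=> [[_ [u [[v Av <-] Su ->]]]|[v [u [Av Su ->]]]].
  by exists v, u; split=> //; apply: S01.
have SSv : S2 n m (phi v).
  by exists (phi v), 0; rewrite addr0; split; [exists v | exact: (is_sub0 (S0_sub m)) |].
by apply: (is_subD (S2_sub n m)) => //; apply: S12.
Qed.

Let d_map n m :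
  (fin_len (K n m) (A n m) <-> fin_len (d @` K n m) (d @` A n m)) /\
  len (K n m) (A n m) = len (d @` K n m) (d @` A n m).
Proof.
apply: (len_map (f := d)) => [//||v|w]; first exact: image_is_sub.
  split=> [Kv|[Av [u Ku du]]]; first by split; [case: Kv | exists v].
  rewrite -[v](subrK u); apply: (is_subD (K_sub n m)) => //.
  have Zvu : cyc n (v - u).
    split; last by rewrite linearB du subrr.
    by apply: (is_subB (GG.1 n)); [case: Av | case: Ku => -[]].
  split; first exact: cyc_A.
  by exists (phi (v - u)), 0; rewrite addr0; split; [exists (v - u) | exact: (is_sub0 (S0_sub m)) |].
split=> [[v Av <-]|[v [_ [Av [u [Au _] <-] ->]]]].
  by exists v, 0; rewrite addr0; split=> //; exists 0; [exact: is_sub0 | exact: linear0].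
by exists (v + u); rewrite ?linearD //; apply: (is_subD (A_sub n m)).
Qed.

Let up_poly : ev_poly (fun n => (len (S1 n n) (S2 n n))%:R).
Proof.
apply: (@ev_poly_ext 0%N (fun n => (len (d @` K (n + 0) (n + 0)) (d @` A (n + 0) (n + 0)))%:R)).
  by move=> n _; rewrite addn0 -(d_map n n).2 (up_map n n).2.
apply: (@hilbert_diagonal _ _ _ tl scls (fun e => d @` K e.1 e.2) (fun e => d @` A e.1 e.2)) => //.
have d_scl a v : d (scl a v) = a *: d v by rewrite /scl linearZ.
have phi_scl a v : phi (scl a v) = a *: phi v by rewrite /scl linearZ.
have AF : fam (hops tl scls) (fun e => A e.1 e.2).
  split=> [e|p]; first exact: A_sub.
  move=> /in_hopsP[[t /in_tlP[a ->] ->]|[u /in_sclsP[a ->] ->]] [n m] v /= [Gv dv]; split.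
  - by apply: GG.2 => //; apply/in_tlP; exists a.
  - by rewrite d_T; apply: ipow_map dv => x; apply: GG'.2; apply/in_tlP; exists a.
  - exact: (is_subZ (GG.1 n)).
  - by rewrite d_scl; apply: imul_gen dv; apply: ipow_is_sub; apply: GG'.1.
have KF : fam (hops tl scls) (fun e => K e.1 e.2).
  split=> [e|p pin [n m] v [Av [_ [u [[z Zz <-] Su vE]]]]]; first exact: K_sub.
  split; first by have := AF.2 _ pin (n, m) v Av; case: (p.2).
  rewrite /preimage /=; move: pin => /in_hopsP[[t /in_tlP[a ->] ->]|[w /in_sclsP[a ->] ->]] /=.
    exists (phi (T a z)), (f a *: u); rewrite !phi_T vE scalerDr; split=> //; last exact: S0_scl'.
    by exists (T a z); [exact: cyc_T | rewrite phi_T].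
  exists (phi (f a *: z)), (f a *: u); rewrite phi_scl vE scalerDr linearZ; split=> //; last exact: S0_scl.
  by exists (f a *: z); [exact: is_subZ | rewrite linearZ].
have im_fam (Z : degree -> set V) : fam (hops tl scls) Z -> fam (hops tl scls) (fun e => d @` Z e).
  move=> [SZ FZ]; split=> [e|p pin e _ [v Zv <-]]; first exact: image_is_sub.
  exists (p.1 v); first exact: FZ.
  by move: pin => /in_hopsP[[t /in_tlP[a ->] ->]|[u /in_sclsP[a ->] ->]] /=; rewrite (d_T, d_scl).
split; [exact: comm_hops C (@scls_scale _ _ _ _) | exact: im_fam | exact: im_fam | | split].
- by move=> [n m] _ [v [Av _] <-]; exists v.
- apply: noeth_sub (noeth_ipow hR C GG' fgG') _ _; last by move=> e _ [v [_ dv] <-].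
  by move=> e _ ->; exists 0; [exact: is_sub0 | exact: linear0].
- by move=> [n m]; apply/(d_map n m).1/(up_map n m).1; have [] := fin1 n m.
Qed.

Lemma image_poly : ev_poly (fun n => (len (sub_add B (ipow n Q))
  (sub_add (phi @` cycm f d G G' n n) (sub_add B (ipow n Q))))%:R).
Proof.
apply: (@ev_poly_ext 0%N (fun n => (len (S0 n) (S1 n n))%:R + (len (S1 n n) (S2 n n))%:R)).
  by move=> n _; rewrite -natrD -len_add.
exact: ev_polyD.
Qed.

End ImageLength.

(** * Finite length *)

Section FiniteLength.
Context (R : comNzRingType).

Section Module.
Context (V : lmodType R).
Implicit Types (S X Y B : set V) (s : seq V).

Definition gen_sub s : set V := fun v => forall S, is_sub S -> (forall x, List.In x s -> S x) -> S v.

Lemma gen_sub_is_sub s : is_sub (gen_sub s).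
Proof.
split=> [S SS _|a u v su sv S SS sS]; first exact: is_sub0.
by apply: SS.2; [exact: su | exact: sv].
Qed.

Lemma mem_gen_sub s x : List.In x s -> gen_sub s x.
Proof. by move=> sx S _; apply. Qed.

Lemma gen_sub_min s S : is_sub S -> (forall x, List.In x s -> S x) -> gen_sub s `<=` S.
Proof. by move=> SS sS v; apply. Qed.

Definition sub_fg X : Prop := exists2 s, (forall x, List.In x s -> X x) & X `<=` gen_sub s.

Definition noeth_sub_of Y : Prop := forall X, is_sub X -> X `<=` Y -> sub_fg X.

Context (P : {pred R}) (hP : maximal_ideal P).

(** Otherwise [P + R a] is a proper ideal containing [P], hence [P] itself, and it contains [a]. *)
Lemma maximal_bezout a : a \notin P -> exists p u, p \in P /\ 1 = p + u * a.
Proof.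
move=> aP; apply: contrapT => nex; have [[P0 P1 PP] Pmax] := hP.
pose J : {pred R} := fun x => `[< exists p u, p \in P /\ x = p + u * a >].
have JE x : (x \in J) = `[< exists p u, p \in P /\ x = p + u * a >] by [].
have PJ : {subset P <= J}.
  by move=> x Px; rewrite JE; apply/asboolP; exists x, 0; rewrite mul0r addr0.
have JP : J =i P.
  apply: Pmax => //; split; first exact: PJ.
    by rewrite JE; apply/asboolPn.
  move=> c x y /[!JE] /asboolP[p [u [Pp ->]]] /asboolP[q [v [Pq ->]]].
  apply/asboolP; exists (c * p + q), (c * u + v); split; first exact: PP.
  by rewrite mulrDr mulrDl mulrA addrACA.
move: aP; rewrite -JP JE => /asboolPn; apply; exists 0, 1; split=> //.
by rewrite mul1r add0r.
Qed.

Lemma fin_len_refl B : is_sub B -> fin_len B B.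
Proof.
move=> SB; apply: (@fin_len_bound _ _ _ _ 0%N) => // m S [Sin Slt].
rewrite leqNgt; apply/negP => m0; have [_ nS] := Slt 0%N m0; apply: nS => x Sx.
by have [_ BS _] := Sin 0%N (leq0n _); have [_ _ SB1] := Sin 1%N m0; apply/BS/SB1.
Qed.

(** Generators are adjoined one at a time. Each step is a cyclic module killed by [P], so a vector
    space of dimension at most one over the residue field. *)
Lemma fin_len_killed s B : is_sub B -> (forall p x, p \in P -> List.In x s -> B (p *: x)) ->
  fin_len B (sub_add B (gen_sub s)).
Proof.
elim: s B => [|x s IH] B SB kill.
  rewrite (_ : sub_add B _ = B); first exact: fin_len_refl.
  apply/seteqP; split; last exact: sub_addl (gen_sub_is_sub _).
  by apply: sub_add_min => //; apply: gen_sub_min.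
pose B1 : set V := [set y | exists b a, B b /\ y = b + a *: x].
have SB1 : is_sub B1.
  split=> [|c _ _ [b [a [Bb ->]]] [b' [a' [Bb' ->]]]].
    by exists 0, 0; rewrite scale0r addr0; split=> //; apply: is_sub0.
  exists (c *: b + b'), (c * a + a'); split; first exact: SB.2.
  by rewrite scalerDr scalerA scalerDl addrACA.
have BB1 : B `<=` B1 by move=> b Bb; exists b, 0; rewrite scale0r addr0.
have B1x : B1 x by exists 0, 1; rewrite add0r scale1r; split=> //; apply: is_sub0.
have SE : sub_add B (gen_sub (x :: s)) = sub_add B1 (gen_sub s).
  have Sg := @gen_sub_is_sub; apply/seteqP; split; apply: sub_add_min.
  - exact: sub_add_is_sub.
  - by move=> b /BB1; apply: sub_addl.
  - apply: gen_sub_min => [|y [<-|sy]]; first exact: sub_add_is_sub.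
      exact: sub_addl.
    by apply: sub_addr => //; apply: mem_gen_sub.
  - exact: sub_add_is_sub.
  - move=> _ [b [a [Bb ->]]]; exists b, (a *: x); split=> //.
    by apply: (is_subZ (Sg _)); apply: mem_gen_sub; left.
  - apply: gen_sub_min => [|y sy]; first exact: sub_add_is_sub.
    by apply: sub_addr => //; apply: mem_gen_sub; right.
rewrite SE; apply/(fin_lenE SB SB1) => //.
- by apply: sub_add_is_sub => //; apply: gen_sub_is_sub.
- by apply: sub_addl; apply: gen_sub_is_sub.
split; last first.
  by apply: IH => // p y Pp sy; apply: BB1; apply: kill => //; right.
apply: (@fin_len_bound _ _ _ _ 1%N) => // m S [Sin Slt]; rewrite leqNgt; apply/negP => m1.
have m0 : (0 < m)%N by apply: ltn_trans m1.
have [_ nS0] := Slt 0%N m0; have [_ nS1] := Slt 1%N m1.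
have [_ BS0 _] := Sin 0%N (leq0n _); have [SS1 BS1 S1B] := Sin 1%N m0.
apply: nS1 => y S2y.
suff Sx : S 1%N x.
  have [_ _ S2B] := Sin 2%N m1; have [b [a [Bb ->]]] := S2B y S2y.
  by apply: (is_subD SS1); [exact: BS1 | exact: is_subZ].
apply: contrapT => nSx; apply: nS0 => z Sz; have [b [a [Bb zE]]] := S1B z Sz.
have [Pa|Pa] := boolP (a \in P).
  apply: BS0; rewrite zE; apply: (is_subD SB) => //.
  by apply: kill => //; left.
(* A coefficient outside [P] is invertible modulo [P], which recovers [x] from [z]. *)
have [p [u [Pp uE]]] := maximal_bezout Pa; case: nSx.
rewrite -[x]scale1r uE scalerDl; apply: (is_subD SS1).
  by apply: BS1; apply: kill => //; left.
rewrite -scalerA; apply: (is_subZ SS1).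
rewrite (_ : a *: x = z - b); last by rewrite zE addrAC subrr add0r.
by apply: (is_subB SS1) => //; apply: BS1.
Qed.

(** The colon ideal [(B : Y)]. *)
Definition kill_into B Y : {pred R} := fun a => `[< forall y, Y y -> B (a *: y) >].

Lemma kill_intoP B Y a : reflect (forall y, Y y -> B (a *: y)) (a \in kill_into B Y).
Proof. exact: asboolP. Qed.

Lemma kill_into_ideal B Y : is_sub B -> is_ideal (kill_into B Y).
Proof.
move=> SB; split=> [|c a b /kill_intoP Ka /kill_intoP Kb]; apply/kill_intoP => y Yy.
  by rewrite scale0r; apply: is_sub0.
by rewrite scalerDl -scalerA; apply: SB.2; [exact: Ka | exact: Kb].
Qed.

(** Induction on [L] and on the exponent of its head [p], cutting [Y / B] at [B + p Y]. The upper
    part is killed by [p], which moves from [L] into the annihilator; on the lower part the exponent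
    drops. With [L] empty the annihilator contains [P]. *)
Lemma fin_len_nilpotent (L : seq R) B Y : is_sub B -> is_sub Y -> B `<=` Y -> noeth_sub_of Y ->
  (forall J : {pred R}, is_ideal J -> {subset kill_into B Y <= J} ->
     (forall a, List.In a L -> a \in J) -> {subset P <= J}) ->
  (forall a, List.In a L -> exists c, a ^+ c \in kill_into B Y) ->
  fin_len B Y.
Proof.
elim: L B Y => [|p L IH] B Y SB SY BY NY gen nil.
  have [s sY Ys] := NY Y SY (fun x => id).
  have -> : Y = sub_add B (gen_sub s).
    apply/seteqP; split; first by move=> y /Ys; apply: sub_addr.
    by apply: sub_add_min => //; apply: gen_sub_min.
  apply: fin_len_killed => // q x Pq sx; have : q \in kill_into B Y.
    by apply: (gen _ (kill_into_ideal _ SB)).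
  by move/kill_intoP; apply; apply: sY.
have [c] := nil p (or_introl erefl); elim: c Y SY BY NY gen nil => [|c IHc] Y SY BY NY gen nil.
  move=> /kill_intoP p1; rewrite (_ : Y = B); first exact: fin_len_refl.
  by apply/seteqP; split=> // y /p1; rewrite expr0 scale1r.
move=> /kill_intoP pc.
pose Y1 := sub_add B (@scl R V p @` Y).
have SpY : is_sub (@scl R V p @` Y) by apply: image_is_sub.
have SY1 : is_sub Y1 by apply: sub_add_is_sub.
have Y1Y : Y1 `<=` Y.
  by apply: sub_add_min => // _ [y Yy <-]; apply: (is_subZ SY).
have BY1 : B `<=` Y1 by apply: sub_addl.
have KY1 : {subset kill_into B Y <= kill_into B Y1}.
  by move=> a /kill_intoP Ka; apply/kill_intoP => y /Y1Y; apply: Ka.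
apply/(fin_lenE SB SY1 SY BY1 Y1Y); split.
  apply: IHc => //.
  - by move=> X SX XY1; apply: NY => // x /XY1/Y1Y.
  - by move=> J JI KJ; apply: gen => // a /KY1/KJ.
  - by move=> a /nil[k /KY1 ak]; exists k.
  - apply/kill_intoP => _ [b [_ [Bb [y Yy <-] ->]]]; rewrite scalerDr.
    apply: (is_subD SB); first exact: (is_subZ SB).
    by rewrite /scl scalerA -exprSr; apply: pc.
have KYY : {subset kill_into B Y <= kill_into Y1 Y}.
  by move=> a /kill_intoP Ka; apply/kill_intoP => y /Ka; apply: BY1.
apply: IH => //.
- move=> J JI KJ LJ; apply: gen => // [a /KYY/KJ//|a [<-|]]; last exact: LJ.
  by apply: KJ; apply/kill_intoP => y Yy; apply: (sub_addr SB); exists y.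
- by move=> a La; have [k /KYY ak] := nil a (or_intror La); exists k.
Qed.

End Module.

Section Graded.
Context (hR : noetherian R) (r : nat) (f : 'I_r -> R) (V : lmodType R).

(** The family that is [X] in degree [n], zero below and all of [G] above is finitely generated;
    since operators only raise the degree, its generators of degree [n] generate [X]. *)
Lemma graded_fg_piece (tl : seq {linear V -> V}) (G : nat -> set V) n :
  comm_list tl -> graded tl G -> graded_fg tl G -> noeth_sub_of (G n).
Proof.
move=> C GG fgG X SX XG; have [SG TG] := GG.
pose W (S T : set V) k : set V := if (k < n)%N then [set 0] else if k == n then S else T.
have NG := noeth_const hR C GG fgG.
have gW (S : set V) (T : nat -> set V) : is_sub S -> (forall k, is_sub (T k)) ->
    (forall t, List.In t tl -> forall v, S v -> T n.+1 (t v)) ->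
    (forall k, forall t, List.In t tl -> forall v, T k v -> T k.+1 (t v)) ->
    graded tl (fun k => W S (T k) k).
  move=> SS ST ST1 TT; split=> [k|t tin k v]; rewrite /W.
    by case: ifP => _; [exact: set0_is_sub | case: ifP].
  case: (ltngtP k n) => [kn|nk|->].
  - move=> ->; rewrite linear0; case: ifP => _; first by [].
    by case: ifP => _; apply: is_sub0.
  - rewrite ltnNge (leq_trans (ltnW nk)) //= gtn_eqF ?(leq_trans nk) //; exact: TT.
  - by rewrite ltnNge leqnSn /= gtn_eqF //; apply: ST1.
have gX : graded tl (fun k => W X (G k) k).
  apply: (gW X G) => // [t tin v /XG|k t tin v]; exact: TG.
have [|s [sW Ws]] := noeth_fingen NG (graded_const gX).
  move=> [k m] v /=; rewrite /W; case: ifP => _; first by move=> ->; apply: is_sub0.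
  by case: eqP => [-> /XG|].
exists [seq p.2 | p <- s & p.1.1 == n] => [x /List.in_map_iff[[[k m] v] /= [<-]]|x Xx].
  move=> /List.filter_In[ps /= /eqP kn]; have := sW _ ps.
  by rewrite /W /= kn ltnn eqxx.
move=> S SS sS.
(* This test family imposes nothing above degree [n], which isolates the generators of degree
   [n]. *)
have gS : graded tl (fun k => W S [set: V] k) by apply: (gW S (fun=> [set: V])).
have := Ws (n, 0%N) x; rewrite /= {1}/W ltnn eqxx => /(_ Xx) /(_ _ (graded_const gS)).
rewrite /= /W ltnn eqxx; apply => -[[k m] v] ps /=.
have := sW _ ps; rewrite /W /=; case: ltnP => // kn; case: eqP => // kE _.
apply: sS; apply/List.in_map_iff; exists ((k, m), v); split=> //.
by apply/List.filter_In; split=> //=; apply/eqP.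
Qed.

(** Modulo [B] each factor [x + y] acts on [A] as [x], which lies in the ideal, so [m] factors land
    in [ipow f m A + B]. *)
Lemma kill_pow (A B : set V) (x y : R) (c : 'I_r -> R) m :
  is_sub A -> is_sub B -> x = \sum_a c a * f a -> y \in kill_into B A ->
  ipow f m A `<=` B -> (x + y) ^+ m \in kill_into B A.
Proof.
move=> SA SB xE /kill_intoP Ky Im; apply/kill_intoP => v Av.
suff : sub_add (ipow f m A) B ((x + y) ^+ m *: v).
  by apply: sub_add_min.
elim: m {Im} => [|m [u [b [Iu Bb uE]]]].
  by rewrite expr0 scale1r; apply: sub_addl.
have SIm := ipow_is_sub f m SA.
exists (x *: u), (y *: u + (x + y) *: b); split.
- exists (fun a => c a *: u); split=> [a|]; first exact: (is_subZ SIm).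
  by rewrite xE scaler_suml; apply: eq_bigr => a _; rewrite scalerA mulrC.
- apply: (is_subD SB); last exact: (is_subZ SB).
  by apply: Ky; apply: ipow_le Iu.
- by rewrite exprS -scalerA uE scalerDr [in LHS]scalerDl addrA.
Qed.

End Graded.
End FiniteLength.

(** * Comparison of resolutions and Tor *)

Section LengthOfModules.
Context (R : comNzRingType).
Implicit Types U V W : lmodType R.

Lemma is_sub_mem V (S : {pred V}) : submod_closed S <-> is_sub [set v | v \in S].
Proof. by split=> -[S0 SP]; split=> // a u v; apply: SP. Qed.

Lemma has_lengthE V k : has_length V k <-> len_is [set (0 : V)] [set: V] k.
Proof.
have E m : (exists S, submodule_chain (V := V) m S) <-> (exists S, chain [set (0 : V)] [set: V] m S).
  split=> -[S [Sin Slt]].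
    exists (fun j => [set v | v \in S j]); split=> j jm.
      have SS := Sin j jm; split=> //.
      by move=> _ ->; apply: SS.1.
    have [SS nS] := Slt j jm; split=> [x|le]; first exact: SS.
    by apply: nS => x; apply: le.
  have Sm j x : (x \in (fun v => `[< S j v >] : bool)) = `[< S j x >] by [].
  exists (fun j v => `[< S j v >]); split=> j jm.
    have [SS _ _] := Sin j jm; apply: (is_sub_mem (fun v => `[< S j v >])).2.
    rewrite (_ : [set v | _] = S j) //; apply/seteqP; split=> x /=.
      by move/asboolP.
    by move=> Sx; apply/asboolP.
  have [SS nS] := Slt j jm; split=> [x /asboolP Sx|le]; first by apply/asboolP/SS.
  by apply: nS => x Sx; apply/asboolP/le/asboolP.
split=> -[ex bnd]; split; try exact/E.
  by move=> m S cS; have [S' /bnd] : exists S, submodule_chain (V := V) m S by apply/E; exists S.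
by move=> m S cS; have [S' /bnd] : exists S, chain [set (0 : V)] [set: V] m S by apply/E; exists S.
Qed.

Lemma homology_len U V W (f : {linear U -> V}) (g : {linear V -> W}) k :
  (forall u, g (f u) = 0) ->
  has_length (homology f g) k <-> len_is (range f) [set v | g v = 0] k.
Proof.
move=> gf; rewrite has_lengthE.
pose K : set (submodule (lker_pred g)) := [set z | exists u, f u = val z].
have SK : is_sub K.
  split=> [|a z w [u uE] [v vE]]; first by exists 0; rewrite linear0.
  by exists (a *: u + v); rewrite !linearP uE vE.
rewrite -(@len_is_map _ _ _ (quotmod_pi (@boundaries R U V W f g)) K [set: submodule (lker_pred g)]) //; last 3 first.
- exact: set0_is_sub.
- move=> z; split=> [[u uE]|[_ z0]].
    split=> //; apply/eqP; rewrite -[X in _ == X](linear0 (quotmod_pi (@boundaries R U V W f g))).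
    by rewrite quotmod_piP subr0; apply/asboolP; exists u.
  have : quotmod_pi (@boundaries R U V W f g) z == quotmod_pi (@boundaries R U V W f g) 0 by rewrite z0 linear0.
  by rewrite quotmod_piP subr0 => /asboolP.
- move=> w; split=> // _; exists (quotmod_repr w), 0; split=> //.
  by rewrite addr0; apply: esym; apply: quotmod_reprK.
apply: (@len_is_map _ _ _ (val : {linear submodule (lker_pred g) -> V})) => //.
- exact: image_is_sub.
- by move=> z; split=> [[u uE]|[_ [u _ uE]]]; [split=> //; exists u | exists u].
- move=> w; split=> [gw|[z [_ [_ [u _ <-] ->]]]].
    have wK : w \in lker_pred g by rewrite unfold_in; apply/eqP.
    exists (Submodule wK), 0; rewrite addr0; split=> //; exists 0 => //; exact: linear0.
  by rewrite /= linearD gf addr0; have /eqP := valP z.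
Qed.

End LengthOfModules.

(** * Linear maps out of free modules and tensor products *)

Section Tensor.
Context (R : comNzRingType).
Implicit Types M N W : lmodType R.

Lemma malg_linearE (K : choiceType) W (h : {linear {malg R[K]} -> W}) g :
  h g = \sum_(k <- msupp g) g@_k *: h << k >>.
Proof.
rewrite {1}[g]monalgE linear_sum; apply: eq_bigr => k _.
rewrite -linearZ; congr (h _); apply/malgP => k'.
by rewrite mcoeffZ !mcoeffU mulrnAr mulr1.
Qed.

Lemma malg_linear_ext (K : choiceType) W (h h' : {linear {malg R[K]} -> W}) :
  (forall k, h << k >> = h' << k >>) -> forall g, h g = h' g.
Proof. by move=> hh g; rewrite !malg_linearE; apply: eq_bigr => k _; rewrite hh. Qed.

Lemma tensor_ind M N (S : set (tensor M N)) : is_sub S -> (forall x y, S (tens x y)) -> forall t, S t.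
Proof.
move=> SS St t; rewrite -[t]quotmod_reprK malg_linearE.
by apply: is_sub_sum => // -[x y] _; apply: is_subZ => //; apply: St.
Qed.

Lemma tensor_ext M N W (g h : {linear tensor M N -> W}) :
  (forall x y, g (tens x y) = h (tens x y)) -> forall t, g t = h t.
Proof.
move=> gh; apply: (@tensor_ind M N [set t | g t = h t]) => //.
by split=> [|a u v /= gu gv]; rewrite /= ?linear0 // !linearP gu gv.
Qed.

Section TensorMap.
Context (N : lmodType R).

Lemma tens0l M (y : N) : tens (0 : M) y = 0.
Proof. by have := (@tens_is_bilinear _ M N).1 y (-1) 0 0; rewrite scaler0 addr0 scaleN1r addNr. Qed.

Lemma tensDl M (x x' : M) (y : N) : tens (x + x') y = tens x y + tens x' y.
Proof. by have := (@tens_is_bilinear _ M N).1 y 1 x x'; rewrite !scale1r. Qed.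

Lemma tensZl M a (x : M) (y : N) : tens (a *: x) y = a *: tens x y.
Proof. by have := (@tens_is_bilinear _ M N).1 y a x 0; rewrite tens0l !addr0. Qed.

Lemma tens0r M (x : M) : tens x (0 : N) = 0.
Proof. by have := (@tens_is_bilinear _ M N).2 x (-1) 0 0; rewrite scaler0 addr0 scaleN1r addNr. Qed.

Lemma tensDr M (x : M) (y y' : N) : tens x (y + y') = tens x y + tens x y'.
Proof. by have := (@tens_is_bilinear _ M N).2 x 1 y y'; rewrite !scale1r. Qed.

Lemma tensZr M a (x : M) (y : N) : tens x (a *: y) = a *: tens x y.
Proof. by have := (@tens_is_bilinear _ M N).2 x a y 0; rewrite tens0r !addr0. Qed.

Lemma tensor_map_comp M M' M'' (h : {linear M -> M''}) (f : {linear M' -> M''})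
    (g : {linear M -> M'}) : (forall x, h x = f (g x)) ->
  forall t, tensor_map N h t = tensor_map N f (tensor_map N g t).
Proof.
move=> hE; apply: (@tensor_ext _ _ _ _ (tensor_map N f \o tensor_map N g)) => x y /=.
by rewrite !tensor_mapE hE.
Qed.

Lemma tensor_mapD M M' (h f g : {linear M -> M'}) : (forall x, h x = f x + g x) ->
  forall t, tensor_map N h t = tensor_map N f t + tensor_map N g t.
Proof.
move=> hE; apply: (@tensor_ext _ _ _ _ (tensor_map N f \+ tensor_map N g)) => x y /=.
by rewrite !tensor_mapE hE tensDl.
Qed.

Lemma tensor_mapZ M M' (h f : {linear M -> M'}) a : (forall x, h x = a *: f x) ->
  forall t, tensor_map N h t = a *: tensor_map N f t.
Proof.
move=> hE; apply: (@tensor_ext _ _ _ _ (@scl R _ a \o tensor_map N f)) => x y /=.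
by rewrite /scl !tensor_mapE hE tensZl.
Qed.

Lemma tensor_map_id M (f : {linear M -> M}) : (forall x, f x = x) ->
  forall t, tensor_map N f t = t.
Proof.
move=> fE; apply: (@tensor_ext _ _ _ _ idfun) => x y /=.
by rewrite tensor_mapE fE.
Qed.

Lemma tensor_map0 M M' (f : {linear M -> M'}) : (forall x, f x = 0) ->
  forall t, tensor_map N f t = 0.
Proof.
move=> fE; apply: (@tensor_ext _ _ _ _ \0) => x y /=.
by rewrite tensor_mapE fE tens0l.
Qed.

End TensorMap.
End Tensor.

(** * Projective resolutions and the independence of Tor from the resolution *)

Section Resolutions.
Context (R : comNzRingType).

Lemma dep_choice (T : nat -> Type) (P : forall n, T n -> Prop) (Q : forall n, T n -> T n.+1 -> Prop) :
  (exists t, P 0%N t) -> (forall n t, P n t -> exists t', P n.+1 t' /\ Q n t t') ->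
  exists s : forall n, T n, (forall n, P n (s n)) /\ forall n, Q n (s n) (s n.+1).
Proof.
move=> ex0 exS; pose start := cid ex0.
pose next n (t : {t : T n | P n t}) := cid (exS n (sval t) (svalP t)).
pose fix s n : {t : T n | P n t} :=
  if n is n'.+1 then exist _ (sval (next n' (s n'))) (svalP (next n' (s n'))).1
  else exist _ (sval start) (svalP start).
exists (fun n => sval (s n)); split=> n; first exact: svalP.
exact: (svalP (next n (s n))).2.
Qed.

(** Stated for maps [h] that reach the image of [g], so that it applies directly to a differential
    and a map into its image. *)
Definition projective (D : lmodType R) : Prop :=
  forall (A B : lmodType R) (h : {linear A -> B}) (g : {linear D -> B}),
    (forall x, exists a, h a = g x) -> exists k : {linear D -> A}, forall x, h (k x) = g x.

Lemma malg_projective (K : choiceType) : projective {malg R[K]}.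
Proof.
move=> A B h g hg; have [c cE] := choice (fun k => hg << k >>).
exists (free_lift c) => x.
by apply: (@malg_linear_ext _ _ _ (h \o free_lift c)) => k /=; rewrite free_liftU.
Qed.

Lemma prod_projective (D E : lmodType R) : projective D -> projective E -> projective (D * E)%type.
Proof.
move=> PD PE A B h g hg.
have inl_lin : linear (fun x : D => (x, 0 : E)).
  by move=> a u v; apply: injective_projections; rewrite /= ?scaler0 ?addr0.
have inr_lin : linear (fun x : E => (0 : D, x)).
  by move=> a u v; apply: injective_projections; rewrite /= ?scaler0 ?addr0.
pose inl' : {linear D -> (D * E)%type} := HB.pack (fun x : D => (x, 0 : E)) (GRing.isLinear.Build _ _ _ _ _ inl_lin).
pose inr' : {linear E -> (D * E)%type} := HB.pack (fun x : E => (0 : D, x)) (GRing.isLinear.Build _ _ _ _ _ inr_lin).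
have [k1 k1E] := PD _ _ h (g \o inl') (fun x => hg _).
have [k2 k2E] := PE _ _ h (g \o inr') (fun x => hg _).
exists ((k1 \o fst) \+ (k2 \o snd)) => -[x y] /=.
rewrite linearD k1E k2E /= -linearD; congr (g _).
by apply: injective_projections; rewrite /= ?addr0 ?add0r.
Qed.

Lemma retract_projective (D E : lmodType R) (i : {linear D -> E}) (p : {linear E -> D}) :
  cancel i p -> projective E -> projective D.
Proof.
move=> ip PE A B h g hg; have [k kE] := PE _ _ h (g \o p) (fun x => hg _).
by exists (k \o i) => x /=; rewrite kE /= ip.
Qed.

Section Comparison.
Context (X : lmodType R).

Definition zcyc (D : nat -> lmodType R) (d : forall n, {linear D n.+1 -> D n})
    (eps : {linear D 0%N -> X}) n : D n -> Prop :=
  match n with 0 => fun x => eps x = 0 | n'.+1 => fun x => d n' x = 0 end.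

Definition is_res (D : nat -> lmodType R) (d : forall n, {linear D n.+1 -> D n})
    (eps : {linear D 0%N -> X}) : Prop :=
  (forall x, exists y, eps y = x) /\
  forall n x, zcyc d eps x <-> exists y, d n y = x.

Context (D D' : nat -> lmodType R).
Context (d : forall n, {linear D n.+1 -> D n}) (eps : {linear D 0%N -> X}).
Context (d' : forall n, {linear D' n.+1 -> D' n}) (eps' : {linear D' 0%N -> X}).
Hypotheses (PD : forall n, projective (D n)).
Hypotheses (rD : is_res d eps) (rD' : is_res d' eps').

Lemma chain_lift : exists a : forall n, {linear D n -> D' n},
  (forall x, eps' (a 0%N x) = eps x) /\ forall n x, d' n (a n.+1 x) = a n (d n x).
Proof.
(* The dependent match keeps the clause about the augmentation at level 0 inside the single
   predicate that [dep_choice] carries through all levels. *)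
have [||a [aP aS]] := @dep_choice (fun n => {linear D n -> D' n})
  (fun n a => (forall x, zcyc d eps x -> zcyc d' eps' (a x)) /\
     match n return {linear D n -> D' n} -> Prop with
      | 0 => fun a => forall x, eps' (a x) = eps x | _ => fun=> True end a)
  (fun n a b => forall x, d' n (b x) = a (d n x)).
- have [a aE] := PD (h := eps') (fun x => rD'.1 (eps x)).
  by exists a; split=> // x /=; rewrite aE.
- move=> n a [az _].
  have [|b bE] := @PD n.+1 _ _ (d' n) (a \o d n).
    by move=> x; apply/rD'.2/az/rD.2; exists x.
  by exists b; split=> //; split=> // x /= dx; rewrite bE /= dx linear0.
by exists a; split=> //; exact: (aP 0%N).2.
Qed.

Lemma chain_homotopy (a b : forall n, {linear D n -> D' n}) :
  (forall x, eps' (a 0%N x) = eps' (b 0%N x)) ->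
  (forall n x, d' n (a n.+1 x) = a n (d n x)) ->
  (forall n x, d' n (b n.+1 x) = b n (d n x)) ->
  exists h : forall n, {linear D n -> D' n.+1},
    (forall x, a 0%N x - b 0%N x = d' 0%N (h 0%N x)) /\
    forall n x, a n.+1 x - b n.+1 x = d' n.+1 (h n.+1 x) + h n (d n x).
Proof.
move=> ab0 ad bd.
have [||h [hP hS]] := @dep_choice (fun n => {linear D n -> D' n.+1})
  (fun n h => (forall x, zcyc d eps x -> a n x - b n x = d' n (h x)) /\
     match n return {linear D n -> D' n.+1} -> Prop with
      | 0 => fun h => forall x, a 0%N x - b 0%N x = d' 0%N (h x) | _ => fun=> True end h)
  (fun n h k => forall x, a n.+1 x - b n.+1 x = d' n.+1 (k x) + h (d n x)).
- have [|h hE] := @PD 0%N _ _ (d' 0%N) (a 0%N \- b 0%N).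
    by move=> x; apply/rD'.2; rewrite /= linearB ab0 subrr.
  by exists h; split=> [x _|x]; rewrite hE.
- move=> n h [hz _].
  have [|k kE] := @PD n.+1 _ _ (d' n.+1) ((a n.+1 \- b n.+1) \- (h \o d n)).
    move=> x; apply/rD'.2; rewrite /= !linearB ad bd hz ?subrr //.
    by apply/rD.2; exists x.
  exists k; split=> [|x]; last by rewrite kE /= subrK.
  by split=> // x /= dx; rewrite kE /= dx linear0 subr0.
by exists h; split=> //; exact: (hP 0%N).2.
Qed.

End Comparison.

Section TensorHomology.
Context (N : lmodType R).

Definition tcyc (D : nat -> lmodType R) (d : forall n, {linear D n.+1 -> D n}) i :
    set (tensor (D i) N) :=
  match i with 0 => setT | i'.+1 => [set t | tensor_map N (d i') t = 0] end.

Lemma tensor_homotopic (D : nat -> lmodType R) (d : forall n, {linear D n.+1 -> D n})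
    (c : forall n, {linear D n -> D n}) (h : forall n, {linear D n -> D n.+1}) i
    (t : tensor (D i) N) :
  (forall x, c 0%N x - x = d 0%N (h 0%N x)) ->
  (forall n x, c n.+1 x - x = d n.+1 (h n.+1 x) + h n (d n x)) ->
  tcyc d t -> exists u, tensor_map N (c i) t - t = tensor_map N (d i) u.
Proof.
move=> h0 hS; case: i t => [|n] t /= ct.
  exists (tensor_map N (h 0%N) t).
  rewrite -(@tensor_map_comp _ N _ _ _ (d 0%N \o h 0%N)) //; apply/eqP; rewrite subr_eq; apply/eqP.
  rewrite -[X in _ + X](@tensor_map_id _ N _ idfun) //.
  by apply: tensor_mapD => x; rewrite /= -h0 subrK.
exists (tensor_map N (h n.+1) t).
rewrite -(@tensor_map_comp _ N _ _ _ (d n.+1 \o h n.+1)) //; apply/eqP; rewrite subr_eq; apply/eqP.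
have cE : tensor_map N (c n.+1) t =
    tensor_map N ((d n.+1 \o h n.+1) \+ idfun) t + tensor_map N (h n \o d n) t.
  by apply: tensor_mapD => x; rewrite /= addrAC -hS subrK.
rewrite cE (@tensor_map_comp _ N _ _ _ (h n \o d n) (h n) (d n)) // ct linear0 addr0.
by rewrite (@tensor_mapD _ N _ _ _ (d n.+1 \o h n.+1) idfun) // (@tensor_map_id _ N _ idfun).
Qed.

(** Lifts of the identity of [X] in both directions are inverse up to homotopy, and tensoring
    preserves this, so the lift [a] induces an isomorphism of homology. *)
Lemma tensor_homology_len (X : lmodType R) (D D' : nat -> lmodType R) (d : forall n, {linear D n.+1 -> D n})
    (eps : {linear D 0%N -> X}) (d' : forall n, {linear D' n.+1 -> D' n})
    (eps' : {linear D' 0%N -> X}) i k :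
  (forall n, projective (D n)) -> (forall n, projective (D' n)) ->
  is_res d eps -> is_res d' eps' ->
  len_is (range (tensor_map N (d i))) (@tcyc D d i) k <->
  len_is (range (tensor_map N (d' i))) (@tcyc D' d' i) k.
Proof.
move=> PD PD' rD rD'.
have [a [a0 aS]] := chain_lift PD rD rD'; have [b [b0 bS]] := chain_lift PD' rD' rD.
have dd n x : d n (d n.+1 x) = 0 by apply: (rD.2 n.+1 _).2; exists x.
have dd' n x : d' n (d' n.+1 x) = 0 by apply: (rD'.2 n.+1 _).2; exists x.
have [||| h [h0 hS]] := chain_homotopy PD rD rD (a := fun n => b n \o a n) (b := fun n => idfun).
- by move=> x /=; rewrite b0 a0.
- by move=> n x /=; rewrite bS aS.
- by [].
have [||| h' [h'0 h'S]] := chain_homotopy PD' rD' rD' (a := fun n => a n \o b n) (b := fun n => idfun).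
- by move=> x /=; rewrite a0 b0.
- by move=> n x /=; rewrite aS bS.
- by [].
have tc0 n t : tensor_map N (d n) (tensor_map N (d n.+1) t) = 0.
  by rewrite -(@tensor_map_comp _ N _ _ _ (d n \o d n.+1)) //; apply: tensor_map0 => x; apply: dd.
have tc0' n t : tensor_map N (d' n) (tensor_map N (d' n.+1) t) = 0.
  by rewrite -(@tensor_map_comp _ N _ _ _ (d' n \o d' n.+1)) //; apply: tensor_map0 => x; apply: dd'.
have ta n t : tensor_map N (d' n) (tensor_map N (a n.+1) t) = tensor_map N (a n) (tensor_map N (d n) t).
  by rewrite -(@tensor_map_comp _ N _ _ _ (d' n \o a n.+1)) //; exact: (@tensor_map_comp _ N _ _ _ (d' n \o a n.+1) (a n) (d n) (aS n)).
have tb n t : tensor_map N (d n) (tensor_map N (b n.+1) t) = tensor_map N (b n) (tensor_map N (d' n) t).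
  by rewrite -(@tensor_map_comp _ N _ _ _ (d n \o b n.+1)) //; exact: (@tensor_map_comp _ N _ _ _ (d n \o b n.+1) (b n) (d' n) (bS n)).
have cyc_d n t : @tcyc D d n (tensor_map N (d n) t) by case: n t => [//|n] t; apply: tc0.
have cyc_d' n t : @tcyc D' d' n (tensor_map N (d' n) t) by case: n t => [//|n] t; apply: tc0'.
have cyc_a t : tcyc d t -> @tcyc D' d' i (tensor_map N (a i) t).
  by case: (i) t => [//|n] t /= t0; rewrite ta t0 linear0.
have cyc_b t : tcyc d' t -> @tcyc D d i (tensor_map N (b i) t).
  by case: (i) t => [//|n] t /= t0; rewrite tb t0 linear0.
have th t : tcyc d t -> exists u, tensor_map N (b i) (tensor_map N (a i) t) - t = tensor_map N (d i) u.
  by move=> /(tensor_homotopic (c := fun n => b n \o a n) h0 hS)[u uE]; exists u; rewrite -uE -(@tensor_map_comp _ N _ _ _ (b i \o a i)).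
have th' t : tcyc d' t -> exists u, tensor_map N (a i) (tensor_map N (b i) t) - t = tensor_map N (d' i) u.
  by move=> /(tensor_homotopic (c := fun n => a n \o b n) h'0 h'S)[u uE]; exists u; rewrite -uE -(@tensor_map_comp _ N _ _ _ (a i \o b i)).
apply: (@len_is_map _ _ _ (tensor_map N (a i))) => [||v|w].
- by case: (i) => [|n] //; apply: (preimage_is_sub (tensor_map N (d n)) (set0_is_sub _)).
- exact: image_is_sub.
- split=> [[u _ <-]|[cv [u _ uE]]].
    by split; [exact: cyc_d | exists (tensor_map N (a i.+1) u); rewrite ?ta].
  have [t tE] := th v cv; exists (tensor_map N (b i.+1) u - t) => //.
  by rewrite linearB /= tb uE -tE opprB addrCA subrr addr0.
- split=> [cw|[v [_ [cv [u _ <-] ->]]]].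
    have [t tE] := th' w cw.
    exists (tensor_map N (b i) w), (- tensor_map N (d' i) t); split; first exact: cyc_b.
      by exists (- t) => //; rewrite linearN.
    by rewrite -tE opprB addrCA subrr addr0.
  have := cyc_a v cv; have := cyc_d' i u; case: (i) v u cv => [//|n] v u _ /= u0 v0.
  by rewrite linearD /= u0 v0 addr0.
Qed.

Lemma resolution_is_res (M : lmodType R) :
  is_res (D := resolution M) (resolution_diff M) (augmentation M).
Proof.
split=> [x|[|n] x]; first exact: augmentation_surj.
- exact: resolution_exact0.
- exact: resolution_exact.
Qed.

Lemma Tor_len (X : lmodType R) (D : nat -> lmodType R) (d : forall n, {linear D n.+1 -> D n})
    (eps : {linear D 0%N -> X}) i k :
  (forall n, projective (D n)) -> is_res d eps ->
  has_length (Tor i X N) k <-> len_is (range (tensor_map N (d i))) (@tcyc D d i) k.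
Proof.
move=> PD rD.
have PX n : projective (resolution X n) by apply: malg_projective.
rewrite (tensor_homology_len i k PD PX rD (resolution_is_res X)).
rewrite (_ : @tcyc (resolution X) (resolution_diff X) i = [set v | tor_diff X N i v = 0]); last by case: (i) => //; apply/seteqP.
apply: homology_len; case: (i) => [//|n] u /=.
rewrite -(@tensor_map_comp _ N _ _ _ (resolution_diff X n \o resolution_diff X n.+1)) //.
by apply: tensor_map0 => x; apply/resolution_exact; exists x.
Qed.

End TensorHomology.
End Resolutions.

(** * Graded free modules and the graded resolution *)

Section GradedFree.
Context (R : comNzRingType) (r : nat).

(* The free module over the polynomial ring [R[T_a, a < r]] with basis indexed by [nat],
   as an [R]-module: [(j, alpha)] stands for the monomial [T^alpha] times the [j]-th generator. *)
Definition mons : choiceType := (nat * {ffun 'I_r -> nat})%type.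
Definition gfree : lmodType R := {malg R[mons]}.

Definition bump_vec (a : 'I_r) (al : {ffun 'I_r -> nat}) : {ffun 'I_r -> nat} :=
  [ffun b => (al b + (b == a))%N].

Definition mon0 : {ffun 'I_r -> nat} := [ffun=> 0%N].

Definition mon_deg (al : {ffun 'I_r -> nat}) : nat := (\sum_b al b)%N.

Lemma mon_deg0 : mon_deg mon0 = 0%N.
Proof. by rewrite /mon_deg big1 // => b _; rewrite ffunE. Qed.

Lemma mon_deg_bump a al : mon_deg (bump_vec a al) = (mon_deg al).+1.
Proof.
rewrite /mon_deg (eq_bigr (fun b => al b + (b == a))%N) => [|b _]; last by rewrite ffunE.
rewrite big_split /= -addn1; congr addn.
by rewrite (bigD1 a) //= eqxx big1 // => b /negPf ->.
Qed.

Lemma bump_vecC a b al : bump_vec a (bump_vec b al) = bump_vec b (bump_vec a al).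
Proof. by apply/ffunP => c; rewrite !ffunE addnAC. Qed.

Lemma mon_ind (Q : {ffun 'I_r -> nat} -> Prop) :
  Q mon0 -> (forall a al, Q al -> Q (bump_vec a al)) -> forall al, Q al.
Proof.
move=> Q0 QS al; have [k] := ubnP (mon_deg al); elim: k al => [//|k IH] al; rewrite ltnS => alk.
have [al0|] := boolP [forall b, al b == 0%N].
  suff -> : al = mon0 by [].
  by apply/ffunP => b; rewrite ffunE; apply/eqP/(forallP al0).
rewrite negb_forall => /existsP[a al_a].
pose be : {ffun 'I_r -> nat} := [ffun b => (al b - (b == a))%N].
have alE : al = bump_vec a be.
  apply/ffunP => b; rewrite !ffunE; case: eqP => [->|_]; last by rewrite subn0 addn0.
  by rewrite subnK // lt0n.
by rewrite alE; apply/QS/IH; rewrite -(mon_deg_bump a) -alE.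
Qed.

Definition opT (a : 'I_r) : {linear gfree -> gfree} :=
  free_lift (fun k : mons => << (k.1, bump_vec a k.2) >> : gfree).

Arguments opT : simpl never.

Lemma opTE a j al : opT a << (j, al) >> = << (j, bump_vec a al) >>.
Proof. exact: free_liftU. Qed.

Lemma gfree_ext (W : lmodType R) (g h : {linear gfree -> W}) :
  (forall j al, g << (j, al) >> = h << (j, al) >>) -> forall x, g x = h x.
Proof. by move=> gh; apply: malg_linear_ext => -[j al]. Qed.

Lemma opTC a b x : opT a (opT b x) = opT b (opT a x).
Proof.
apply: (@gfree_ext _ (opT a \o opT b) (opT b \o opT a)) => j al /=.
by rewrite !opTE bump_vecC.
Qed.

Definition Tlist : seq {linear gfree -> gfree} := [seq opT a | a <- enum 'I_r].

Section Extension.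
Context (W : lmodType R) (t : 'I_r -> {linear W -> W}).
Hypothesis tC : forall a b w, t a (t b w) = t b (t a w).

(** A monomial acts one variable at a time in the order of [s]; commutation of the [t a] makes the
    order immaterial. *)
Definition mon_act (s : seq 'I_r) (al : {ffun 'I_r -> nat}) (w : W) : W :=
  foldr (fun b => iter (al b) (t b)) w s.

Lemma mon_act_bump s al a w : uniq s ->
  mon_act s (bump_vec a al) w = if a \in s then t a (mon_act s al w) else mon_act s al w.
Proof.
elim: s => //= b s IH /andP[bs us]; rewrite ffunE IH // inE [a == b]eq_sym.
case: eqP => [<-|_] /=.
  by rewrite (negPf bs) addn1.
rewrite addn0; case: ifP => // _.
by elim: (al b) => //= k ->; rewrite tC.
Qed.

Definition gfree_lift (v : nat -> W) : {linear gfree -> W} :=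
  free_lift (fun k : mons => mon_act (enum 'I_r) k.2 (v k.1)).

Arguments gfree_lift : simpl never.

Lemma gfree_lift_gen v j : gfree_lift v << (j, mon0) >> = v j.
Proof.
rewrite /gfree_lift /= free_liftU /=; elim: (enum _) => //= b s ->.
by rewrite ffunE.
Qed.

Lemma gfree_lift_T v a x : gfree_lift v (opT a x) = t a (gfree_lift v x).
Proof.
apply: (@gfree_ext _ (gfree_lift v \o opT a) (t a \o gfree_lift v)) => j al /=.
rewrite opTE /= !free_liftU /= mon_act_bump ?enum_uniq //.
by rewrite mem_enum.
Qed.

End Extension.

(** [s] lists the degrees of the generators. Basis elements of index at least [size s] lie in no
    piece, so graded free modules of every finite rank share the carrier [gfree]. *)
Definition in_piece (s : seq nat) (n : nat) (k : mons) : bool :=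
  (k.1 < size s)%N && (nth 0%N s k.1 + mon_deg k.2 == n)%N.

Definition gproj s (n : nat) : {linear gfree -> gfree} :=
  free_lift (fun k : mons => if in_piece s n k then << k >> else 0 : gfree).

Arguments gproj : simpl never.

Lemma gprojE s n k : gproj s n << k >> = if in_piece s n k then << k >> else 0.
Proof. exact: free_liftU. Qed.

Lemma gproj_idem s n x : gproj s n (gproj s n x) = gproj s n x.
Proof.
apply: (@gfree_ext _ (gproj s n \o gproj s n) (gproj s n)) => j al /=.
by rewrite !gprojE; case: ifP => [k|_]; rewrite ?gprojE ?k ?linear0.
Qed.

Lemma in_piece_bump s n j a al : in_piece s n.+1 (j, bump_vec a al) = in_piece s n (j, al).
Proof. by rewrite /in_piece mon_deg_bump addnS eqSS. Qed.

Lemma gproj_T s n a x : gproj s n.+1 (opT a x) = opT a (gproj s n x).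
Proof.
apply: (@gfree_ext _ (gproj s n.+1 \o opT a) (opT a \o gproj s n)) => j al /=.
rewrite opTE !gprojE in_piece_bump.
by case: ifP => _; rewrite ?opTE ?linear0.
Qed.

Lemma gproj_nil n x : gproj [::] n x = 0.
Proof. by apply: (@gfree_ext _ (gproj [::] n) \0) => j al; rewrite (gprojE [::]). Qed.

(** A fixed-point set of an idempotent keeps this form after tensoring, so pieces tensored with [N]
    remain submodules of one module. *)
Definition gpiece s (n : nat) : set gfree := [set x | gproj s n x = x].

Lemma piece_is_sub s n : is_sub (gpiece s n).
Proof.
by split=> [|c u v pu pv]; rewrite /gpiece /= ?linear0 // linearP pu pv.
Qed.

Lemma piece_proj s n x : gpiece s n (gproj s n x). Proof. exact: gproj_idem. Qed.

Lemma in_TlistP t : List.In t Tlist <-> exists a, t = opT a.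
Proof.
rewrite /Tlist List.in_map_iff; split=> [[a [<- _]]|[a ->]]; first by exists a.
exists a; split=> //.
by apply/In_mem; rewrite mem_enum.
Qed.

Lemma piece_graded s : graded Tlist (gpiece s).
Proof.
split=> [n|t /in_TlistP[a ->] n v pv]; first exact: piece_is_sub.
by rewrite /gpiece /= gproj_T pv.
Qed.

Lemma Tlist_comm : comm_list Tlist.
Proof. by move=> t u /in_TlistP[a ->] /in_TlistP[b ->] v; apply: opTC. Qed.

Lemma piece_gen s j : (j < size s)%N -> gpiece s (nth 0%N s j) << (j, mon0) >>.
Proof. by move=> js; rewrite /gpiece /= gprojE /in_piece /= js mon_deg0 addn0 eqxx. Qed.

(** A piece is spanned by monomials times generators, and both [opT a] on the source and [t a] on
    [X] raise the degree by one. *)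
Lemma piece_min s (W : lmodType R) (g : {linear gfree -> W}) (t : 'I_r -> {linear W -> W})
    (X : nat -> set W) :
  (forall a x, g (opT a x) = t a (g x)) ->
  (forall n, is_sub (X n)) -> (forall a n w, X n w -> X n.+1 (t a w)) ->
  (forall j, (j < size s)%N -> X (nth 0%N s j) (g << (j, mon0) >>)) ->
  forall n x, gpiece s n x -> X n (g x).
Proof.
move=> gT SX TX gX n x <-; move: x.
have gal j al : (j < size s)%N -> X (nth 0%N s j + mon_deg al)%N (g << (j, al) >>).
  move=> js; elim/mon_ind: al => [|a al IH]; first by rewrite mon_deg0 addn0; apply: gX.
  by rewrite mon_deg_bump addnS -opTE gT; apply: TX.
have E x : (g \o gproj s n) x = \sum_(k <- msupp x) x@_k *: (g \o gproj s n) << k >>.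
  exact: malg_linearE.
move=> x; rewrite -[g _]/((g \o gproj s n) x) E; apply: is_sub_sum => // -[j al] _.
apply: is_subZ => //=; rewrite gprojE; case: ifP => [/andP[js /eqP <-]|_]; first exact: gal.
by rewrite linear0; apply: is_sub0.
Qed.

Lemma piece_fg s : graded_fg Tlist (gpiece s).
Proof.
pose L : seq (nat * gfree) := [seq (nth 0%N s j, << (j, mon0) >> : gfree) | j <- iota 0 (size s)].
have inL j : (j < size s)%N -> List.In (nth 0%N s j, << (j, mon0) >> : gfree) L.
  move=> js; apply/List.in_map_iff; exists j; split=> //; apply/List.in_seq.
  by split; [exact/leP | apply/ltP].
exists L => [p /List.in_map_iff[j [<- /List.in_seq[_ /ltP js]]]|X [SX TX] LX n x px].
  exact: piece_gen.
apply: (@piece_min s _ idfun opT X) px => // [a k w|j js].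
  by apply: TX; apply/in_TlistP; exists a.
exact: LX (inL j js).
Qed.

End GradedFree.

(** * Existence of the graded resolution, its comparison maps and its homotopies *)

Section GradedResolution.
Context (R : comNzRingType) (hR : noetherian R) (r : nat) (f : 'I_r -> R).
Notation F := (gfree R r).
Notation T := (@opT R r).
Notation piece := (@gpiece R r).
Notation gproj := (@gproj R r).

Lemma piece_disjoint s n m x : n != m -> piece s n x -> gproj s m x = 0.
Proof.
move=> nm <-; apply: (@gfree_ext _ _ _ (gproj s m \o gproj s n) \0) => j al.
rewrite -[LHS]/(gproj s m (gproj s n << (j, al) >>)) gprojE.
case: ifP => [/andP[js /eqP jn]|_]; last by rewrite linear0.
by rewrite gprojE /in_piece js jn (negPf nm).
Qed.

(** Basis generators go to the generators of [Z]. The last clause, vanishing beyond the rank, is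
    what makes [D] commute with the projections onto pieces in [gfree_cover_proj]. *)
Lemma gfree_cover (W : lmodType R) (t : 'I_r -> {linear W -> W}) (Z : nat -> set W)
    (g : seq (nat * W)) :
  (forall a b w, t a (t b w) = t b (t a w)) ->
  (forall n, is_sub (Z n)) -> (forall a n w, Z n w -> Z n.+1 (t a w)) ->
  (forall p, List.In p g -> Z p.1 p.2) ->
  (forall X : nat -> set W, (forall n, is_sub (X n)) -> (forall a n w, X n w -> X n.+1 (t a w)) ->
     (forall p, List.In p g -> X p.1 p.2) -> forall n, Z n `<=` X n) ->
  exists (s : seq nat) (D : {linear F -> W}),
    [/\ forall a x, D (T a x) = t a (D x),
        forall n x, piece s n x -> Z n (D x),
        forall n w, Z n w -> exists2 x, piece s n x & D x = w
      & forall j al, (size s <= j)%N -> D << (j, al) >> = 0].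
Proof.
move=> tC SZ TZ gZ Zmin.
pose s := [seq p.1 | p <- g]; pose v j := nth 0 [seq p.2 | p <- g] j.
pose D := gfree_lift t v; have DT a x : D (T a x) = t a (D x) by apply: gfree_lift_T.
have gin j : (j < size s)%N -> List.In (nth 0%N s j, v j) g.
  rewrite /s /v size_map; elim: (g) j => [//|[m w] g' IH] [|j] /=; first by left.
  by rewrite ltnS => /IH; right.
have DZ n x : piece s n x -> Z n (D x).
  apply: piece_min DT SZ TZ _ _ _ => j js.
  by rewrite gfree_lift_gen; apply: (gZ _ (gin j js)).
exists s, D; split=> // [n w Zw|j al sj].
  have [||p pg|x px <-] := Zmin (fun n => D @` piece s n) _ _ _ n w Zw; last by exists x.
  - by move=> m; apply: image_is_sub; apply: piece_is_sub.
  - move=> a m _ [x px <-]; exists (T a x); last exact: DT.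
    by rewrite /gpiece /= gproj_T px.
  have [j js pE] : exists2 j, (j < size s)%N & p = (nth 0%N s j, v j).
    rewrite /s /v size_map; elim: (g) pg => [//|[m y] g' IH] /= [<-|/IH[j js ->]].
      by exists 0%N.
    by exists j.+1.
  exists << (j, mon0 r) >>; first by rewrite pE; apply: piece_gen.
  by rewrite gfree_lift_gen pE.
elim/mon_ind: al => [|a al IH]; first by rewrite gfree_lift_gen /v nth_default // size_map -(size_map fst).
by rewrite -opTE DT IH linear0.
Qed.

Lemma gfree_cover_proj s s' (D : {linear F -> F}) :
  (forall n x, piece s' n x -> piece s n (D x)) ->
  (forall j al, (size s' <= j)%N -> D << (j, al) >> = 0) ->
  forall n x, D (gproj s' n x) = gproj s n (D x).
Proof.
move=> Dp D0 n; apply: (@gfree_ext _ _ _ (D \o gproj s' n) (gproj s n \o D)) => j al.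
rewrite -[LHS]/(D (gproj s' n _)) -[RHS]/(gproj s n (D _)) gprojE.
case: (ltnP j (size s')) => js; last by rewrite /in_piece ltnNge js /= linear0 D0 // linear0.
have pj : piece s' (nth 0%N s' j + mon_deg al)%N << (j, al) >>.
  by rewrite /gpiece /= gprojE /in_piece js eqxx.
rewrite /in_piece js /=; case: eqP => [<-|/eqP jn]; first by rewrite (Dp _ _ pj).
by rewrite linear0 (piece_disjoint jn) //; apply: Dp.
Qed.

(** Hilbert's basis theorem for a graded free module of finite rank; it makes the syzygies finitely
    generated. *)
Lemma graded_sub_fg s (Z : nat -> set F) : graded (@Tlist R r) Z -> (forall n, Z n `<=` piece s n) ->
  graded_fg (@Tlist R r) Z.
Proof.
move=> GZ Zs.
have N := noeth_const hR (@Tlist_comm R r) (@piece_graded R r s) (@piece_fg R r s).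
have [|g [gZ Zg]] := noeth_fingen N (graded_const GZ); first by move=> e; apply: Zs.
exists [seq (p.1.1, p.2) | p <- g] => [p /List.in_map_iff[q [<- /gZ]]//|X GX gX n x Zx].
apply: (Zg (n, 0%N) x Zx) (graded_const GX) _ => q qg.
apply: (gX (q.1.1, q.2)); apply/List.in_map_iff; by exists q.
Qed.

Implicit Types n : nat.
(** [phi] extends a choice on generators by letting [T a] act on the target as the scalar [f a], so
    all degrees are sent into the one submodule [S]. *)
Lemma semilinear_lift (W : lmodType R) s (S : set F) (g h : {linear F -> W}) :
  is_sub S -> (forall a x, g (T a x) = f a *: g x) ->
  (forall n x, piece s n x -> exists2 y, S y & h y = g x) ->
  exists phi : {linear F -> F}, [/\ forall a x, phi (T a x) = f a *: phi x,
    forall x, S (phi x) & forall n x, piece s n x -> h (phi x) = g x].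
Proof.
move=> SS gT gh.
have /choice[v vP] (j : nat) : exists y : F, S y /\ ((j < size s)%N -> h y = g << (j, mon0 r) >>).
  case: (ltnP j (size s)) => js; last by exists 0; split=> //; apply: is_sub0.
  by have [y Sy yE] := gh _ _ (piece_gen R r js); exists y.
have sC a b (w : F) : scl (f a) (scl (f b) w) = scl (f b) (scl (f a) w).
  by rewrite /scl !scalerA mulrC.
pose phi := gfree_lift (fun a => scl (f a) : {linear F -> F}) v.
have phiT a x : phi (T a x) = f a *: phi x.
  exact: (@gfree_lift_T _ _ _ (fun a => scl (f a) : {linear F -> F}) sC).
exists phi; split=> // [x|n x px].
  rewrite (@malg_linearE _ _ _ phi); apply: is_sub_sum => // -[j al] _; apply: (is_subZ SS).
  elim/mon_ind: al => [|a al IH]; first by rewrite gfree_lift_gen; have [] := vP j.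
  by rewrite -opTE phiT; apply: (is_subZ SS).
suff : [set (0 : W)] (((h \o phi) \- g) x) by move=> /= /eqP; rewrite subr_eq0 => /eqP.
apply: (@piece_min _ _ s _ _ (fun a => scl (f a) : {linear W -> W}) (fun=> [set 0])) px => /=.
- by move=> a y; rewrite phiT gT linearZ /= /scl scalerBr.
- by move=> m; apply: set0_is_sub.
- by move=> a m w ->; apply: linear0.
- by move=> j js; rewrite gfree_lift_gen; have [_ ->] := vP j; rewrite ?subrr.
Qed.

Context (M : lmodType R) (hM : fin_gen M).

(* [res_deg l] are the degrees of the generators at level [l]; level [0] is zero and
   level [l.+1] is the [l]-th free module of a graded resolution of the family [I^n M]. *)
Record graded_res : Type := GradedRes {
  res_deg : nat -> seq nat;
  res_d : nat -> {linear F -> F};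
  res_eps : {linear F -> M};
  res_phi : nat -> {linear F -> F} }.

(** Says that [x], taken at level [l.+1], is a cycle of the augmented resolution. *)
Definition res_out (s : graded_res) l : F -> Prop :=
  match l with 0 => fun x => res_eps s x = 0 | l'.+1 => fun x => res_d s l'.+1 x = 0 end.

Record graded_res_spec (s : graded_res) : Prop := {
  res_deg0 : res_deg s 0 = [::];
  res_d0 : forall x, res_d s 0 x = 0;
  res_dT : forall l a x, res_d s l (T a x) = T a (res_d s l x);
  res_d_proj : forall l n x, res_d s l (gproj (res_deg s l.+1) n x) = gproj (res_deg s l) n (res_d s l x);
  res_out_d : forall l n x, piece (res_deg s l.+2) n x -> res_out s l (res_d s l.+1 x);
  res_exact : forall l n x, piece (res_deg s l.+1) n x -> res_out s l x ->
    exists2 y, piece (res_deg s l.+2) n y & res_d s l.+1 y = x;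
  res_eps_piece : forall n x, piece (res_deg s 1) n x -> ipow f n [set: M] (res_eps s x);
  res_eps_surj : forall n w, ipow f n [set: M] w -> exists2 x, piece (res_deg s 1) n x & res_eps s x = w;
  res_phi0 : forall x, res_phi s 0 x = 0;
  res_phiT : forall l a x, res_phi s l (T a x) = f a *: res_phi s l x;
  res_phi_piece : forall l x, piece (res_deg s l) 0 (res_phi s l x);
  res_phi_d : forall l n x, piece (res_deg s l.+1) n x ->
    res_d s l (res_phi s l.+1 x) = res_phi s l (res_d s l x);
  res_eps_phi : forall n x, piece (res_deg s 1) n x -> res_eps s (res_phi s 1 x) = res_eps s x }.

(** With [T a] acting as [f a], the family I^n M is generated in degree 0 by generators of [M]. *)
Lemma eps_exists : exists (s : seq nat) (e : {linear F -> M}),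
  [/\ forall a x, e (T a x) = f a *: e x,
      forall n x, piece s n x -> ipow f n [set: M] (e x)
    & forall n w, ipow f n [set: M] w -> exists2 x, piece s n x & e x = w].
Proof.
have [g gM] := hM.
have [|||p|X SX TX gX n|s [e [eT e1 e2 _]]] := @gfree_cover M (fun a => @scl R M (f a))
  (fun n => ipow f n [set: M]) [seq (0%N, x) | x <- g].
- by move=> a b w; rewrite /= /scl !scalerA mulrC.
- by move=> n; apply: ipow_is_sub.
- by move=> a n w Iw; apply: imul_gen Iw; apply: ipow_is_sub.
- by move=> /List.in_map_iff[x [<- _]].
- elim: n => [|n IH]; last by apply: imul_min => // a x /IH; apply: TX.
  move=> w _; have : w \in Defs.span (fun v => is_true (v \in g)) by rewrite -gM.
  move=> /asboolP/(_ (fun v => `[< X 0%N v >])) H; apply/asboolP; apply: H.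
    apply/is_sub_mem; have [X0 XP] := SX 0%N; split=> [|a u v]; first exact/asboolP.
    by move=> /asboolP Xu /asboolP Xv; apply/asboolP/XP.
  move=> a ag; apply/asboolP; apply: (gX (0%N, a)); apply/List.in_map_iff; exists a; split=> //.
  exact/In_mem.
by exists s, e.
Qed.

(** Each kernel is a graded subfamily of a free one, hence finitely generated and covered by the
    next free module. The comparison maps are then lifted level by level, with values in degree
    0. *)
Lemma graded_res_exists : exists s, graded_res_spec s.
Proof.
have [s1 [e [eT e1 e2]]] := eps_exists.
(* A state holds the generator degrees, the kernel family still to be covered, and the
   differential. *)
pose St := (seq nat * (nat -> set F) * {linear F -> F})%type.
pose ok (st : St) := graded (@Tlist R r) st.1.2 /\ forall n, st.1.2 n `<=` piece st.1.1 n.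
pose rel (st st' : St) :=
  [/\ forall a x, st'.2 (T a x) = T a (st'.2 x),
      forall n x, st'.2 (gproj st'.1.1 n x) = gproj st.1.1 n (st'.2 x),
      forall n x, piece st'.1.1 n x -> st.1.2 n (st'.2 x),
      forall n w, st.1.2 n w -> exists2 x, piece st'.1.1 n x & st'.2 x = w
    & st'.1.2 = fun n => [set x | piece st'.1.1 n x /\ st'.2 x = 0]].
pose st1 : St := (s1, fun n => [set x | piece s1 n x /\ e x = 0], (\0 : {linear F -> F})).
have step (_ : nat) (st : St) : ok st -> exists st', ok st' /\ rel st st'.
  move=> [GZ Zs]; have [g gZ Zmin] := graded_sub_fg GZ Zs.
  have [|||||s' [D [DT D1 D2 D3]]] := @gfree_cover F (@opT R r) st.1.2 g.
  - exact: opTC.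
  - exact: GZ.1.
  - by move=> a n w; apply: GZ.2; apply/in_TlistP; exists a.
  - exact: gZ.
  - move=> X SX TX; apply: Zmin; split=> // t /in_TlistP[a ->] n v; exact: TX.
  exists (s', fun n => [set x | piece s' n x /\ D x = 0], D); split; split=> //=.
  - split=> [n|t /in_TlistP[a ->] n v [pv Dv]].
      exact: (setI_is_sub (@piece_is_sub R r s' n) (preimage_is_sub D (set0_is_sub _))).
    split; last by rewrite DT Dv linear0.
    by apply: (@piece_graded R r s').2 pv; apply/in_TlistP; exists a.
  - by move=> n x [].
  - by apply: gfree_cover_proj D3 => n x /D1/Zs.
have [||st [stok strel]] := @dep_choice (fun=> St)
  (fun l st => ok st /\ (l = 0%N -> st = st1))
  (fun _ => rel).
- exists st1; split=> //; split; last by move=> n x [].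
  split=> [n|t /in_TlistP[a ->] n v [pv ev]].
    exact: (setI_is_sub (@piece_is_sub R r s1 n) (preimage_is_sub e (set0_is_sub _))).
  split; last by rewrite eT ev scaler0.
  by apply: (@piece_graded R r s1).2 pv; apply/in_TlistP; exists a.
- move=> n t [/(step n)[t' [okt' rt]] _]; by exists t'.
have st0 : st 0%N = st1 by apply: (stok 0%N).2.
pose dg l := if l is l'.+1 then (st l').1.1 else [::].
pose d l : {linear F -> F} := if l is 0 then \0 else (st l).2.
pose out l : F -> Prop := match l with 0 => fun x => e x = 0 | l'.+1 => fun x => d l'.+1 x = 0 end.
have ZE l : (st l).1.2 = fun n => [set x | piece (dg l.+1) n x /\ out l x].
  by case: l => [|l]; [rewrite /dg /out st0 | have [_ _ _ _ ->] := strel l].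
have dT l a x : d l (T a x) = T a (d l x).
  by case: l => [|l]; [rewrite /= linear0 | have [H _ _ _ _] := strel l; apply: H].
have d_proj l n x : d l (gproj (dg l.+1) n x) = gproj (dg l) n (d l x).
  by case: l => [|l]; [rewrite /= gproj_nil | have [_ H _ _ _] := strel l; apply: H].
have out_d l n x : piece (dg l.+2) n x -> out l (d l.+1 x) /\ piece (dg l.+1) n (d l.+1 x).
  by have [_ _ H _ _] := strel l; move=> /H; rewrite ZE => -[].
have exact l n x : piece (dg l.+1) n x -> out l x -> exists2 y, piece (dg l.+2) n y & d l.+1 y = x.
  by have [_ _ _ H _] := strel l; move=> px ox; apply: H; rewrite ZE.
have s1E : dg 1 = s1 by rewrite /dg /= st0.
have [||phi [phiP phiS]] := @dep_choice (fun=> {linear F -> F})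
  (fun l phi => [/\ forall a x, phi (T a x) = f a *: phi x,
     forall x, piece (dg l.+1) 0 (phi x),
     forall n x, piece (dg l.+1) n x -> out l x -> out l (phi x)
   & l = 0%N -> forall n x, piece s1 n x -> e (phi x) = e x])
  (fun l phi phi' => forall n x, piece (dg l.+2) n x -> d l.+1 (phi' x) = phi (d l.+1 x)).
(* The augmentation of any element lies in [M], and all of [M] is reached from the degree 0
   piece. *)
- have [n x px|phi [phiT phiS phiE]] := @semilinear_lift M s1 (piece s1 0) e e (@piece_is_sub _ _ _ _) eT.
    exact: e2.
  exists phi; split=> //; rewrite s1E // => n x px ex.
  by rewrite /out (phiE n).
- move=> l phi [phiT phiS phi_out _].
  have [a x|n x px|phi' [phiT' phiS' phiE']] := @semilinear_lift F (dg l.+2) (piece (dg l.+2) 0)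
      (phi \o d l.+1) (d l.+1) (@piece_is_sub _ _ _ _).
  + by rewrite -[LHS]/(phi (d l.+1 (T a x))) dT phiT.
  + have [ox px'] := out_d l n x px.
    exact: (exact l 0%N _ (phiS _) (phi_out n _ px' ox)).
  exists phi'; split; last exact: phiE'.
  by split=> // n x px /= dx; rewrite (phiE' n x px) /= dx linear0.
exists (GradedRes dg d e (fun l => if l is l'.+1 then phi l' else \0)); split=> //=.
- by move=> l n x; rewrite /res_out; case: l => [|l] /out_d [].
- by move=> n x; have := e1 n x; rewrite -s1E.
- by move=> n w; have := e2 n w; rewrite -s1E.
- by move=> [|l] a x /=; [rewrite scaler0 | have [H _ _ _] := phiP l; apply: H].
- by move=> [|l] x; [apply: is_sub0; apply: piece_is_sub | have [_ H _ _] := phiP l; apply: H].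
- by move=> [|l] n x px; [rewrite /= | apply: phiS px].
- by move=> n x; have [_ _ _ H] := phiP 0%N; have := H erefl n x; rewrite -s1E.
Qed.

(** The degree [n] strand resolves I^n M, which [a] kills, so multiplication by [a] lifts zero and
    is null-homotopic. Pieces are not types, so lifting is done on all of [F] with the projections
    [e l] inserted. *)
Lemma annihilator_homotopy s (a : R) n : graded_res_spec s -> (forall w : M, a *: w = 0) ->
  exists h : nat -> {linear F -> F}, [/\ forall x, h 0%N x = 0,
    forall l x, piece (res_deg s l.+1) n (h l x)
  & forall l x, piece (res_deg s l.+1) n x ->
      a *: x = res_d s l.+1 (h l.+1 x) + h l (res_d s l x)].
Proof.
move=> sp a0.
have Fproj := @malg_projective R (mons r).
pose e l := gproj (res_deg s l) n.
have [||h [hP hS]] := @dep_choice (fun=> {linear F -> F})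
  (fun l h => [/\ forall x, piece (res_deg s l.+2) n (h x),
     forall x, piece (res_deg s l.+1) n x -> res_out s l x -> a *: x = res_d s l.+1 (h x)
   & l = 0%N -> forall x, piece (res_deg s l.+1) n x -> a *: x = res_d s l.+1 (h x)])
  (fun l h h' => forall x, piece (res_deg s l.+2) n x ->
     a *: x = res_d s l.+2 (h' x) + h (res_d s l.+1 x)).
- have [x|k kE] := Fproj _ _ (res_d s 1 \o e 2) (scl a \o e 1%N).
    have [||y py yE] := @res_exact _ sp 0%N n (a *: e 1%N x).
    + by apply: is_subZ; [exact: piece_is_sub | exact: piece_proj].
    + by rewrite /= linearZ /= a0.
    by exists y; rewrite /= /e py.
  have kE' x : piece (res_deg s 1) n x -> a *: x = res_d s 1 ((e 2 \o k) x).
    by move=> px; have := kE x; rewrite /= /scl /e px => ->.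
  by exists (e 2 \o k); split=> // [x|x px _]; [exact: piece_proj | exact: kE'].
- move=> l h [ph hout _].
  have [x|k kE] := Fproj _ _ (res_d s l.+2 \o e l.+3) ((scl a \o e l.+2) \- (h \o res_d s l.+1 \o e l.+2)).
    have px := piece_proj (res_deg s l.+2) n x.
    have [||y py yE] := @res_exact _ sp l.+1 n (a *: e l.+2 x - h (res_d s l.+1 (e l.+2 x))).
    + by apply: is_subB; [exact: piece_is_sub | apply: is_subZ; [exact: piece_is_sub|] | exact: ph].
    + rewrite /= linearB linearZ /= -hout ?subrr //; last exact: (@res_out_d _ sp l n).
      by rewrite /gpiece /= -(res_d_proj sp) px.
    by exists y; rewrite /= /e py.
  have kE' x : piece (res_deg s l.+2) n x ->
      a *: x = res_d s l.+2 ((e l.+3 \o k) x) + h (res_d s l.+1 x).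
    by move=> px; have := kE x; rewrite /= /scl /e px => ->; rewrite subrK.
  exists (e l.+3 \o k); split=> //; split=> // [x|x px /= dx]; first exact: piece_proj.
  by rewrite kE' // dx linear0 addr0.
exists (fun l => if l is l'.+1 then h l' else (\0 : {linear F -> F})); split=> // [[|l] x|[|l] x px].
- by apply: is_sub0; apply: piece_is_sub.
- by have [H _ _] := hP l; apply: H.
- by rewrite /= addr0; have [_ _ H] := hP 0%N; apply: H.
- exact: hS.
Qed.

End GradedResolution.

(** * The mapping cone resolving a quotient by a power of the ideal *)

Section IdempotentImage.
Context (R : comNzRingType) (E : lmodType R) (e : {linear E -> E}).
Hypothesis ee : forall x, e (e x) = e x.

(** The image of an idempotent as a genuine module, since the comparison of resolutions quantifies
    over modules and not over subsets. *)
Definition fixmod : lmodType R := submodule (lker_pred (e \- idfun)).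

Lemma fixmodP (x : fixmod) : e (val x) = val x.
Proof. by have := valP x; rewrite unfold_in /= subr_eq0 => /eqP. Qed.

Lemma fixmod_retract : exists p : {linear E -> fixmod}, forall x, val (p x) = e x.
Proof.
have ek x : e x \in lker_pred (e \- idfun) by rewrite unfold_in /= ee subrr.
have lin : linear (fun x => Submodule (ek x) : fixmod).
  by move=> a u v; apply: val_inj; rewrite /= !linearP.
pose p : {linear E -> fixmod} :=
  HB.pack (fun x => Submodule (ek x) : fixmod) (GRing.isLinear.Build _ _ _ _ _ lin).
by exists p.
Qed.

End IdempotentImage.

Section Cone.
Context (R : comNzRingType) (r : nat) (f : 'I_r -> R) (M : lmodType R).
Context (s : graded_res r M) (sp : graded_res_spec f s) (n : nat).
Context (X : lmodType R) (pi : {linear M -> X}).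
Hypothesis pi_surj : forall x, exists m, pi m = x.
Hypothesis pi_ker : forall m, pi m = 0 <-> ipow f n [set: M] m.
Notation F := (gfree R r).
Notation FF := (F * F)%type.
Notation dg := (res_deg s).
Notation d := (res_d s).
Notation phi := (res_phi s).
Notation piece := (@gpiece R r).

Definition cone_proj_fun i (y : FF) : FF := (gproj R r (dg i.+1) 0 y.1, gproj R r (dg i) n y.2).

Fact cone_proj_linear i : linear (cone_proj_fun i).
Proof. by move=> a u v; apply: injective_projections; rewrite /= linearP. Qed.

HB.instance Definition _ i := GRing.isLinear.Build R FF FF *:%R (cone_proj_fun i) (cone_proj_linear i).

Definition cone_proj i : {linear FF -> FF} := cone_proj_fun i.

(** The sign makes consecutive differentials compose to zero, as [phi] commutes with [d]. *)
Definition cone_diff_fun i (y : FF) : FF := (d i y.1 + phi i y.2, - d i.-1 y.2).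

Fact cone_diff_linear i : linear (cone_diff_fun i).
Proof.
move=> a u v; apply: injective_projections; rewrite /= !linearP.
  by rewrite scalerDr addrACA.
by rewrite ?opprD ?scalerN.
Qed.

HB.instance Definition _ i := GRing.isLinear.Build R FF FF *:%R (cone_diff_fun i) (cone_diff_linear i).

Lemma cone_projK i y : cone_proj i (cone_proj i y) = cone_proj i y.
Proof. by apply: injective_projections; rewrite /= gproj_idem. Qed.

(* Degree [0] of level [i.+1] plus degree [n] of level [i]: the cone of [phi] between the strands
   resolving [M] and [I^n M]. *)
Definition cone i : lmodType R := fixmod (cone_proj i).

Lemma conePl i (y : cone i) : piece (dg i.+1) 0 (val y).1.
Proof. by have := fixmodP y => /(congr1 fst). Qed.

Lemma conePr i (y : cone i) : piece (dg i) n (val y).2.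
Proof. by have := fixmodP y => /(congr1 snd). Qed.

Lemma cone_retract_sig i : {p : {linear FF -> cone i} | forall y, val (p y) = cone_proj i y}.
Proof. exact: cid (fixmod_retract (@cone_projK i)). Qed.

Definition cone_retract i : {linear FF -> cone i} := sval (cone_retract_sig i).

Lemma cone_retractE i y : val (cone_retract i y) = cone_proj i y.
Proof. exact: svalP (cone_retract_sig i) y. Qed.

Definition cone_d i : {linear cone i.+1 -> cone i} :=
  cone_retract i \o (cone_diff_fun i.+1 : {linear FF -> FF}) \o val.

Lemma res_d_piece l k x : piece (dg l.+1) k x -> piece (dg l) k (d l x).
Proof. by move=> px; rewrite /gpiece /= -(res_d_proj sp) px. Qed.

Lemma cone_dE0 i (y : cone i.+1) : cone_d i y = cone_retract i (cone_diff_fun i.+1 (val y)).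
Proof. by []. Qed.

Lemma cone_dE i (y : cone i.+1) :
  val (cone_d i y) = (d i.+1 (val y).1 + phi i.+1 (val y).2, - d i (val y).2).
Proof.
rewrite cone_dE0; apply: etrans (cone_retractE _ _) _; apply: injective_projections.
  rewrite -[LHS]/(gproj R r (dg i.+1) 0 (d i.+1 (val y).1 + phi i.+1 (val y).2)).
  rewrite linearD (res_d_piece (conePl y)); congr (_ + _); exact: (res_phi_piece sp).
rewrite -[LHS]/(gproj R r (dg i) n (- d i (val y).2)).
by rewrite linearN (res_d_piece (conePr y)).
Qed.

Definition cone_eps : {linear cone 0 -> X} := pi \o res_eps s \o fst \o val.

Lemma coneP i p x : piece (dg i.+1) 0 p -> piece (dg i) n x -> exists y : cone i, val y = (p, x).
Proof.
move=> pp px; exists (cone_retract i (p, x)); rewrite cone_retractE.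
by apply: injective_projections => /=.
Qed.

Lemma cone_projective i : projective (cone i).
Proof.
apply: (@retract_projective _ _ FF val (cone_retract i)) => [y|].
  by apply: val_inj; rewrite cone_retractE fixmodP.
by apply: prod_projective; apply: malg_projective.
Qed.

Lemma dd0 l k x : piece (dg l.+2) k x -> d l (d l.+1 x) = 0.
Proof.
case: l => [|l] px; first exact: (res_d0 sp).
exact: (res_out_d sp px).
Qed.

Lemma cone_coord i (y : cone i) :
  exists p x, [/\ piece (dg i.+1) 0 p, piece (dg i) n x, (val y).1 = p & (val y).2 = x].
Proof.
by exists (val y).1, (val y).2; split; [exact: conePl | exact: conePr | |].
Qed.

Lemma cone_eqP i (z : cone i.+1) (y : cone i) p x : (val y).1 = p -> (val y).2 = x ->
  cone_d i z = y <-> d i.+1 (val z).1 + phi i.+1 (val z).2 = p /\ - d i (val z).2 = x.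
Proof.
move=> <- <-; split=> [<-|[E1 E2]].
  by split; [exact: esym (congr1 fst (cone_dE z)) | exact: esym (congr1 snd (cone_dE z))].
apply: val_inj; apply: etrans (cone_dE z) _.
by apply: injective_projections; [exact: E1 | exact: E2].
Qed.

Lemma cone_coord_eqP i (z : cone i.+1) (y : cone i) p x p' x' :
  (val y).1 = p -> (val y).2 = x -> (val z).1 = p' -> (val z).2 = x' ->
  cone_d i z = y <-> d i.+1 p' + phi i.+1 x' = p /\ - d i x' = x.
Proof. by move=> py xy <- <-; apply: cone_eqP. Qed.

Lemma zcyc_cone0 (y : cone 0) p : (val y).1 = p ->
  zcyc cone_d cone_eps y <-> ipow f n [set: M] (res_eps s p).
Proof. by move=> <-; apply: pi_ker. Qed.

(** A cycle is a [p] whose augmentation lies in I^n M. Some [x'] in degree [n] has the same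
    augmentation, and [p - phi x'] is then a boundary. *)
Lemma cone_res0 (y : cone 0) : zcyc cone_d cone_eps y <-> exists z, cone_d 0 z = y.
Proof.
have [p [x [pp px py xy]]] := cone_coord y.
apply: iff_trans (zcyc_cone0 py) _.
have x0 : x = 0 by move: px; rewrite (res_deg0 sp) /gpiece /= gproj_nil.
split=> [Ip|[z]].
  have [x' px' x'E] := res_eps_surj sp Ip.
  have ph := res_phi_piece sp 1%N x'.
  have [||p' pp' p'E] := @res_exact _ _ _ _ _ sp 0%N 0%N (p - phi 1 x').
  - by apply: is_subB pp ph; apply: piece_is_sub.
  - by rewrite /= linearB (res_eps_phi sp px') x'E subrr.
  have [z zE] := coneP (i := 1) pp' px'.
  exists z; apply/(cone_coord_eqP py xy (congr1 fst zE) (congr1 snd zE)).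
  by rewrite /= p'E subrK x0 (res_d0 sp) oppr0.
have [p' [x' [pp' px' pz xz]]] := cone_coord z.
move=> /(cone_coord_eqP py xy pz xz)[<- _].
have := res_out_d sp pp'; rewrite /res_out linearD => ->.
by rewrite add0r (res_eps_phi sp px'); apply: (res_eps_piece sp px').
Qed.

Lemma cone_resS i (y : cone i.+1) : zcyc cone_d cone_eps y <-> exists z, cone_d i.+1 z = y.
Proof.
have [p [x [pp px py xy]]] := cone_coord y.
apply: (@iff_trans _ (d i.+1 p + phi i.+1 x = 0 /\ d i x = 0)).
  apply: iff_trans (@cone_coord_eqP i y 0 0 0 p x erefl erefl py xy) _.
  split=> -[-> E2]; split=> //; last by rewrite E2 oppr0.
  by apply: oppr_inj; rewrite E2 oppr0.
split=> [[y1 y2]|[z]]; last first.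
  have [p' [x' [pp' px' pz xz]]] := cone_coord z.
  move=> /(cone_coord_eqP py xy pz xz)[<- <-].
  rewrite linearD (dd0 pp') add0r (res_phi_d sp px') !linearN (dd0 px') oppr0.
  by rewrite subrr.
(* For [i = 0] this rests on the injectivity of the inclusion of I^n M in [M]: [x] and [phi x] have
   the same augmentation, and [phi x] is minus a boundary. *)
have ox : res_out s i x.
  case: i y pp px y1 y2 {py xy} => [|i] y pp px y1 y2 //.
  have := res_out_d sp pp; rewrite /res_out -(res_eps_phi sp px).
  by rewrite -[phi 1 x](addKr (d 1 p)) y1 addr0 linearN => ->; rewrite oppr0.
have [x' px' x'E] := res_exact sp px ox.
have px'' : piece (dg i.+2) n (- x') by apply: is_subN px'; apply: piece_is_sub.
have [||p' pp' p'E] := @res_exact _ _ _ _ _ sp i.+1 0%N (p - phi i.+2 (- x')).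
- by apply: is_subB pp (res_phi_piece sp _ _); apply: piece_is_sub.
- by rewrite /res_out linearB (res_phi_d sp px'') linearN x'E linearN opprK.
have [z zE] := coneP (i := i.+2) pp' px''.
exists z; apply/(cone_coord_eqP py xy (congr1 fst zE) (congr1 snd zE)).
by rewrite /= p'E subrK linearN opprK x'E.
Qed.

Lemma cone_res : is_res cone_d cone_eps.
Proof.
split=> [w|[|i] y]; [|exact: cone_res0 | exact: cone_resS].
have [m <-] := pi_surj w; have [x px <-] := @res_eps_surj _ _ _ _ _ sp 0%N m I.
have [|y yE] := @coneP 0 x 0 px; first by apply: is_sub0; apply: piece_is_sub.
by exists y; apply: (congr1 (fun y => pi (res_eps s y.1)) yE).
Qed.

End Cone.

(** * Tensoring with a quotient by a power of the ideal *)

Section RightExactness.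
Context (R : comNzRingType) (r : nat) (f : 'I_r -> R) (N Y : lmodType R) (n : nat).
Context (pi : {linear N -> Y}).
Hypothesis pi_surj : forall y, exists x, pi x = y.
Hypothesis pi_ker : forall x, pi x = 0 <-> ipow f n [set: N] x.

Section RightMap.
Context (E : lmodType R).

Definition tensor_mapr_fun : tensor E N -> tensor E Y :=
  tensor_lift (fun (x : E) (y : N) => tens x (pi y)).

Let linl (y : N) : linear (fun x : E => tens x (pi y)).
Proof. exact: (@tens_is_bilinear _ E Y).1. Qed.

Let linr (x : E) : linear (fun y : N => tens x (pi y)).
Proof. by move=> a u v; rewrite linearP tensDr tensZr. Qed.

HB.instance Definition _ := GRing.isLinear.Build R (tensor E N) (tensor E Y)
  *:%R tensor_mapr_fun (tensor_lift_linear linl linr).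

Definition tensor_mapr : {linear tensor E N -> tensor E Y} := tensor_mapr_fun.

Arguments tensor_mapr : simpl never.

Lemma tensor_maprE x y : tensor_mapr (tens x y) = tens x (pi y).
Proof. exact: tensor_liftE linl linr x y. Qed.

Lemma tensor_mapr_surj t : exists u, tensor_mapr u = t.
Proof.
move: t; apply: (@tensor_ind _ _ _ [set t | exists u, tensor_mapr u = t]).
  have [S0 SP] := image_is_sub tensor_mapr (@setT_is_sub _ (tensor E N)).
  split=> [|a _ _ [u <-] [v <-]]; first by exists 0; rewrite linear0.
  by exists (a *: u + v); rewrite linearP.
by move=> x y; have [z <-] := pi_surj y; exists (tens x z); rewrite tensor_maprE.
Qed.

Lemma tens_ipow m (x : E) (y : N) : ipow f m [set: N] y -> ipow f m [set: tensor E N] (tens x y).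
Proof.
have lin : linear (fun y : N => tens x y : tensor E N) := (@tens_is_bilinear _ E N).2 x.
pose g : {linear N -> tensor E N} :=
  HB.pack (fun y : N => tens x y : tensor E N) (GRing.isLinear.Build _ _ _ _ _ lin).
by apply: (@ipow_map _ _ _ _ _ _ _ _ g).
Qed.

Lemma ipow_tensor_min m (S : set (tensor E N)) : is_sub S ->
  (forall x y, ipow f m [set: N] y -> S (tens x y)) -> ipow f m [set: tensor E N] `<=` S.
Proof.
elim: m S => [|m IH] S SS tS; first by move=> t _; apply: tensor_ind => // x y; apply: tS.
apply: imul_min => // a t; apply: (IH (@scl R (tensor E N) (f a) @^-1` S)).
  exact: preimage_is_sub.
move=> x y Iy; rewrite /preimage /= /scl -tensZr; apply: tS.
by apply: imul_gen Iy; apply: ipow_is_sub.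
Qed.

(** Right exactness of the tensor product. For the harder direction, a section of [pi] as a mere
    function gives a bilinear map into the quotient by I^n, and composing the induced [psi] with
    [tensor_mapr] gives the projection to that quotient. *)
Lemma tensor_mapr_ker t : tensor_mapr t = 0 <-> ipow f n [set: tensor E N] t.
Proof.
split; last first.
  apply: (@ipow_tensor_min n [set t | tensor_mapr t = 0]).
    exact: (preimage_is_sub tensor_mapr (set0_is_sub _)).
  by move=> x y /pi_ker y0; rewrite /= tensor_maprE y0 tens0r.
(* The same submodule in the form of a closed boolean predicate, which [quotmod] requires. *)
pose J := Defs.span (ipow f n [set: tensor E N]).
have JE u : u \in J -> ipow f n [set: tensor E N] u.
  move=> /asboolP/(_ (fun u => `[< ipow f n [set: tensor E N] u >])) H.
  apply/asboolP; apply: H => [|a Ia]; last exact/asboolP.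
  have [S0 SP] := @ipow_is_sub _ _ f _ n _ (@setT_is_sub _ (tensor E N)).
  split=> [|a v w /asboolP Iu /asboolP Iv]; apply/asboolP; [exact: S0 | exact: SP].
have EJ u : ipow f n [set: tensor E N] u -> quotmod_pi J u = 0.
  move=> Iu; apply/eqP; rewrite -[X in _ == X](linear0 (quotmod_pi J)) quotmod_piP subr0.
  exact: Defs.sub_span.
have /choice[sec secP] := pi_surj.
pose h (x : E) (y : Y) : quotmod J := quotmod_pi J (tens x (sec y)).
have hl y : linear (h^~ y).
  by move=> a u v; rewrite /h (@tens_is_bilinear _ E N).1 linearP.
have tens_eq x u v : pi u = pi v -> quotmod_pi J (tens x u) = quotmod_pi J (tens x v).
  move=> uv; apply/eqP; rewrite -subr_eq0 -linearB; apply/eqP/EJ.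
  rewrite -scaleN1r -tensZr -tensDr; apply: tens_ipow; apply/pi_ker.
  by rewrite scaleN1r linearB uv subrr.
have hr x : linear (h x).
  move=> a u v; rewrite /h -linearP -(@tens_is_bilinear _ E N).2.
  by apply: tens_eq; rewrite linearP !secP.
pose psi : {linear tensor E Y -> quotmod J} :=
  HB.pack (tensor_lift h) (GRing.isLinear.Build _ _ _ _ _ (tensor_lift_linear hl hr)).
have psiE u : psi (tensor_mapr u) = quotmod_pi J u.
  apply: (@tensor_ext _ _ _ _ (psi \o tensor_mapr) (quotmod_pi J)) => x y.
  rewrite -[LHS]/(psi (tensor_mapr (tens x y))) tensor_maprE.
  rewrite -[LHS]/(tensor_lift h (tens x (pi y))) (tensor_liftE hl hr).
  by apply: tens_eq; rewrite secP.
move=> t0; apply: JE; have := psiE t; rewrite t0 linear0 => /esym/eqP.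
by rewrite -[X in _ == X](linear0 (quotmod_pi J)) quotmod_piP subr0.
Qed.

End RightMap.

Lemma tensor_mapr_nat (E E' : lmodType R) (g : {linear E -> E'}) t :
  tensor_map Y g (tensor_mapr E t) = tensor_mapr E' (tensor_map N g t).
Proof.
apply: (@tensor_ext _ _ _ _ (tensor_map Y g \o tensor_mapr E) (tensor_mapr E' \o tensor_map N g)) => x y.
rewrite -[LHS]/(tensor_map Y g (tensor_mapr E (tens x y))) tensor_maprE tensor_mapE.
by rewrite -[RHS]/(tensor_mapr E' (tensor_map N g (tens x y))) tensor_mapE tensor_maprE.
Qed.

End RightExactness.

(** * The tensored cone in coordinates *)

Section ConeTensor.
Context (R : comNzRingType) (r : nat) (f : 'I_r -> R) (N Y : lmodType R) (n : nat).
Context (pi : {linear N -> Y}).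
Hypothesis pi_surj : forall y, exists x, pi x = y.
Hypothesis pi_ker : forall x, pi x = 0 <-> ipow f n [set: N] x.
Context (F : lmodType R) (C : nat -> lmodType R) (dC : forall i, {linear C i.+1 -> C i}).
Context (r1 r2 : forall i, {linear F -> C i}) (s1 s2 : forall i, {linear C i -> F}).
Context (p1 p2 D Phi : nat -> {linear F -> F}).
Hypothesis s1r1 : forall i x, s1 i (r1 i x) = p1 i x.
Hypothesis s2r1 : forall i x, s2 i (r1 i x) = 0.
Hypothesis s1r2 : forall i x, s1 i (r2 i x) = 0.
Hypothesis s2r2 : forall i x, s2 i (r2 i x) = p2 i x.
Hypothesis rs : forall i y, y = r1 i (s1 i y) + r2 i (s2 i y).
Hypothesis dCr1 : forall i x, dC i (r1 i.+1 x) = r1 i (D i.+1 x).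
Hypothesis dCr2 : forall i x, dC i (r2 i.+1 x) = r1 i (Phi i.+1 (p2 i.+1 x)) - r2 i (D i x).
Hypothesis dCC : forall i x, dC i (dC i.+1 x) = 0.
Hypothesis p1D : forall i x, p1 i (D i.+1 x) = D i.+1 (p1 i.+1 x).
Hypothesis p1Phi : forall i x, p1 i (Phi i.+1 x) = Phi i.+1 x.
Hypothesis p2D : forall i x, p2 i (D i x) = D i (p2 i.+1 x).
Notation V := (tensor F N).
Notation tm := (tensor_map N).
Notation I_ := (ipow f n).

(** [fix1 i] and [fix2 i] stand for the two summands of [C i] tensored with [N], embedded in [V] as
    images of idempotents. *)
Definition fix1 i : set V := [set v | tm (p1 i) v = v].
Definition fix2 i : set V := [set v | tm (p2 i) v = v].

Arguments tensor_map : simpl never.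

Let tmD (A B : lmodType R) (g : {linear A -> B}) t u : tm g (t + u) = tm g t + tm g u.
Proof. exact: linearD. Qed.

Let tmN (A B : lmodType R) (g : {linear A -> B}) t : tm g (- t) = - tm g t.
Proof. exact: linearN. Qed.

Let fix1_sub i : is_sub (fix1 i). Proof. exact: (fixed_is_sub (tm (p1 i))). Qed.
Let fix2_sub i : is_sub (fix2 i). Proof. exact: (fixed_is_sub (tm (p2 i))). Qed.

Let rp E := @tensor_mapr R N Y pi E.

Definition cone_tensor i : {linear (V * V)%type -> tensor (C i) Y} :=
  (rp (C i) \o tm (r1 i) \o fst) \+ (rp (C i) \o tm (r2 i) \o snd).

Let io i (z : (V * V)%type) : tensor (C i) N := tm (r1 i) z.1 + tm (r2 i) z.2.

Let thE i z : cone_tensor i z = rp (C i) (io i z).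
Proof. by rewrite linearD. Qed.

Let tm_comp (A B E : lmodType R) (g : {linear B -> E}) (h : {linear A -> B}) (k : {linear A -> E}) t :
  (forall x, g (h x) = k x) -> tm g (tm h t) = tm k t.
Proof. by move=> ghk; rewrite -(@tensor_map_comp _ _ _ _ _ k) // => x; rewrite ghk. Qed.

Let s1io i z : fix1 i z.1 -> tm (s1 i) (io i z) = z.1.
Proof.
move=> z1; rewrite /io tmD (tm_comp _ (s1r1 i)) z1.
by rewrite (@tm_comp _ _ _ _ _ \0) ?(@tensor_map0 _ N) ?addr0 // => x; rewrite s1r2.
Qed.

Let s2io i z : fix2 i z.2 -> tm (s2 i) (io i z) = z.2.
Proof.
move=> z2; rewrite /io tmD (tm_comp _ (s2r2 i)) z2.
by rewrite (@tm_comp _ _ _ _ _ \0) ?(@tensor_map0 _ N) ?add0r // => x; rewrite s2r1.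
Qed.

Let ios i t : t = io i (tm (s1 i) t, tm (s2 i) t).
Proof.
rewrite /io /= -(@tensor_map_comp _ N _ _ _ (r1 i \o s1 i)) // -(@tensor_map_comp _ N _ _ _ (r2 i \o s2 i)) //.
rewrite -(@tensor_mapD _ N _ _ idfun) ?(@tensor_map_id _ N _ idfun) //.
exact: rs.
Qed.

Let fix1_s i t : fix1 i (tm (s1 i) t).
Proof.
apply: tm_comp => x; rewrite -s1r1.
by rewrite [in RHS](rs x) linearD s1r2 addr0.
Qed.

Let fix2_s i t : fix2 i (tm (s2 i) t).
Proof.
apply: tm_comp => x; rewrite -s2r2.
by rewrite [in RHS](rs x) linearD s2r1 add0r.
Qed.

Let th_surj i t : exists z, [/\ fix1 i z.1, fix2 i z.2 & cone_tensor i z = t].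
Proof.
have [u <-] := @tensor_mapr_surj _ _ _ _ pi_surj (C i) t.
exists (tm (s1 i) u, tm (s2 i) u); split; [exact: fix1_s | exact: fix2_s |].
by rewrite thE -ios.
Qed.

(** The coordinate maps [s1] and [s2] split I^n times the tensor product of [C i] with [N] into I^n
    times each summand. *)
Let th0 i z : fix1 i z.1 -> fix2 i z.2 ->
  cone_tensor i z = 0 <-> I_ (fix1 i) z.1 /\ I_ (fix2 i) z.2.
Proof.
move=> z1 z2; rewrite thE (tensor_mapr_ker pi_surj pi_ker); split=> [Iz|[I1 I2]].
  by split; [rewrite -(s1io z1) | rewrite -(s2io z2)]; apply: ipow_map Iz => x _;
    [exact: fix1_s | exact: fix2_s].
apply: is_subD; first exact: ipow_is_sub (setT_is_sub _).
  exact: ipow_map I1.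
exact: ipow_map I2.
Qed.

Definition cone_tdiff i (z : (V * V)%type) : (V * V)%type :=
  (tm (D i.+1) z.1 + tm (Phi i.+1) z.2, - tm (D i) z.2).

Let tm_r1 i v : tm (dC i) (tm (r1 i.+1) v) = tm (r1 i) (tm (D i.+1) v).
Proof.
apply: (@tensor_ext _ _ _ _ (tm (dC i) \o tm (r1 i.+1)) (tm (r1 i) \o tm (D i.+1))) => x y.
by rewrite /= !tensor_mapE dCr1.
Qed.

Let tm_r2 i w : tm (dC i) (tm (r2 i.+1) w) =
  tm (r1 i) (tm (Phi i.+1) (tm (p2 i.+1) w)) - tm (r2 i) (tm (D i) w).
Proof.
apply: (@tensor_ext _ _ _ _ (tm (dC i) \o tm (r2 i.+1))
  ((tm (r1 i) \o tm (Phi i.+1) \o tm (p2 i.+1)) \- (tm (r2 i) \o tm (D i)))) => x y.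
by rewrite /= !tensor_mapE dCr2 tensDl -[- r2 i _]scaleN1r tensZl scaleN1r.
Qed.

Let dth i z : fix2 i.+1 z.2 ->
  tensor_map Y (dC i) (cone_tensor i.+1 z) = cone_tensor i (cone_tdiff i z).
Proof.
move=> z2; rewrite !thE /rp tensor_mapr_nat; congr (tensor_mapr pi (C i) _).
by rewrite /io tmD tm_r1 tm_r2 z2 tmD tmN addrA.
Qed.

Let tdiff_fix1 i z : fix1 i.+1 z.1 -> fix1 i (cone_tdiff i z).1.
Proof.
move=> z1; apply: etrans (tmD _ _ _) _; congr (_ + _).
  have -> : tm (p1 i) (tm (D i.+1) z.1) = tm (D i.+1) (tm (p1 i.+1) z.1).
    apply: (@tensor_ext _ _ _ _ (tm (p1 i) \o tm (D i.+1)) (tm (D i.+1) \o tm (p1 i.+1))) => x y.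
    by rewrite /= !tensor_mapE p1D.
  by rewrite z1.
exact: tm_comp (p1Phi i).
Qed.

Let tdiff_fix2 i z : fix2 i.+1 z.2 -> fix2 i (cone_tdiff i z).2.
Proof.
move=> z2; apply: etrans (tmN _ _) _; congr (- _).
have -> : tm (p2 i) (tm (D i) z.2) = tm (D i) (tm (p2 i.+1) z.2).
  apply: (@tensor_ext _ _ _ _ (tm (p2 i) \o tm (D i)) (tm (D i) \o tm (p2 i.+1))) => x y.
  by rewrite /= !tensor_mapE p2D.
by rewrite z2.
Qed.

(* Cycles and boundaries of the tensored cone, pulled back along [cone_tensor]. *)
Definition cone_cyc i : set (V * V)%type := [set z | [/\ fix1 i z.1, fix2 i z.2 &
  if i is i'.+1 then I_ (fix1 i') (cone_tdiff i' z).1 /\ I_ (fix2 i') (cone_tdiff i' z).2 else True]].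

Definition cone_bd i : set (V * V)%type := [set z | exists y u,
  [/\ fix1 i.+1 y.1, fix2 i.+1 y.2, I_ (fix1 i) u.1, I_ (fix2 i) u.2 & z = cone_tdiff i y + u]].

Let cycE i z : cone_cyc i z <-> [/\ fix1 i z.1, fix2 i z.2 & tcyc dC (cone_tensor i z)].
Proof.
rewrite /cone_cyc; case: i z => [|i] z; first by split=> -[].
split=> -[z1 z2 z3]; split=> //; move: z3; rewrite /= dth //;
  by move=> /(th0 (tdiff_fix1 z1) (tdiff_fix2 z2)).
Qed.

Let cyc_sub i : is_sub (cone_cyc i).
Proof.
have E : cone_cyc i = [set z | fix1 i z.1] `&` ([set z | fix2 i z.2] `&` [set z | tcyc dC (cone_tensor i z)]).
  by apply/seteqP; split=> z; [move=> /cycE[] | move=> [? [? ?]]; apply/cycE].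
rewrite E; apply: setI_is_sub; first exact: (preimage_is_sub (fst : {linear (V * V)%type -> V})).
apply: setI_is_sub; first exact: (preimage_is_sub (snd : {linear (V * V)%type -> V})).
apply: (preimage_is_sub (cone_tensor i)); case: (i) => [//|j].
exact: (preimage_is_sub (tensor_map Y (dC j)) (set0_is_sub _)).
Qed.

Let dCC_t i t : tensor_map Y (dC i) (tensor_map Y (dC i.+1) t) = 0.
Proof.
rewrite -(@tensor_map_comp _ Y _ _ _ (dC i \o dC i.+1)) //.
by apply: tensor_map0 => x; apply: dCC.
Qed.

(** [cone_tensor i] maps pairs from [fix1 i] and [fix2 i] onto the tensored cone, with kernel given
    by [th0], and is compatible with the differentials by [dth]. *)
Lemma cone_tensor_len i k :
  len_is (range (tensor_map Y (dC i))) (@tcyc _ Y C dC i) k <-> len_is (cone_bd i) (cone_cyc i) k.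
Proof.
apply: iff_sym; apply: (@len_is_map _ _ _ (cone_tensor i)) => [||z|t].
- exact: cyc_sub.
- exact: image_is_sub.
- split=> [[y [u [y1 y2 u1 u2 ->]]]|[/cycE[z1 z2 _] [t _ tE]]].
    have u0 : cone_tensor i u = 0.
      by apply/th0 => //; [exact: ipow_le u1 | exact: ipow_le u2].
    have E : cone_tensor i (cone_tdiff i y + u) = tensor_map Y (dC i) (cone_tensor i.+1 y).
      by rewrite linearD u0 addr0 dth.
    split; last by rewrite E; exists (cone_tensor i.+1 y).
    apply/cycE; split.
    + by apply: is_subD; [exact: fix1_sub | exact: tdiff_fix1 | exact: ipow_le u1].
    + by apply: is_subD; [exact: fix2_sub | exact: tdiff_fix2 | exact: ipow_le u2].
    + by rewrite E; case: (i) y {y1 y2 E u u1 u2 u0} => [//|j] y; apply: dCC_t.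
  have [y [y1 y2 yE]] := th_surj t.
  have /th0[||] : cone_tensor i (z - cone_tdiff i y) = 0.
  - by rewrite linearB -dth // yE tE subrr.
  - by apply: is_subB z1 (tdiff_fix1 y1); apply: fix1_sub.
  - by apply: is_subB z2 (tdiff_fix2 y2); apply: fix2_sub.
  by exists y, (z - cone_tdiff i y); split=> //; rewrite addrC subrK.
split=> [tc|[z [_ [/cycE[z1 z2 zc] [u _ <-] ->]]]].
  have [z [z1 z2 zE]] := th_surj t; exists z, 0; rewrite addr0; split=> //.
    by apply/cycE; rewrite zE.
  by exists 0 => //; apply: linear0.
case: i {t} z z1 z2 zc u => [//|i] z z1 z2 zc u.
exact: (is_subD (preimage_is_sub (tensor_map Y (dC i)) (set0_is_sub _)) zc (dCC_t u)).
Qed.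

End ConeTensor.

(** * Length of the homology of a mapping cone *)

Section ConeLength.
Context (R : comNzRingType) (V : lmodType R).
Context (da db dc Pa Pb : {linear V -> V}).
Context (Q2 Q1 H1 H0 JQ1 JQ0 JH0 JHm : set V).
Hypotheses (SQ2 : is_sub Q2) (SQ1 : is_sub Q1) (SH1 : is_sub H1) (SH0 : is_sub H0).
Hypotheses (SJQ1 : is_sub JQ1) (SJQ0 : is_sub JQ0) (SJH0 : is_sub JH0) (SJHm : is_sub JHm).
Hypotheses (JQ : JQ1 `<=` Q1) (JH : JH0 `<=` H0).
Hypothesis daQ : forall q, Q2 q -> Q1 (da q) /\ db (da q) = 0.
Hypothesis dbH : forall g, H1 g -> H0 (db g) /\ dc (db g) = 0.
Hypothesis dbJ : forall q, JQ1 q -> JQ0 (db q).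
Hypothesis dcJ : forall g, JH0 g -> JHm (dc g).
Hypothesis PaH : forall g, H1 g -> Q1 (Pa g) /\ db (Pa g) = Pb (db g).
Hypothesis PbJ : forall g, JH0 g -> JQ0 (Pb g).

(* The homology of a cone with differential [(q, g) |-> (d q + P g, - d g)] modulo [J]; its length
   follows by projecting to the second factor and cutting at the images of [Pa] and [Pb]. *)
Definition cl_cyc : set (V * V)%type :=
  [set z | [/\ Q1 z.1, H0 z.2, JQ0 (db z.1 + Pb z.2) & JHm (dc z.2)]].
Definition cl_bd : set (V * V)%type := [set z | exists y1 y2 u1 u2,
  [/\ Q2 y1 /\ H1 y2, JQ1 u1, JH0 u2, z.1 = da y1 + Pa y2 + u1 & z.2 = - db y2 + u2]].

(** With [Q] the degree 0 strand and [H] the degree [n] strand, [AQ / BQ] and [AH / BH] are their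
    homologies modulo [J], while [im1 / BQ] and [im0 / S0] are the images of the comparison map at
    two consecutive levels: the terms of the long exact sequence of the cone. *)
Let AQ : set V := [set q | Q1 q /\ JQ0 (db q)].
Let BQ : set V := sub_add (da @` Q2) JQ1.
Let AH : set V := [set g | H0 g /\ JHm (dc g)].
Let BH : set V := sub_add (db @` H1) JH0.
Let A1 : set V := [set g | H1 g /\ JH0 (db g)].
Let im1 : set V := sub_add (Pa @` A1) BQ.
Let S0 : set V := sub_add (db @` Q1) JQ0.
Let im0 : set V := sub_add (Pb @` AH) S0.

Hypotheses (finQ : fin_len BQ AQ) (finH : fin_len BH AH).

(** [Kd / BH] is the kernel of the map that [Pb] induces on homology; [Zm] is the set of cone cycles
    whose class projects to zero there. *)
Let Kd : set V := [set g | AH g /\ S0 (Pb g)].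
Let Zm : set (V * V)%type := [set z | cl_cyc z /\ BH z.2].

Let SAQ : is_sub AQ. Proof. exact: (setI_is_sub SQ1 (preimage_is_sub db SJQ0)). Qed.
Let SAH : is_sub AH. Proof. exact: (setI_is_sub SH0 (preimage_is_sub dc SJHm)). Qed.
Let SA1 : is_sub A1. Proof. exact: (setI_is_sub SH1 (preimage_is_sub db SJH0)). Qed.
Let SBQ : is_sub BQ. Proof. exact: (sub_add_is_sub (image_is_sub da SQ2) SJQ1). Qed.
Let SBH : is_sub BH. Proof. exact: (sub_add_is_sub (image_is_sub db SH1) SJH0). Qed.
Let Sim1 : is_sub im1. Proof. exact: (sub_add_is_sub (image_is_sub Pa SA1) SBQ). Qed.
Let SS0 : is_sub S0. Proof. exact: (sub_add_is_sub (image_is_sub db SQ1) SJQ0). Qed.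
Let SKd : is_sub Kd. Proof. exact: (setI_is_sub SAH (preimage_is_sub Pb SS0)). Qed.

Let Scyc : is_sub cl_cyc.
Proof.
split=> [|a u v [u1 u2 u3 u4] [v1 v2 v3 v4]].
  by split; rewrite /= ?linear0 ?addr0; apply: is_sub0.
split=> /=; [exact: SQ1.2 | exact: SH0.2 | | by rewrite linearP; apply: SJHm.2].
by rewrite !linearP addrACA -scalerDr; apply: SJQ0.2.
Qed.

Let Sbd : is_sub cl_bd.
Proof.
split=> [|a u v [y1 [y2 [u1 [u2 [[Y1 Y2] U1 U2 E1 E2]]]]] [z1 [z2 [v1 [v2 [[Z1 Z2] V1 V2 F1 F2]]]]]].
  exists 0, 0, 0, 0; split; [by split; apply: is_sub0 | exact: is_sub0 | exact: is_sub0 | |].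
    by rewrite /= !linear0 !addr0.
  by rewrite /= linear0 oppr0 addr0.
exists (a *: y1 + z1), (a *: y2 + z2), (a *: u1 + v1), (a *: u2 + v2); split.
- by split; [exact: SQ2.2 | exact: SH1.2].
- exact: SJQ1.2.
- exact: SJH0.2.
- by rewrite /= E1 F1 !linearP !scalerDr [X in _ = X + _]addrACA [RHS]addrACA.
- by rewrite /= E2 F2 linearP scalerDr scalerN opprD addrACA.
Qed.

Let SZm : is_sub Zm.
Proof. exact: (setI_is_sub Scyc (preimage_is_sub (snd : {linear (V * V)%type -> V}) SBH)). Qed.

Let bd_Zm : cl_bd `<=` Zm.
Proof.
move=> z [y1 [y2 [u1 [u2 [[Y1 Y2] U1 U2 E1 E2]]]]].
have [Q1a da0] := daQ Y1; have [Q1P PE] := PaH Y2; have [H0b db0] := dbH Y2.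
split; last first.
  exists (db (- y2)), u2; rewrite linearN; split=> //.
  by exists (- y2); [exact: (is_subN SH1) | exact: linearN].
split; rewrite ?E1 ?E2.
- by apply: (is_subD SQ1); [exact: (is_subD SQ1) | exact: JQ].
- by apply: (is_subD SH0); [exact: (is_subN SH0) | exact: JH].
- rewrite !linearD da0 add0r PE linearN addrACA subrr add0r.
  by apply: (is_subD SJQ0); [exact: dbJ | exact: PbJ].
- by rewrite linearD linearN db0 oppr0 add0r; apply: dcJ.
Qed.

Let BH_Kd : BH `<=` Kd.
Proof.
move=> _ [_ [u [[g Hg <-] Ju ->]]]; have [Hb db0] := dbH Hg; have [QP PE] := PaH Hg; split.
  split; first by apply: (is_subD SH0) => //; apply: JH.
  by rewrite linearD db0 add0r; apply: dcJ.
rewrite /= linearD -PE; exists (db (Pa g)), (Pb u); split=> //; exact: PbJ.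
Qed.

Let Kd_AH : Kd `<=` AH. Proof. by move=> g []. Qed.

Let finBK : fin_len BH Kd /\ fin_len Kd AH.
Proof. exact/(fin_lenE SBH SKd SAH BH_Kd Kd_AH). Qed.

Let map0 : (fin_len Kd AH <-> fin_len S0 im0) /\ len Kd AH = len S0 im0.
Proof.
apply: (len_map (f := Pb)) => // w; split=> [[_ [u [[v Av <-] Su ->]]]|[v [u [Av Su ->]]]].
  by exists v, u.
by exists (Pb v), u; split=> //; exists v.
Qed.

Let map_snd : (fin_len Zm cl_cyc <-> fin_len BH Kd) /\ len Zm cl_cyc = len BH Kd.
Proof.
apply: (len_map (f := (snd : {linear (V * V)%type -> V}))) => // w.
split=> [[[Hw dw] [_ [j [[q Qq <-] Jj PE]]]]|[z [b [[z1 z2 z3 z4] /BH_Kd Kb ->]]]].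
  exists (- q, w), 0; rewrite /= addr0; split=> //; last exact: is_sub0.
  split=> //=; first exact: (is_subN SQ1).
  by rewrite PE linearN addKr.
apply: (is_subD SKd) => //; split=> //=.
exists (db (- z.1)), (db z.1 + Pb z.2); split=> //; last by rewrite linearN addKr.
by exists (- z.1) => //; apply: (is_subN SQ1).
Qed.

Fact cl_inl_linear : linear (fun q : V => (q, 0) : (V * V)%type).
Proof. by move=> a u v; apply: injective_projections; rewrite /= ?scaler0 ?addr0. Qed.

Let cl_inl : {linear V -> (V * V)%type} :=
  HB.pack (fun q : V => (q, 0) : (V * V)%type) (GRing.isLinear.Build _ _ _ _ _ cl_inl_linear).

Let map_inl : (fin_len im1 AQ <-> fin_len cl_bd Zm) /\ len im1 AQ = len cl_bd Zm.
Proof.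
apply: (len_map (f := cl_inl)) => // [q|z].
  split=> [[_ [_ [[g [Hg Jg] <-] [_ [u [[y Qy <-] Ju ->]] ->]]]]|].
    have [Q1a da0] := daQ Qy; have [Q1P PE] := PaH Hg; split.
      split; first by apply: (is_subD SQ1) => //; apply: (is_subD SQ1) => //; apply: JQ.
      rewrite !linearD da0 add0r PE; apply: (is_subD SJQ0); [exact: PbJ | exact: dbJ].
    exists y, g, u, (db g); split=> //=; first by rewrite addrA [Pa g + _]addrC.
    by rewrite addNr.
  move=> [[Qq Jq] [y1 [y2 [u1 [u2 [[Y1 Y2] U1 U2 /= -> E2]]]]]].
  exists (Pa y2), (da y1 + u1); rewrite addrA [Pa y2 + _]addrC; split=> //.
    exists y2 => //; split=> //.
    by rewrite (_ : db y2 = u2) //; apply/eqP; rewrite eq_sym -subr_eq0 addrC -E2.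
  by exists (da y1), u1; split=> //; exists y1.
split=> [[[z1 z2 z3 z4] [_ [u [[g Hg <-] Ju zE]]]]|[q [b [[Qq Jq] /bd_Zm Zb ->]]]]; last first.
  apply: (is_subD SZm) => //; split=> /=; last exact: is_sub0.
  by split; rewrite /= ?linear0 ?addr0 //; apply: is_sub0.
have [Q1P PE] := PaH Hg.
(* Up to [u], the second summand is the boundary of [(0, - g)]; removing it clears the second
   coordinate of [z]. *)
exists (z.1 + Pa g), (- Pa g, z.2); split.
- split; first exact: (is_subD SQ1).
  rewrite linearD PE; move: z3; rewrite zE linearD addrA => z3.
  rewrite -[X in JQ0 X](addrK (Pb u)); apply: (is_subB SJQ0) => //; exact: PbJ.
- exists 0, (- g), 0, u; split=> //; [split | | |] => /=; [exact: is_sub0 | exact: (is_subN SH1) | exact: is_sub0 | |].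
    by rewrite linear0 add0r addr0 linearN.
  by rewrite linearN opprK.
- by apply: injective_projections; rewrite /= ?addrK ?add0r.
Qed.

Let BQ_im1 : BQ `<=` im1. Proof. exact: (sub_addr (image_is_sub Pa SA1)). Qed.

Let im1_AQ : im1 `<=` AQ.
Proof.
move=> _ [_ [_ [[g [Hg Jg] <-] [_ [u [[y Qy <-] Ju ->]]] ->]]].
have [Q1a da0] := daQ Qy; have [Q1P PE] := PaH Hg.
split; first by apply: (is_subD SQ1) => //; apply: (is_subD SQ1) => //; apply: JQ.
by rewrite !linearD da0 add0r PE; apply: (is_subD SJQ0); [exact: PbJ | exact: dbJ].
Qed.

Let finQ1 : fin_len BQ im1 /\ fin_len im1 AQ.
Proof. exact/(fin_lenE SBQ Sim1 SAQ BQ_im1 im1_AQ). Qed.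

Let Zm_cyc : Zm `<=` cl_cyc. Proof. by move=> z []. Qed.

Lemma cl_fin : fin_len cl_bd cl_cyc.
Proof.
apply/(fin_lenE Sbd SZm Scyc bd_Zm Zm_cyc); split.
  by apply/map_inl.1; case: finQ1.
by apply/map_snd.1; case: finBK.
Qed.

(** The cone homology has a submodule isomorphic to [AQ / im1] with quotient [Kd / BH], and
    [AH / Kd] is isomorphic to [im0 / S0]. *)
Lemma cl_len : (len cl_bd cl_cyc + len BQ im1 + len S0 im0 = len BQ AQ + len BH AH)%N.
Proof.
rewrite (len_add Sbd SZm Scyc bd_Zm Zm_cyc cl_fin) -map_inl.2 map_snd.2 -map0.2.
rewrite (len_add SBQ Sim1 SAQ BQ_im1 im1_AQ finQ) (len_add SBH SKd SAH BH_Kd Kd_AH finH).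
by rewrite addnA [(len BQ im1 + _)%N]addnC; congr addn; rewrite addnAC.
Qed.

End ConeLength.

Section ConeCoordinates.
Context (R : comNzRingType) (F : lmodType R) (C : nat -> lmodType R).
Context (dC : forall i, {linear C i.+1 -> C i}).
Context (r1 r2 : forall i, {linear F -> C i}) (s1 s2 : forall i, {linear C i -> F}).
Context (p1 p2 D Phi : nat -> {linear F -> F}).
Hypothesis ext : forall i y z, s1 i y = s1 i z -> s2 i y = s2 i z -> y = z.
Hypothesis s1r1 : forall i x, s1 i (r1 i x) = p1 i x.
Hypothesis s2r1 : forall i x, s2 i (r1 i x) = 0.
Hypothesis s1r2 : forall i x, s1 i (r2 i x) = 0.
Hypothesis s2r2 : forall i x, s2 i (r2 i x) = p2 i x.
Hypothesis p1s1 : forall i y, p1 i (s1 i y) = s1 i y.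
Hypothesis p2s2 : forall i y, p2 i (s2 i y) = s2 i y.
Hypothesis s1d : forall i y, s1 i (dC i y) = D i.+1 (s1 i.+1 y) + Phi i.+1 (s2 i.+1 y).
Hypothesis s2d : forall i y, s2 i (dC i y) = - D i (s2 i.+1 y).
Hypothesis p1D : forall i x, p1 i (D i.+1 x) = D i.+1 (p1 i.+1 x).
Hypothesis p1Phi : forall i x, p1 i (Phi i.+1 x) = Phi i.+1 x.
Hypothesis p2D : forall i x, p2 i (D i x) = D i (p2 i.+1 x).

Lemma coord_decomp i y : y = r1 i (s1 i y) + r2 i (s2 i y).
Proof.
by apply: ext; rewrite linearD ?s1r1 ?s1r2 ?s2r1 ?s2r2 ?addr0 ?add0r ?p1s1 ?p2s2.
Qed.

Lemma coord_diff_l i x : dC i (r1 i.+1 x) = r1 i (D i.+1 x).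
Proof.
apply: ext; first by rewrite s1d !s1r1 s2r1 linear0 addr0 p1D.
by rewrite s2d !s2r1 linear0 oppr0.
Qed.

Lemma coord_diff_r i x : dC i (r2 i.+1 x) = r1 i (Phi i.+1 (p2 i.+1 x)) - r2 i (D i x).
Proof.
apply: ext; rewrite linearB; first by rewrite s1d s1r2 s2r2 s1r1 s1r2 linear0 add0r subr0 p1Phi.
by rewrite s2d s2r2 s2r1 s2r2 sub0r p2D.
Qed.

End ConeCoordinates.

(** * Tor of the two quotients as the homology of the tensored cone *)

Section TorCone.
Context (R : comNzRingType) (r : nat) (f : 'I_r -> R) (M N : lmodType R).
Context (s : graded_res r M) (sp : graded_res_spec f s) (n : nat).
Context (X Y : lmodType R) (piM : {linear M -> X}) (piN : {linear N -> Y}).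
Hypothesis piM_surj : forall x, exists m, piM m = x.
Hypothesis piM_ker : forall m, piM m = 0 <-> ipow f n [set: M] m.
Hypothesis piN_surj : forall x, exists m, piN m = x.
Hypothesis piN_ker : forall m, piN m = 0 <-> ipow f n [set: N] m.
Notation F := (gfree R r).
Notation dg := (res_deg s).

Definition free_inl (x : F) : (F * F)%type := (x, 0).
Definition free_inr (x : F) : (F * F)%type := (0, x).

Fact free_inl_linear : linear free_inl.
Proof. by move=> a u v; apply: injective_projections; rewrite /= ?scaler0 ?addr0. Qed.

Fact free_inr_linear : linear free_inr.
Proof. by move=> a u v; apply: injective_projections; rewrite /= ?scaler0 ?addr0. Qed.

HB.instance Definition _ := GRing.isLinear.Build R F (F * F)%type *:%R free_inl free_inl_linear.
HB.instance Definition _ := GRing.isLinear.Build R F (F * F)%type *:%R free_inr free_inr_linear.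

Let C := cone s n.
Let r1 i : {linear F -> C i} := cone_retract s n i \o free_inl.
Let r2 i : {linear F -> C i} := cone_retract s n i \o free_inr.
Let s1 i : {linear C i -> F} := fst \o val.
Let s2 i : {linear C i -> F} := snd \o val.
Let p1 i : {linear F -> F} := gproj R r (dg i.+1) 0.
Let p2 i : {linear F -> F} := gproj R r (dg i) n.

Let valr1 i x : val (r1 i x) = (p1 i x, 0).
Proof. by apply: etrans (cone_retractE _ _ _ _) _; apply: injective_projections; rewrite //= linear0. Qed.

Let valr2 i x : val (r2 i x) = (0, p2 i x).
Proof. by apply: etrans (cone_retractE _ _ _ _) _; apply: injective_projections; rewrite //= linear0. Qed.

Let s1r1 i x : s1 i (r1 i x) = p1 i x. Proof. exact: (congr1 (fun z : (F * F)%type => z.1) (valr1 i x)). Qed.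
Let s2r1 i x : s2 i (r1 i x) = 0. Proof. exact: (congr1 (fun z : (F * F)%type => z.2) (valr1 i x)). Qed.
Let s1r2 i x : s1 i (r2 i x) = 0. Proof. exact: (congr1 (fun z : (F * F)%type => z.1) (valr2 i x)). Qed.
Let s2r2 i x : s2 i (r2 i x) = p2 i x. Proof. exact: (congr1 (fun z : (F * F)%type => z.2) (valr2 i x)). Qed.

Let cone_ext i (y z : C i) : s1 i y = s1 i z -> s2 i y = s2 i z -> y = z.
Proof. by move=> E1 E2; apply: val_inj; apply: injective_projections. Qed.

Let s1d i y : s1 i (cone_d s n i y) = res_d s i.+1 (s1 i.+1 y) + res_phi s i.+1 (s2 i.+1 y).
Proof. exact: (congr1 (fun z : (F * F)%type => z.1) (cone_dE sp y)). Qed.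

Let s2d i y : s2 i (cone_d s n i y) = - res_d s i (s2 i.+1 y).
Proof. exact: (congr1 (fun z : (F * F)%type => z.2) (cone_dE sp y)). Qed.

Let p1s1 i y : p1 i (s1 i y) = s1 i y. Proof. exact: (conePl y). Qed.
Let p2s2 i y : p2 i (s2 i y) = s2 i y. Proof. exact: (conePr y). Qed.

Let p1D i x : p1 i (res_d s i.+1 x) = res_d s i.+1 (p1 i.+1 x).
Proof. by rewrite /p1 (res_d_proj sp). Qed.

Let p1Phi i x : p1 i (res_phi s i.+1 x) = res_phi s i.+1 x.
Proof. exact: (res_phi_piece sp). Qed.

Let p2D i x : p2 i (res_d s i x) = res_d s i (p2 i.+1 x).
Proof. by rewrite /p2 (res_d_proj sp). Qed.

Lemma Tor_cone_len i k : has_length (Tor i X Y) k <->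
  len_is (@cone_bd _ _ f N n F p1 p2 (res_d s) (res_phi s) i) (@cone_cyc _ _ f N n F p1 p2 (res_d s) (res_phi s) i) k.
Proof.
have rC := cone_res sp (n := n) piM_surj piM_ker.
apply: iff_trans (Tor_len Y i k (@cone_projective _ _ _ s n) rC) _.
have dCC j x : cone_d s n j (cone_d s n j.+1 x) = 0.
  by have := (rC.2 j.+1 (cone_d s n j.+1 x)).2; apply; exists x.
apply: (cone_tensor_len piN_surj piN_ker s1r1 s2r1 s1r2 s2r2 _ _ _ dCC p1D p1Phi p2D).
- exact: (coord_decomp cone_ext s1r1 s2r1 s1r2 s2r2 p1s1 p2s2).
- exact: (coord_diff_l cone_ext s1r1 s2r1 s1d s2d p1D).
- exact: (coord_diff_r cone_ext s1r1 s2r1 s1r2 s2r2 s1d s2d p1Phi p2D).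
Qed.

End TorCone.

(** * The graded resolution tensored with a module *)

Section GradedTensor.
Context (R : comNzRingType) (r : nat) (f : 'I_r -> R) (M N : lmodType R).
Hypothesis hN : fin_gen N.
Context (s : graded_res r M) (sp : graded_res_spec f s).
Notation F := (gfree R r).
Notation dg := (res_deg s).
Notation V := (tensor F N).
Notation tm := (tensor_map N).

Arguments tensor_map : simpl never.

Definition gt_d l : {linear V -> V} := tm (res_d s l).
Definition gt_phi l : {linear V -> V} := tm (res_phi s l).
Definition gt_T a : {linear V -> V} := tm (opT R a).
Definition gt_proj l k : {linear V -> V} := tm (gproj R r (dg l) k).

Arguments gt_d : simpl never.
Arguments gt_phi : simpl never.
Arguments gt_T : simpl never.
Arguments gt_proj : simpl never.

(* The degree [k] piece of level [l] of the graded resolution, tensored with [N]. *)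
Definition gt_piece l k : set V := [set v | gt_proj l k v = v].

Lemma tm_square (A B B' E : lmodType R) (g : {linear B -> E}) (h : {linear A -> B})
    (g' : {linear B' -> E}) (h' : {linear A -> B'}) :
  (forall x, g (h x) = g' (h' x)) -> forall t, tm g (tm h t) = tm g' (tm h' t).
Proof.
move=> gh t; rewrite -(@tensor_map_comp _ N _ _ _ (g \o h)) //.
exact: (@tensor_map_comp _ N _ _ _ (g \o h) g' h').
Qed.

Lemma tm_comp (A B E : lmodType R) (g : {linear B -> E}) (h : {linear A -> B}) (k : {linear A -> E}) t :
  (forall x, g (h x) = k x) -> tm g (tm h t) = tm k t.
Proof. by move=> ghk; apply: esym; apply: (@tensor_map_comp _ N _ _ _ k g h) => x; rewrite ghk. Qed.

Lemma gt_projE l k x y : gt_proj l k (tens x y) = tens (gproj R r (dg l) k x) y.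
Proof. exact: tensor_mapE. Qed.

Lemma gt_is_sub l k : is_sub (gt_piece l k).
Proof. exact: (fixed_is_sub (gt_proj l k)). Qed.

Lemma gt_proj_d l k v : gt_proj l k (gt_d l v) = gt_d l (gt_proj l.+1 k v).
Proof. by apply: tm_square => x; rewrite (res_d_proj sp). Qed.

Lemma gt_dT l a v : gt_d l (gt_T a v) = gt_T a (gt_d l v).
Proof. by apply: tm_square => x; rewrite (res_dT sp). Qed.

Lemma gt_TC a b v : gt_T a (gt_T b v) = gt_T b (gt_T a v).
Proof. by apply: tm_square => x; rewrite opTC. Qed.

Lemma gt_proj_T l k a v : gt_proj l k.+1 (gt_T a v) = gt_T a (gt_proj l k v).
Proof. by apply: tm_square => x; rewrite gproj_T. Qed.

Lemma gt_phiT l a v : gt_phi l (gt_T a v) = f a *: gt_phi l v.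
Proof.
apply: etrans (tm_comp (k := res_phi s l \o opT R a) v _) _ => //.
by apply: tensor_mapZ => x; apply: (res_phiT sp).
Qed.

Lemma gt_phi_piece l v : gt_piece l 0 (gt_phi l v).
Proof. by apply: tm_comp => x; rewrite (res_phi_piece sp). Qed.

Lemma gt_d_piece l k v : gt_piece l.+1 k v -> gt_piece l k (gt_d l v).
Proof. by move=> gv; rewrite /gt_piece /mkset gt_proj_d gv. Qed.

Lemma gt0 k v : gt_piece 0 k v -> v = 0.
Proof. by move=> <-; apply: tensor_map0 => x; rewrite (res_deg0 sp) gproj_nil. Qed.

Lemma gt_d0 v : gt_d 0 v = 0.
Proof. by apply: tensor_map0 => x; apply: (res_d0 sp). Qed.

Lemma gt_dd l k v : gt_piece l.+2 k v -> gt_d l (gt_d l.+1 v) = 0.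
Proof.
move=> <-; apply: etrans (tm_comp (k := res_d s l \o res_d s l.+1) _ _) _ => //.
apply: etrans (tm_comp (k := res_d s l \o res_d s l.+1 \o gproj R r (dg l.+2) k) _ _) _ => //.
by apply: tensor_map0 => x; apply: (dd0 sp); apply: piece_proj.
Qed.

Lemma gt_phi_d l k v : gt_piece l.+1 k v -> gt_d l (gt_phi l.+1 v) = gt_phi l (gt_d l v).
Proof.
have L w : gt_d l (gt_phi l.+1 w) = tm (res_d s l \o res_phi s l.+1) w by apply: tm_comp.
have E w : gt_phi l (gt_d l w) = tm (res_phi s l \o res_d s l) w by apply: tm_comp.
have H := @tm_square _ _ _ _ (res_d s l \o res_phi s l.+1) (gproj R r (dg l.+1) k)
  (res_phi s l \o res_d s l) (gproj R r (dg l.+1) k).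
move=> <-; apply: etrans (L _) _; apply: etrans _ (esym (E _)).
by apply: H => x; apply: (res_phi_d sp); apply: piece_proj.
Qed.

Definition gt_ops : seq {linear V -> V} := [seq gt_T a | a <- enum 'I_r].

Lemma in_gt_opsP t : List.In t gt_ops <-> exists a, t = gt_T a.
Proof.
rewrite /gt_ops List.in_map_iff; split=> [[a [<- _]]|[a ->]]; first by exists a.
exists a; split=> //.
by apply/In_mem; rewrite mem_enum.
Qed.

Lemma gt_ops_comm : comm_list gt_ops.
Proof. by move=> t u /in_gt_opsP[a ->] /in_gt_opsP[b ->] v; apply: gt_TC. Qed.

Lemma gt_graded l : graded gt_ops (gt_piece l).
Proof.
split=> [k|t /in_gt_opsP[a ->] k v gv]; first exact: gt_is_sub.
by rewrite /gt_piece /mkset gt_proj_T gv.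
Qed.

(** Generators are the free generators tensored with generators of [N]. The span property of [N] is
    applied with the left factor already projected to degree [k]. *)
Lemma gt_fg l : graded_fg gt_ops (gt_piece l).
Proof.
have [g gN] := hN.
pose L := [seq (nth 0%N (dg l) j, tens (<< (j, mon0 r) >> : F) y) | j <- iota 0 (size (dg l)), y <- g].
have inL p : List.In p L <-> exists j y,
    [/\ (j < size (dg l))%N, y \in g & p = (nth 0%N (dg l) j, tens (<< (j, mon0 r) >> : F) y)].
  rewrite /L; split.
    move=> /List.in_concat[q [/List.in_map_iff[j [<- /List.in_seq[_ /ltP jl]]] /List.in_map_iff[y [<- yg]]]].
    exists j, y; split=> //.
    exact/In_mem.
  move=> [j [y [jl yg ->]]]; apply/List.in_concat.
  exists [seq (nth 0%N (dg l) j, tens (<< (j, mon0 r) >> : F) y) | y <- g]; split.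
    apply/List.in_map_iff; exists j; split=> //; apply/List.in_seq.
    by split; [exact/leP | apply/ltP].
  apply/List.in_map_iff; exists y; split=> //.
  exact/In_mem.
exists L => [p /inL[j [y [jl yg ->]]]|X [SX TX] LX k v <-].
  by rewrite /gt_piece /mkset gt_projE (piece_gen R r jl).
move: v; apply: (@tensor_ind _ _ _ [set v | X k (gt_proj l k v)]).
  exact: (preimage_is_sub (gt_proj l k) (SX k)).
move=> x y; rewrite /mkset gt_projE.
have : y \in Defs.span (fun v => is_true (v \in g)) by rewrite -gN.
move=> /asboolP/(_ (fun y => `[< X k (tens (gproj R r (dg l) k x) y) >])) H; apply/asboolP.
apply: H => [|z zg].
  split=> [|a u v /asboolP Xu /asboolP Xv]; apply/asboolP.
    by rewrite tens0r; apply: is_sub0.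
  by rewrite tensDr tensZr; apply: (SX k).2.
apply/asboolP.
have tz_lin : linear (fun x : F => tens x z) := (@tens_is_bilinear _ F N).1 z.
pose tz : {linear F -> V} := HB.pack (fun x : F => tens x z) (GRing.isLinear.Build _ _ _ _ _ tz_lin).
apply: (@piece_min _ _ (dg l) _ tz gt_T X) (piece_proj _ _ _) => //.
- by move=> a w; apply: esym; apply: tensor_mapE.
- by move=> a m w; apply: TX; apply/in_gt_opsP; exists a.
- move=> j jl; apply: (LX (nth 0%N (dg l) j, tens (<< (j, mon0 r) >> : F) z)).
  by apply/inL; exists j, z.
Qed.

Definition gt_bd l k : set V := gt_d l @` gt_piece l.+1 k.

Lemma gt_bd_graded l : graded gt_ops (gt_bd l).
Proof.
split=> [k|t tin k _ [v gv <-]]; first by apply: image_is_sub; apply: gt_is_sub.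
exists (t v); first exact: (gt_graded l.+1).2.
by move: tin => /in_gt_opsP[a ->]; apply: gt_dT.
Qed.

Lemma gt_bd_cyc l k v : gt_bd l k v -> gt_piece l k v /\ gt_d l.-1 v = 0.
Proof.
move=> [w gw <-]; split; first exact: gt_d_piece.
by case: l gw => [|l] gw; [exact: gt_d0 | exact: gt_dd gw].
Qed.

Lemma gt_d_pred l k v : gt_piece l k v -> gt_piece l.-1 k (gt_d l.-1 v).
Proof.
case: l => [|l] gv; last exact: gt_d_piece.
by rewrite /= gt_d0; apply: is_sub0; apply: gt_is_sub.
Qed.

(* [mod_cyc l k m / mod_bd l k m] is the homology at level [l] of the degree [k] strand modulo [I^m]. *)
Definition mod_cyc l k m := cycm f (gt_d l.-1) (gt_piece l) (gt_piece l.-1) k m.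
Definition mod_bd l k m := bdrm f (gt_piece l) (gt_bd l) k m.

Lemma mod_cyc_sub l k m : is_sub (mod_cyc l k m).
Proof. exact: (cycm_sub f (gt_d l.-1) (gt_graded l) (gt_graded l.-1)). Qed.

Lemma mod_bd_sub l k m : is_sub (mod_bd l k m).
Proof. exact: (bdrm_sub f (gt_graded l) (gt_bd_graded l)). Qed.

Lemma mod_bd_cyc l k m : mod_bd l k m `<=` mod_cyc l k m.
Proof.
apply: sub_add_min => [|v /gt_bd_cyc[gv dv]|v Iv]; first exact: mod_cyc_sub.
  by split=> //; rewrite dv; apply: is_sub0; apply: ipow_is_sub; apply: gt_is_sub.
split; first exact: (ipow_le (gt_is_sub l k) Iv).
by apply: ipow_map Iv => w; apply: gt_d_pred.
Qed.

End GradedTensor.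

(** The homotopy identity is given on the image of [e] only; it passes to [v] because [v] is fixed
    by the tensored [e]. *)
Lemma tensor_homotopy (R : comNzRingType) (F N : lmodType R) (e d1 h1 d0 h0 : {linear F -> F})
    (y : R) (v : tensor F N) :
  (forall x, y *: e x = d1 (h1 (e x)) + h0 (d0 (e x))) -> tensor_map N e v = v ->
  y *: v = tensor_map N d1 (tensor_map N h1 v) + tensor_map N h0 (tensor_map N d0 v).
Proof.
move=> H <-; move: v.
apply: (@tensor_ext _ _ _ _ (scl y \o tensor_map N e)
  ((tensor_map N d1 \o tensor_map N h1 \o tensor_map N e)
   \+ (tensor_map N h0 \o tensor_map N d0 \o tensor_map N e))) => x w.
by rewrite /= /scl !tensor_mapE -tensZl H tensDl.
Qed.

Section ConstantFamily.
Context (R : comNzRingType) (hR : noetherian R) (r : nat) (f : 'I_r -> R) (V : lmodType R).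
Context (d : {linear V -> V}) (G G' B : nat -> set V) (k : nat).
Hypotheses (SG : is_sub (G k)) (SG' : is_sub (G' k)) (SB : is_sub (B k)).
Hypotheses (fgG : sub_fg (G k)) (fgG' : sub_fg (G' k)).
Hypothesis dG : forall v, G k v -> G' k (d v).
Hypothesis BG : forall v, B k v -> G k v /\ d v = 0.
Hypothesis fin : forall m, fin_len (bdrm f G B k m) (cycm f d G G' k m).

(** A fixed degree [k] becomes a family constant in [n] with the identity as its operator, so that
    only the exponent of I varies and [homology_poly] applies. *)
Lemma const_homology_poly : ev_poly (fun n => (len (bdrm f G B k n) (cycm f d G G' k n))%:R).
Proof.
pose id1 : seq {linear V -> V} := [:: (idfun : {linear V -> V})].
have C1 : comm_list id1 by move=> t u [<-|//] [<-|//].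
have g1 (S : set V) : is_sub S -> graded id1 (fun=> S) by move=> SS; split=> // t [<-|//].
have fg1 (S : set V) : sub_fg S -> graded_fg id1 (fun=> S).
  move=> [g gS Sg].
  exists [seq (0%N, x) | x <- g] => [p /List.in_map_iff[x [<- /gS]]//|X [SX TX] gX n x Gx].
  elim: n => [|n IH]; last by apply: (TX idfun) IH; left.
  apply: (Sg _ Gx _ (SX 0%N)) => y yg.
  by apply: (gX (0%N, y)); apply/List.in_map_iff; exists y.
apply: (homology_poly hR (f := f) (d := d) C1 (g1 _ SG) (g1 _ SG') (g1 _ SB) (fg1 _ fgG) (fg1 _ fgG')).
- by move=> t [<-|//].
- by move=> n v; apply: dG.
- by move=> n v; apply: BG.
- by move=> n m; apply: fin.
Qed.

End ConstantFamily.

(** * Strand homology modulo powers of the ideal: finite length and polynomial growth *)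

Section ModularHomology.
Context (R : comNzRingType) (hR : noetherian R) (P : {pred R}) (hP : maximal_ideal P).
Context (r : nat) (f : 'I_r -> R) (M N : lmodType R).
Hypothesis hN : fin_gen N.
Context (s : graded_res r M) (sp : graded_res_spec f s).
Hypothesis hrad : forall p, p \in P -> exists c (b : 'I_r -> R) y z,
  [/\ p ^+ c = \sum_a b a * f a + (y + z), forall w : M, y *: w = 0 & forall w : N, z *: w = 0].
Notation dg := (res_deg s).
Notation V := (tensor (gfree R r) N).
Notation gd := (gt_d N s).
Notation gphi := (gt_phi N s).
Notation G := (@gt_piece R r M N s).
Notation mod_cyc := (@mod_cyc R r f M N s).
Notation mod_bd := (@mod_bd R r f M N s).
Notation im l n m := (sub_add (gphi l @` mod_cyc l n m) (mod_bd l 0 m)).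

(** The homotopy writes [y *: v] as a boundary plus the image of [gd l v]; the latter lies in I^m,
    so its image does too. *)
Lemma annihilator_kills_homology l k m y : (forall w : M, y *: w = 0) -> y \in kill_into (mod_bd l.+1 k m) (mod_cyc l.+1 k m).
Proof.
move=> y0; apply/kill_intoP => v [gv dv].
have [h [h0 hp hE]] := annihilator_homotopy k sp y0.
have tmh j w : G j.+1 k (tensor_map N (h j) w).
  by apply: tm_comp => x; apply: hp.
have E : y *: v = gd l.+1 (tensor_map N (h l.+1) v) + tensor_map N (h l) (gd l v).
  apply: (@tensor_homotopy _ _ N (gproj R r (dg l.+1) k)) => // x.
  by apply: hE; apply: piece_proj.
exists (gd l.+1 (tensor_map N (h l.+1) v)), (tensor_map N (h l) (gd l v)); split; last exact: E.
  by exists (tensor_map N (h l.+1) v); [exact: tmh |].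
by apply: ipow_map dv => w _; apply: tmh.
Qed.

(** The parts of a power of [p] in the two annihilators kill the homology, and I^m carries cycles
    into I^m of the strand. Hence each of finitely many generators of [P] acts nilpotently. *)
Lemma mod_homology_fin l k m : fin_len (mod_bd l k m) (mod_cyc l k m).
Proof.
have SB := mod_bd_sub N sp l k m; have SC := mod_cyc_sub f N s l k m.
case: l SB SC => [|l] SB SC.
  rewrite (_ : mod_cyc 0 k m = mod_bd 0 k m); first exact: fin_len_refl.
  apply/seteqP; split; last exact: (mod_bd_cyc sp).
  by move=> v [/(gt0 sp) -> _]; apply: (is_sub0 SB).
have [|g gP] := hR (J := P); first by have [[P0 _ PP] _] := hP.
apply: (fin_len_nilpotent hP (L := g)) => //.
- exact: (mod_bd_cyc sp).
- move=> X SX XC; apply: (graded_fg_piece hR (@gt_ops_comm R r N) (gt_graded N s l.+1) (gt_fg hN s l.+1) SX).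
  by move=> x Xx; have [gx _] := XC x Xx; exact: gx.
- move=> J [J0 JP] KJ LJ p; rewrite gP => /asboolP; apply; first by split.
  by move=> a ag; apply: LJ; exact/In_mem.
move=> p pg; have Pp : p \in P.
  rewrite gP; apply/asboolP => S _; apply.
  exact/In_mem.
have [c [b [y [z [pE yM zN]]]]] := hrad Pp.
(* [p ^+ c] lies in I up to elements killing the homology, and [m] factors from I are needed to
   reach I^m. *)
exists (c * m)%N; rewrite exprM pE; apply: (kill_pow (f := f) SC SB erefl).
  apply/kill_intoP => v cv; rewrite scalerDl; apply: (is_subD SB).
    by have /kill_intoP := annihilator_kills_homology l k m yM; apply.
  suff -> : z *: v = 0 by apply: (is_sub0 SB).
  apply: (@tensor_ext _ _ _ _ (scl z) \0) => x w.
  by rewrite /= /scl -tensZr zN tens0r.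
move=> v Iv; apply: (sub_addr (image_is_sub _ (gt_is_sub N s _ _))).
by apply: (ipow_map (g := idfun)) Iv => w [].
Qed.

Lemma mod_homology_poly l : ev_poly (fun n => (len (mod_bd l n n) (mod_cyc l n n))%:R).
Proof.
apply: (homology_poly hR (@gt_ops_comm R r N) (gt_graded N s l) (gt_graded N s l.-1)
  (gt_bd_graded N sp l) (gt_fg hN s l) (gt_fg hN s l.-1)).
- by move=> t /in_gt_opsP[a ->] v; apply: (gt_dT sp).
- by move=> n v; apply: (gt_d_pred sp).
- by move=> n v; apply: (gt_bd_cyc sp).
- exact: mod_homology_fin.
Qed.

Lemma mod_homology_poly0 l : ev_poly (fun n => (len (mod_bd l 0 n) (mod_cyc l 0 n))%:R).
Proof.
have fg1 j : sub_fg (G j 0).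
  exact: (graded_fg_piece hR (@gt_ops_comm R r N) (gt_graded N s j) (gt_fg hN s j) (gt_is_sub N s j 0) (fun x => id)).
exact: (@const_homology_poly _ hR _ f _ (gd l.-1) (G l) (G l.-1) (@gt_bd R r M N s l) 0%N
  (gt_is_sub N s l 0) (gt_is_sub N s l.-1 0) (image_is_sub _ (gt_is_sub N s l.+1 0)) (fg1 l) (fg1 l.-1)
  (fun v => @gt_d_pred R r f M N s sp l 0 v) (fun v => @gt_bd_cyc R r f M N s sp l 0 v)
  (fun m => mod_homology_fin l 0 m)).
Qed.

Lemma im_sub_mod_cyc l n m : im l n m `<=` mod_cyc l 0 m.
Proof.
apply: sub_add_min; [exact: (mod_cyc_sub f N s) | | exact: (mod_bd_cyc sp)].
move=> _ [v [gv dv] <-]; split; first exact: (gt_phi_piece sp).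
case: l gv dv => [|l] gv dv.
  rewrite (gt0 sp gv) !linear0; apply: is_sub0; apply: ipow_is_sub; exact: gt_is_sub.
rewrite /= (gt_phi_d sp gv); apply: ipow_map dv => w _; exact: (gt_phi_piece sp).
Qed.

Lemma mod_image_poly l : ev_poly (fun n => (len (mod_bd l 0 n) (im l n n))%:R).
Proof.
apply: (@image_poly _ hR _ f _ (@gt_T R r N) (@gt_TC R r N) (gd l.-1) (gphi l) (G l) (G l.-1) (G l 0) (@gt_bd R r M N s l 0)).
- exact: gt_graded.
- exact: gt_graded.
- exact: gt_fg.
- exact: gt_fg.
- exact: gt_is_sub.
- by apply: image_is_sub; apply: gt_is_sub.
- by move=> a v; apply: (gt_dT sp).
- by move=> a v; apply: (gt_phiT sp).
move=> n m; have SB := mod_bd_sub N sp l 0 m.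
have Sim : is_sub (im l n m).
  by apply: sub_add_is_sub => //; apply: image_is_sub; apply: (mod_cyc_sub f N s).
by have /(fin_lenE SB Sim (mod_cyc_sub f N s l 0 m) (sub_addr (image_is_sub _ (mod_cyc_sub f N s l n m)))
  (@im_sub_mod_cyc l n m))[] := mod_homology_fin l 0 m.
Qed.

End ModularHomology.

(** * The length of the homology of the cone *)

Section ConeSets.
Context (R : comNzRingType) (r : nat) (f : 'I_r -> R) (N : lmodType R) (n : nat) (F : lmodType R).
Context (p0 p2 D Phi : nat -> {linear F -> F}).
Hypotheses (D0 : forall x, D 0 x = 0) (Phi0 : forall x, Phi 0 x = 0).
Notation V := (tensor F N).
Notation tm := (tensor_map N).
Notation fix_ p := ([set v : V | tm p v = v]).
Notation I_ S := (ipow f n S).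

Arguments tensor_map : simpl never.

Let fix_sub (p : {linear F -> F}) : is_sub (fix_ p).
Proof. exact: (fixed_is_sub (tm p)). Qed.

Let tmD0 v : tm (D 0) v = 0. Proof. exact: tensor_map0. Qed.
Let tmPhi0 v : tm (Phi 0) v = 0. Proof. exact: tensor_map0. Qed.

(** At level 0 the left side puts no condition on the differential, and on the right the conditions
    hold because [D 0] and [Phi 0] vanish. At higher levels the two sides differ by a sign. *)
Lemma cone_cyc_cl i : @cone_cyc R r f N n F (fun j => p0 j.+1) p2 D Phi i =
  cl_cyc (tm (D i)) (tm (D i.-1)) (tm (Phi i)) (fix_ (p0 i.+1)) (fix_ (p2 i))
    (I_ (fix_ (p0 i))) (I_ (fix_ (p2 i.-1))).
Proof.
have NS j x : I_ (fix_ (p2 j)) (- x) <-> I_ (fix_ (p2 j)) x.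
  have SI : is_sub (I_ (fix_ (p2 j))) by apply: ipow_is_sub; apply: fix_sub.
  by split=> [/(is_subN SI)|/(is_subN SI)//]; rewrite opprK.
apply/seteqP; split=> z; case: i => [|i].
- move=> [z1 z2 _]; split=> //.
    exact: (eq0_sub (ipow_is_sub f n (fix_sub (p0 0%N))) (etrans (congr2 +%R (tmD0 _) (tmPhi0 _)) (addr0 _))).
  exact: (eq0_sub (ipow_is_sub f n (fix_sub (p2 0%N))) (tmD0 _)).
- by move=> [z1 z2 [z3 /NS z4]].
- by move=> [z1 z2 _ _].
- by move=> [z1 z2 z3 z4]; split=> //; split=> //; apply/NS.
Qed.

Lemma cone_bd_cl i : @cone_bd R r f N n F (fun j => p0 j.+1) p2 D Phi i =
  cl_bd (tm (D i.+1)) (tm (D i)) (tm (Phi i.+1)) (fix_ (p0 i.+2)) (fix_ (p2 i.+1))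
    (I_ (fix_ (p0 i.+1))) (I_ (fix_ (p2 i))).
Proof.
apply/seteqP; split=> z.
  by move=> [y [u [y1 y2 u1 u2 ->]]]; exists y.1, y.2, u.1, u.2.
move=> [y1 [y2 [u1 [u2 [[Y1 Y2] U1 U2 E1 E2]]]]]; exists (y1, y2), (u1, u2); split=> //.
exact: injective_projections.
Qed.

End ConeSets.

(** * Polynomial growth for the cone and for Tor *)

Section ConePoly.
Context (R : comNzRingType) (hR : noetherian R) (P : {pred R}) (hP : maximal_ideal P).
Context (r : nat) (f : 'I_r -> R) (M N : lmodType R).
Hypothesis hN : fin_gen N.
Context (s : graded_res r M) (sp : graded_res_spec f s).
Hypothesis hrad : forall p, p \in P -> exists c (b : 'I_r -> R) y z,
  [/\ p ^+ c = \sum_a b a * f a + (y + z), forall w : M, y *: w = 0 & forall w : N, z *: w = 0].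
Notation dg := (res_deg s).
Notation gd := (gt_d N s).
Notation gphi := (gt_phi N s).
Notation G := (@gt_piece R r M N s).
Notation mod_cyc := (@mod_cyc R r f M N s).
Notation mod_bd := (@mod_bd R r f M N s).
Notation im l n m := (sub_add (gphi l @` mod_cyc l n m) (mod_bd l 0 m)).
Notation J l k n := (ipow f n (G l k)).

Let hfin l k m : fin_len (mod_bd l k m) (mod_cyc l k m).
Proof. exact: (@mod_homology_fin R hR P hP r f M N hN s sp hrad l k m). Qed.

Let SG l k : is_sub (G l k) := gt_is_sub N s l k.
Let SJ l k n : is_sub (J l k n) := ipow_is_sub f n (SG l k).
Let JG l k n : J l k n `<=` G l k := ipow_le (SG l k).

Let d_J l k n v : J l k n v -> J l.-1 k n (gd l.-1 v).
Proof. by apply: ipow_map => w; exact: (gt_d_pred sp). Qed.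

Let phi_J l k n v : J l k n v -> J l 0 n (gphi l v).
Proof. by apply: ipow_map => w _; exact: (gt_phi_piece sp). Qed.

Let phi_d l k v : G l.+1 k v -> G l.+1 0 (gphi l.+1 v) /\ gd l (gphi l.+1 v) = gphi l (gd l v).
Proof. by move=> gv; split; [exact: (gt_phi_piece sp) | exact: (gt_phi_d sp gv)]. Qed.

Definition cone_len_bd i n := cl_bd (gd i.+1) (gd i) (gphi i.+1) (G i.+2 0) (G i.+1 n) (J i.+1 0 n) (J i n n).
Definition cone_len_cyc i n := cl_cyc (gd i) (gd i.-1) (gphi i) (G i.+1 0) (G i n) (J i 0 n) (J i.-1 n n).

Let bd_cyc l k v : G l.+1 k v -> G l k (gd l v) /\ gd l.-1 (gd l v) = 0.
Proof. by move=> gv; apply: (gt_bd_cyc sp); exists v. Qed.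

Lemma cone_homology_fin i n : fin_len (cone_len_bd i n) (cone_len_cyc i n).
Proof.
exact: (cl_fin (SG i.+2 0) (SG i.+1 0) (SG i.+1 n) (SG i n) (SJ i.+1 0 n) (SJ i 0 n) (SJ i n n)
  (SJ i.-1 n n) (@JG i.+1 0 n) (@JG i n n) (@bd_cyc i.+1 0) (@bd_cyc i n) (@d_J i.+1 0 n) (@d_J i n n)
  (@phi_d i n) (@phi_J i n n) (hfin i.+1 0 n) (hfin i n n)).
Qed.

Lemma cone_homology_len i n :
  (len (cone_len_bd i n) (cone_len_cyc i n) + len (mod_bd i.+1 0 n) (im i.+1 n n) + len (mod_bd i 0 n) (im i n n) =
   len (mod_bd i.+1 0 n) (mod_cyc i.+1 0 n) + len (mod_bd i n n) (mod_cyc i n n))%N.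
Proof.
exact: (cl_len (SG i.+2 0) (SG i.+1 0) (SG i.+1 n) (SG i n) (SJ i.+1 0 n) (SJ i 0 n) (SJ i n n)
  (SJ i.-1 n n) (@JG i.+1 0 n) (@JG i n n) (@bd_cyc i.+1 0) (@bd_cyc i n) (@d_J i.+1 0 n) (@d_J i n n)
  (@phi_d i n) (@phi_J i n n) (hfin i.+1 0 n) (hfin i n n)).
Qed.

Lemma cone_homology_poly i : ev_poly (fun n => (len (cone_len_bd i n) (cone_len_cyc i n))%:R).
Proof.
have E1 := @mod_homology_poly0 R hR P hP r f M N hN s sp hrad i.+1.
have E2 := @mod_homology_poly R hR P hP r f M N hN s sp hrad i.
have E3 := @mod_image_poly R hR P hP r f M N hN s sp hrad i.+1.
have E4 := @mod_image_poly R hR P hP r f M N hN s sp hrad i.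
apply: (@ev_poly_ext 0%N) (ev_polyB (ev_polyB (ev_polyD E1 E2) E3) E4) => n _.
by rewrite -natrD -cone_homology_len !natrD addrAC addrK addrK.
Qed.

Lemma cone_homologyE i n :
  @cone_bd R r f N n (gfree R r) (fun j => gproj R r (dg j.+1) 0) (fun j => gproj R r (dg j) n) (res_d s) (res_phi s) i
    = cone_len_bd i n /\
  @cone_cyc R r f N n (gfree R r) (fun j => gproj R r (dg j.+1) 0) (fun j => gproj R r (dg j) n) (res_d s) (res_phi s) i
    = cone_len_cyc i n.
Proof.
split; first exact: (@cone_bd_cl R r f N n (gfree R r) (fun j => gproj R r (dg j) 0) (fun j => gproj R r (dg j) n)
  (res_d s) (res_phi s) i).
exact: (@cone_cyc_cl R r f N n (gfree R r) (fun j => gproj R r (dg j) 0) (fun j => gproj R r (dg j) n)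
  (res_d s) (res_phi s) (res_d0 sp) (res_phi0 sp) i).
Qed.

Lemma Tor_len_poly (i : nat) (X Y : nat -> lmodType R) (piM : forall n, {linear M -> X n})
    (piN : forall n, {linear N -> Y n}) :
  (forall n x, exists m, piM n m = x) -> (forall n m, piM n m = 0 <-> ipow f n [set: M] m) ->
  (forall n x, exists m, piN n m = x) -> (forall n m, piN n m = 0 <-> ipow f n [set: N] m) ->
  exists2 g : nat -> nat, ev_poly (fun n => (g n)%:R) & forall n, has_length (Tor i (X n) (Y n)) (g n).
Proof.
move=> sM kM sN kN; exists (fun n => len (cone_len_bd i n) (cone_len_cyc i n)); first exact: cone_homology_poly.
move=> n; apply/(Tor_cone_len sp (sM n) (kM n) (sN n) (kN n)).
by have [-> ->] := cone_homologyE i n; apply: lenP; apply: cone_homology_fin.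
Qed.

End ConePoly.

(** * Conclusion *)

Section IdealGenerators.
Context (R : comNzRingType) (I : {pred R}) (r : nat) (f : 'I_r -> R).
Hypothesis fI : forall a, f a \in I.
Hypothesis If : forall x, x \in I -> exists b : 'I_r -> R, x = \sum_a b a * f a.

Lemma ideal_powZ (V : lmodType R) n a (v : V) : a \in ideal_pow I n -> ipow f n [set: V] (a *: v).
Proof.
elim: n a v => [//|n IH] a v aI.
have SI m : is_sub (ipow f m [set: V]) by apply: ipow_is_sub; split.
pose S : {pred R^o} := fun c => `[< forall w : V, ipow f n.+1 [set: V] ((c : R) *: w) >].
suff /asboolP : a \in S by apply.
apply: (Defs.span_min _ _ aI) => [|_ [x [b [/If[c ->] bI ->]]]]; last first.
  apply/asboolP => w; rewrite -scalerA scaler_suml.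
  apply: is_sub_sum => // j _; rewrite -scalerA.
  by apply: is_subZ => //; apply: imul_gen (IH _ _ bI).
split=> [|c x y /asboolP xS /asboolP yS]; apply/asboolP => w; first by rewrite scale0r; apply: is_sub0.
by rewrite scalerDl -scalerA; apply: (SI n.+1).2.
Qed.

(** Reconciles the submodule spanned by products from the ideal I^n with the [n]-fold product by
    generators of I on which the graded families rely. *)
Lemma ideal_pow_ipow (V : lmodType R) n (w : V) :
  w \in scale_sub (ideal_pow I n) predT <-> ipow f n [set: V] w.
Proof.
have SI m : is_sub (ipow f m [set: V]) by apply: ipow_is_sub; split.
split=> [wI|].
  suff /asboolP : w \in (fun v => `[< ipow f n [set: V] v >] : bool) by [].
  apply: (Defs.span_min _ _ wI) => [|_ [a [v [aI _ ->]]]]; last exact/asboolP/ideal_powZ.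
  split=> [|c x y /asboolP xS /asboolP yS]; apply/asboolP; first exact: is_sub0.
  exact: (SI n).2.
elim: n w => [|n IH] w; first by move=> _; apply: Defs.sub_span; exists 1, w; rewrite scale1r.
move=> [g [gI ->]]; apply: rpred_sum => a _; move: (IH _ (gI a)) => {}gI.
pose S : {pred V} := fun v => f a *: v \in scale_sub (ideal_pow I n.+1) predT.
suff : g a \in S by [].
apply: (Defs.span_min _ _ gI) => [|_ [c [v [cI _ ->]]]]; last first.
  rewrite /S unfold_in scalerA; apply: Defs.sub_span; exists (f a * c), v; split=> //.
  by apply: Defs.sub_span; exists (f a), c.
split=> [|c x y xS yS]; rewrite /S unfold_in; first by rewrite scaler0 rpred0.
by rewrite scalerDr scalerA mulrC -scalerA rpredD // rpredZ.
Qed.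

Lemma quot_pow_surj (V : lmodType R) n (x : quot_pow I n V) : exists v, quotmod_pi _ v = x.
Proof. by exists (quotmod_repr x); apply: quotmod_reprK. Qed.

Lemma quot_pow_ker (V : lmodType R) n (v : V) :
  (quotmod_pi _ v : quot_pow I n V) = 0 <-> ipow f n [set: V] v.
Proof.
apply: iff_trans (ideal_pow_ipow n v); rewrite -[v in X in _ <-> X]subr0 -quotmod_piP linear0.
by split=> /eqP.
Qed.

End IdealGenerators.

Lemma ideal_generators (R : comNzRingType) (I : {pred R}) : noetherian R -> idealr_closed I ->
  exists r (f : 'I_r -> R), (forall a, f a \in I) /\
    forall x, x \in I -> exists b : 'I_r -> R, x = \sum_a b a * f a.
Proof.
move=> hR [I0 I1 IP]; have [|g gI] := hR I.
  by split=> // a x y; apply: IP.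
exists (size g), (fun a => nth 0 g a); split=> [a|x].
  by rewrite gI; apply: Defs.sub_span; apply: mem_nth.
rewrite gI => xg.
pose S : {pred R^o} := fun x => `[< exists b : 'I_(size g) -> R, x = \sum_a b a * nth 0 g a >].
suff /asboolP : x \in S by [].
apply: (Defs.span_min _ _ xg).
  split=> [|c u v /asboolP[b ->] /asboolP[b' ->]]; apply/asboolP.
    by exists (fun=> 0); rewrite big1 // => a _; rewrite mul0r.
  exists (fun a => c * b a + b' a); rewrite /GRing.scale /= mulr_sumr -big_split; apply: eq_bigr => a _.
  by rewrite mulrDl mulrA.
move=> y yg; apply/asboolP.
have yi : (index y g < size g)%N by rewrite index_mem.
exists (fun a => (a == Ordinal yi)%:R); rewrite (bigD1 (Ordinal yi)) //= eqxx mul1r nth_index //.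
by rewrite big1 ?addr0 // => a /negPf ->; rewrite mul0r.
Qed.

Theorem corollary7 (R : comNzRingType) (P I : {pred R}) (M N : lmodType R)
    (i : nat)
    (hR : noetherian R) (hP : local_ring P) (hI : idealr_closed I)
    (hM : fin_gen M) (hN : fin_gen N)
    (hprim : is_primary_to P
      (ideal_add (ideal_add I (annihilator M)) (annihilator N))) :
  exists (p : {poly rat}) (n0 : nat), forall n : nat, (n0 <= n)%N ->
    exists k : nat,
      has_length (Tor i (quot_pow I n M) (quot_pow I n N)) k /\
      k%:R = p.[n%:R].
Proof.
have [r [f [fI If]]] := ideal_generators hR hI.
have [s sp] := graded_res_exists hR f hM.
(* Membership in the radical, unfolded: a power of [p] splits into parts in I and in the two
   annihilators. *)
have hrad p : p \in P -> exists c (b : 'I_r -> R) y z,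
    [/\ p ^+ c = \sum_a b a * f a + (y + z), forall w : M, y *: w = 0 & forall w : N, z *: w = 0].
  rewrite -hprim.2 => /asboolP[c /asboolP[x [z [/asboolP[w [y [/If[b wE] /asboolP yM xE]]] /asboolP zN pE]]]].
  by exists c, b, y, z; rewrite pE xE wE addrA.
have [g [p [n0 gp]] gL] := Tor_len_poly hR hP.1 hN sp hrad i (quot_pow_surj (I := I) (V := M))
  (quot_pow_ker fI If (V := M)) (quot_pow_surj (I := I) (V := N)) (quot_pow_ker fI If (V := N)).
by exists p, n0 => n /gp gn; exists (g n).
Qed.
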